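(* (i) For every even integer $N\ge4$ and every $0<\delta<1$ there exist a closed $N$-dimensional Riemannian manifold $(M,g)$ and a one-dimensional totally geodesic foliation $\mathcal F$ of $M$ such that $K_{\mathrm{mix}}>0$, the leaves of $\mathcal F$ are closed geodesics and form a smooth circle fibration, the metric $g$ is not bundle-like with respect to this fibration, and $\delta_{\mathrm{mix}}(g,\mathcal F)>\delta$. (ii) Such examples are provided by the explicit almost $1$-pinched families described in the context, namely $(S^{4m-1}\times S^3,g_\varepsilon)$ in dimension $N=4m+2$ and $(S^{4m-1}\times S^1_i,g_\varepsilon|_{S^{4m-1}\times S^1_i})$ in dimension $N=4m$ ($m\ge1$), with the foliation generated by $u_1$: along each of these families $\delta_{\mathrm{mix}}\to1$ as $\varepsilon\to0^+$, and after rescaling each metric by a positive constant so that $\max K_{\mathrm{mix}}=1$, the lengths of the circle leaves converge to $2\pi$ as $\varepsilon\to0^+$.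
   Context: Closed means compact without boundary. For a foliation $\mathcal F$ of a Riemannian manifold $(M,g)$, a mixed plane is a 2-plane spanned by a vector tangent to $\mathcal F$ and a vector orthogonal to $\mathcal F$; $K_{\mathrm{mix}}$ denotes the sectional curvature of mixed planes, and $\delta_{\mathrm{mix}}(g,\mathcal F)=\min K_{\mathrm{mix}}/\max K_{\mathrm{mix}}$, with extrema over all mixed planes at all points. A foliation is totally geodesic if its leaves are totally geodesic submanifolds. The metric is bundle-like if locally the foliation is given by the fibers of a Riemannian submersion; for a one-dimensional geodesic foliation with local unit tangent field $T$ this is equivalent to $(\mathcal L_Tg)(U,V)=0$ for all $U,V\perp T$. General family of metrics. Let $m\ge1$, $A>C>0$, $D>0$. Let $g_0$ be the round metric of curvature $1$ on the unit sphere $S^{4m-1}\subset\mathbb H^m$, with $\xi_1(x)=xi$, $\xi_2(x)=xj$, $\xi_3(x)=xk$ and $\eta_\alpha=g_0(\xi_\alpha,\cdot)$. Put $L=2/\sqrt{AC}$, $M=2/A$, $g_{A,C}=L^2g_0+(M^2-L^2)\eta_2\otimes\eta_2$. The fields $u_1=\frac{\sqrt{AC}}2\xi_1$, $u_2=\frac A2\xi_2$, $u_3=\frac{\sqrt{AC}}2\xi_3$ are $g_{A,C}$-orthonormal; put $\beta_\alpha=g_{A,C}(u_\alpha,\cdot)$. Identify $S^3$ with the group $Sp(1)$ of unit quaternions, with the bi-invariant metric $g_{S^3}$ for which the left-invariant frame $v_1,v_2,v_3$, whose values at the identity are positive multiples of $i,j,k$ respectively, is orthonormal and satisfies $[v_1,v_2]=Dv_3$,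 $[v_2,v_3]=Dv_1$, $[v_3,v_1]=Dv_2$; put $\sigma_1=g_{S^3}(v_1,\cdot)$. Fields and forms are pulled back to $S^{4m-1}\times S^3$ without change of notation. For real $p,q\neq0$ with $p^2+q^2<1$ consider the metric $$g=g_{A,C}+g_{S^3}+p(\beta_1\otimes\sigma_1+\sigma_1\otimes\beta_1)+q(\beta_3\otimes\sigma_1+\sigma_1\otimes\beta_3)$$ on $S^{4m-1}\times S^3$. Let $S^1_i=\{a+bi:a^2+b^2=1\}\subset Sp(1)=S^3$. The field $u_1$ is tangent to $S^{4m-1}\times S^1_i$. Explicit families. Fix $p_0\in(0,1)$. For $\varepsilon>0$ let $g_\varepsilon$ be the metric $g_{A,C}+g_{S^3}+p(\beta_1\otimes\sigma_1+\sigma_1\otimes\beta_1)+q(\beta_3\otimes\sigma_1+\sigma_1\otimes\beta_3)$ on $S^{4m-1}\times S^3$ with parameters $C=1$, $A=1+\varepsilon$, $p=p_0$, $q=q_\varepsilon=r_\varepsilon h_\varepsilon$, $D=\sqrt{1+\varepsilon}/p_0$, where $r_\varepsilon>0$, $r_\varepsilon^2=\frac{1+\varepsilon}{\varepsilon(4+\varepsilon)}$ and $h_\varepsilon=\sqrt{\frac{1-p_0^2}{1+r_\varepsilon^2}}$ (then $p_0^2+q_\varepsilon^2<1$). *)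

(* Defs.v *)
From HB Require Import structures.
From mathcomp Require Import all_boot all_order all_algebra.
From mathcomp Require Import all_classical all_reals all_analysis.

Set Implicit Arguments.
Unset Strict Implicit.
Unset Printing Implicit Defensive.

Import Order.TTheory GRing.Theory Num.Theory.
Import numFieldNormedType.Exports.

Local Open Scope classical_set_scope.
Local Open Scope ring_scope.

Section Smoothness.
Context {R : realType}.

(* Iterated directional derivatives exist and are continuous.  All uses below
   have a finite-dimensional source ('rV_n, R, or 'rV_n * R) and an open D, where
   this is the usual C^k. *)
Fixpoint Ck (V W : normedModType R) (k : nat) (D : set V) (f : V -> W) : Prop :=
  (forall x, D x -> {for x, continuous f}) /\
  match k with
  | 0%N => True
  | k'.+1 => forall v : V,
      (forall x, D x -> derivable f x v) /\ Ck k' D (fun x => 'D_v f x)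
  end.

Definition smooth_on (V W : normedModType R) (D : set V) (f : V -> W) : Prop :=
  forall k, Ck k D f.

End Smoothness.

(* Riemannian geometry of a metric G on an open subset of R^n: G u is the matrix
   (g_ij(u)), and Gamma G u k i j is the Christoffel symbol Gamma^k_ij(u) of its
   Levi-Civita connection. *)
Section Coordinates.
Context {R : realType} {n : nat}.
Implicit Types (D : set 'rV[R]_n) (G : 'rV[R]_n -> 'M[R]_n) (u a b : 'rV[R]_n).

Definition partial (i : 'I_n) (f : 'rV[R]_n -> R) u : R :=
  'D_(delta_mx 0 i) f u.

Definition inner (H : 'M[R]_n) a b : R :=
  \sum_i \sum_j H i j * a 0 i * b 0 j.

Definition metric_on D G : Prop :=
  [/\ forall i j, smooth_on D (fun u => G u i j),
      forall u, D u -> (G u)^T = G u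
    & forall u a, D u -> a != 0 -> 0 < inner (G u) a a].

Definition Gamma G u (k i j : 'I_n) : R :=
  2^-1 * \sum_l invmx (G u) k l *
    (partial i (fun w => G w j l) u + partial j (fun w => G w i l) u
     - partial l (fun w => G w i j) u).

(* R(d_i, d_j) d_k = \sum_l Riem G u l i j k d_l, where
   R(X, Y) = [nabla_X, nabla_Y] - nabla_[X, Y] *)
Definition Riem G u (l i j k : 'I_n) : R :=
  partial i (fun w => Gamma G w l j k) u - partial j (fun w => Gamma G w l i k) u
  + \sum_s (Gamma G u l i s * Gamma G u s j k - Gamma G u l j s * Gamma G u s i k).

(* g(R(a, b) b, a) / (|a|^2 |b|^2 - g(a, b)^2) *)
Definition sec G u a b : R :=
  (\sum_i \sum_j \sum_k \sum_l \sum_s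
     G u l s * Riem G u l i j k * a 0 i * b 0 j * b 0 k * a 0 s) /
  (inner (G u) a a * inner (G u) b b - inner (G u) a b ^+ 2).

End Coordinates.

(* Manifolds are smooth submanifolds M of an ambient normed space V, with an
   arbitrary (not necessarily induced) Riemannian metric
   g : V -> V -> V -> R.  Only the values g x v w with x in M and v, w in T_x M
   are relevant. *)
Section Submanifolds.
Context {R : realType} {V : normedModType R}.
Implicit Types (n : nat) (M : set V) (g : V -> V -> V -> R) (F : V -> set V).

(* phi is a smooth immersion of the open set D and a homeomorphism onto a
   relatively open subset of M *)
Definition parametrization n M (D : set 'rV[R]_n) (phi : 'rV[R]_n -> V) : Prop :=
  [/\ open D,
      smooth_on D phi,
      forall u a, D u -> 'D_a phi u = 0 -> a = 0,
      {in D &, injective phi}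
    & forall O : set 'rV[R]_n, open O -> O `<=` D ->
        exists2 W : set V, open W & phi @` O = M `&` W].

Definition submanifold n M : Prop :=
  forall x, M x -> exists (D : set 'rV[R]_n) (phi : 'rV[R]_n -> V),
    parametrization M D phi /\ (phi @` D) x.

Definition closed_manifold n M : Prop := compact M /\ submanifold n M.

End Submanifolds.

Section RiemannianManifolds.
Context {R : realType} {V : normedModType R}.
Implicit Types (n : nat) (M : set V) (g : V -> V -> V -> R) (F : V -> set V).

Definition smooth_map n M (W : normedModType R) (f : V -> W) : Prop :=
  forall (D : set 'rV[R]_n) phi, parametrization M D phi ->
    smooth_on D (f \o phi).

Definition gram n g (phi : 'rV[R]_n -> V) (u : 'rV[R]_n) : 'M[R]_n :=
  \matrix_(i, j) g (phi u) ('D_(delta_mx 0 i) phi u) ('D_(delta_mx 0 j) phi u).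

(* the second conjunct says that g is bilinear on each tangent space *)
Definition riemannian n M g : Prop :=
  forall (D : set 'rV[R]_n) phi, parametrization M D phi ->
    metric_on D (gram g phi) /\
    forall u a b, D u ->
      g (phi u) ('D_a phi u) ('D_b phi u) = inner (gram g phi u) a b.

(* v and w are tangent to M at x and span a plane of sectional curvature k *)
Definition sect_curv n M g (x v w : V) (k : R) : Prop :=
  exists (D : set 'rV[R]_n) (phi : 'rV[R]_n -> V) (u a b : 'rV[R]_n),
    [/\ parametrization M D phi, D u & phi u = x] /\
    [/\ 'D_a phi u = v, 'D_b phi u = w & k = sec (gram g phi) u a b].

Definition geodesic_on n M g (J : set R) (c : R -> V) : Prop :=
  forall (D : set 'rV[R]_n) phi (I : set R) (u : R -> 'rV[R]_n),
    parametrization M D phi -> open I -> I `<=` J -> smooth_on I u ->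
    (forall t, I t -> D (u t) /\ phi (u t) = c t) ->
    forall t k, I t ->
      derive1 (derive1 u) t 0 k
      + \sum_i \sum_j Gamma (gram g phi) (u t) k i j
                      * derive1 u t 0 i * derive1 u t 0 j = 0.

(* A one-dimensional foliation is given by its tangent line field
   F x = T_x(leaf), which is smooth; integrability is automatic in rank one. *)
Definition foliation1 n M F : Prop :=
  forall x, M x ->
    exists (D : set 'rV[R]_n) (phi : 'rV[R]_n -> V) (X : 'rV[R]_n -> 'rV[R]_n),
      [/\ parametrization M D phi, (phi @` D) x, smooth_on D X
        & forall u, D u -> X u != 0 /\
            F (phi u) = [set v | exists s : R, v = s *: 'D_(X u) phi u]].

Definition tangent_curve M F (J : set R) (c : R -> V) : Prop :=
  smooth_on J c /\ forall t, J t -> M (c t) /\ F (c t) (derive1 c t).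

Definition unit_speed g (J : set R) (c : R -> V) : Prop :=
  forall t, J t -> g (c t) (derive1 c t) (derive1 c t) = 1.

Definition leaf M F (x : V) : set V :=
  [set y | exists c : R -> V, [/\ tangent_curve M F setT c, c 0 = x & c 1 = y]].

(* Every geodesic of a leaf is a geodesic of M; the geodesics of a
   one-dimensional leaf are, up to affine reparametrization, its unit-speed
   curves. *)
Definition totally_geodesic n M g F : Prop :=
  forall (J : set R) (c : R -> V), open J ->
    tangent_curve M F J c -> unit_speed g J c -> geodesic_on n M g J c.

Definition mixed_curvatures n M g F : set R :=
  [set k | exists x v w : V,
     [/\ F x v, v != 0, w != 0, forall v', F x v' -> g x v' w = 0
       & sect_curv n M g x v w k]].

Definition is_min (S : set R) (a : R) : Prop := S a /\ lbound S a.
Definition is_max (S : set R) (a : R) : Prop := S a /\ ubound S a.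

Definition is_delta_mix n M g F (r : R) : Prop :=
  exists a b, [/\ is_min (mixed_curvatures n M g F) a,
                  is_max (mixed_curvatures n M g F) b & r = a / b].

Definition simple_loop (c : R -> V) (l : R) : Prop :=
  [/\ 0 < l, forall t, c (t + l) = c t
    & forall s t, 0 <= s < l -> 0 <= t < l -> c s = c t -> s = t].

(* the leaf through x is a circle of length l, parametrized by c *)
Definition circle_leaf M g F (x : V) (c : R -> V) (l : R) : Prop :=
  [/\ tangent_curve M F setT c, unit_speed g setT c, simple_loop c l
    & range c = leaf M F x].

Definition leaf_length M g F (x : V) (l : R) : Prop :=
  exists c, circle_leaf M g F x c l.

Definition leaves_closed_geodesics n M g F : Prop :=
  forall x, M x ->
    exists c l, circle_leaf M g F x c l /\ geodesic_on n M g setT c.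

(* The leaves are the fibres of a smooth, locally trivial circle bundle
   pr : M -> B over a manifold B of dimension n - 1.  Over the coordinate
   neighbourhood psi @` D of B the trivialization is Psi, the factor
   S^1 = R / 2 pi Z being parametrized by the angle: Psi induces a smooth
   bijective immersion from D * S^1 onto the preimage of psi @` D, hence a
   diffeomorphism, since both have dimension n. *)
Definition smooth_circle_fibration n M F : Prop :=
  exists (W : normedModType R) (B : set W) (pr : V -> W),
    [/\ submanifold n.-1 B, smooth_map n M pr, pr @` M = B,
        forall x, M x -> leaf M F x = [set y | M y /\ pr y = pr x]
      & forall b, B b ->
          exists (D : set 'rV[R]_(n.-1)) (psi : 'rV[R]_(n.-1) -> W)
                 (Psi : 'rV[R]_(n.-1) * R -> V),
          [/\ parametrization B D psi, (psi @` D) b,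
              smooth_on (D `*` setT) Psi
            & forall y t, D y -> forall a, 'D_a Psi (y, t) = 0 -> a = 0] /\
          [/\ forall y t, D y -> M (Psi (y, t)) /\ pr (Psi (y, t)) = psi y,
              forall x, M x -> (psi @` D) (pr x) ->
                exists y t, D y /\ Psi (y, t) = x
            & forall y s t, D y -> (Psi (y, s) = Psi (y, t) <->
                exists k : int, s - t = k%:~R * (2 * pi))]].

(* locally, F consists of the tangent lines of the fibres of a Riemannian
   submersion f onto an open subset of (O, h), O open in R^(n - 1) *)
Definition bundle_like n M g F : Prop :=
  forall x, M x ->
    exists (D : set 'rV[R]_n) (phi : 'rV[R]_n -> V)
           (O : set 'rV[R]_(n.-1)) (h : 'rV[R]_(n.-1) -> 'M[R]_(n.-1))
           (f : 'rV[R]_n -> 'rV[R]_(n.-1)),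
    [/\ parametrization M D phi, (phi @` D) x, open O & metric_on O h] /\
    [/\ smooth_on D f, f @` D `<=` O,
        forall u a, D u -> ('D_a f u = 0 <-> F (phi u) ('D_a phi u))
      & forall u a b, D u ->
          (forall v, F (phi u) v -> g (phi u) v ('D_a phi u) = 0) ->
          (forall v, F (phi u) v -> g (phi u) v ('D_b phi u) = 0) ->
          g (phi u) ('D_a phi u) ('D_b phi u) = inner (h (f u)) ('D_a f u) ('D_b f u)].

Record mixed_positive_example n M g F : Prop := MixedPositiveExample {
  mpe_closed : closed_manifold n M;
  mpe_riemannian : riemannian n M g;
  mpe_foliation : foliation1 n M F;
  mpe_totally_geodesic : totally_geodesic n M g F;
  mpe_Kmix_gt0 : forall k, mixed_curvatures n M g F k -> 0 < k;
  mpe_closed_geodesics : leaves_closed_geodesics n M g F;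
  mpe_circle_fibration : smooth_circle_fibration n M F;
  mpe_not_bundle_like : ~ bundle_like n M g F }.

Definition rescale (s : R) g : V -> V -> V -> R := fun x v w => s * g x v w.

End RiemannianManifolds.

Section Quaternions.
Context {R : realType}.

Definition o0 : 'I_4 := @Ordinal 4 0 isT.
Definition o1 : 'I_4 := @Ordinal 4 1 isT.
Definition o2 : 'I_4 := @Ordinal 4 2 isT.
Definition o3 : 'I_4 := @Ordinal 4 3 isT.

(* the row (a, b, c, d) stands for a + b i + c j + d k *)
Definition qmul (x y : 'rV[R]_4) : 'rV[R]_4 :=
  let a := x 0 o0 in let b := x 0 o1 in let c := x 0 o2 in let d := x 0 o3 in
  let a' := y 0 o0 in let b' := y 0 o1 in let c' := y 0 o2 in let d' := y 0 o3 in
  \row_s nth 0 [:: a * a' - b * b' - c * c' - d * d';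
                   a * b' + b * a' + c * d' - d * c';
                   a * c' - b * d' + c * a' + d * b';
                   a * d' + b * c' - c * b' + d * a'] s.

Definition qi : 'rV[R]_4 := delta_mx 0 o1.
Definition qj : 'rV[R]_4 := delta_mx 0 o2.
Definition qk : 'rV[R]_4 := delta_mx 0 o3.

(* an m-by-4 matrix is a vector of H^m, its rows being the coordinates *)
Definition rmulq m (x : 'M[R]_(m, 4)) (q : 'rV[R]_4) : 'M[R]_(m, 4) :=
  \matrix_(r, s) qmul (row r x) q 0 s.

Definition dot m (x y : 'M[R]_(m, 4)) : R := \sum_r \sum_s x r s * y r s.

End Quaternions.

(* The ambient space of S^(4m-1) * S^3 is H^m * H.  A point is x = (x.1, x.2);
   so is a tangent vector. *)
Section Metrics.
Context {R : realType} (m : nat) (A C D p q : R).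
Local Notation E := ('M[R]_(m, 4) * 'rV[R]_4)%type.

Definition xi1 (x : 'M[R]_(m, 4)) := rmulq x qi.
Definition xi2 (x : 'M[R]_(m, 4)) := rmulq x qj.
Definition xi3 (x : 'M[R]_(m, 4)) := rmulq x qk.

Definition gAC (x v w : 'M[R]_(m, 4)) : R :=
  let L := 2 / Num.sqrt (A * C) in
  let M := 2 / A in
  L ^+ 2 * dot v w + (M ^+ 2 - L ^+ 2) * (dot (xi2 x) v * dot (xi2 x) w).

Definition u1 (x : 'M[R]_(m, 4)) := (Num.sqrt (A * C) / 2) *: xi1 x.
Definition u3 (x : 'M[R]_(m, 4)) := (Num.sqrt (A * C) / 2) *: xi3 x.
Definition beta1 (x v : 'M[R]_(m, 4)) : R := gAC x (u1 x) v.
Definition beta3 (x v : 'M[R]_(m, 4)) : R := gAC x (u3 x) v.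

(* The left-invariant fields y |-> y i, y j, y k satisfy [y i, y j] = 2 y k
   and cyclically, so the positive multiples v_a with [v_1, v_2] = D v_3 and
   cyclically are (D / 2) y i, (D / 2) y j, (D / 2) y k, and the metric making
   them orthonormal is (2 / D)^2 times the round one. *)
Definition gS3 (y v w : 'rV[R]_4) : R := (2 / D) ^+ 2 * dot v w.
Definition v1 (y : 'rV[R]_4) : 'rV[R]_4 := (D / 2) *: qmul y qi.
Definition sigma1 (y v : 'rV[R]_4) : R := gS3 y (v1 y) v.

Definition g_family (x v w : E) : R :=
  gAC x.1 v.1 w.1 + gS3 x.2 v.2 w.2
  + p * (beta1 x.1 v.1 * sigma1 x.2 w.2 + sigma1 x.2 v.2 * beta1 x.1 w.1)
  + q * (beta3 x.1 v.1 * sigma1 x.2 w.2 + sigma1 x.2 v.2 * beta3 x.1 w.1).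

Definition u1_foliation (x : E) : set E :=
  [set v | exists s : R, v = s *: ((u1 x.1, 0) : E)].

End Metrics.

Section ExplicitFamilies.
Context {R : realType} (m : nat).
Local Notation E := ('M[R]_(m, 4) * 'rV[R]_4)%type.

Definition sphere_S3 : set E := [set x | dot x.1 x.1 = 1 /\ dot x.2 x.2 = 1].

Definition sphere_S1i : set E :=
  [set x | [/\ sphere_S3 x, x.2 0 o2 = 0 & x.2 0 o3 = 0]].

Definition r_eps (eps : R) : R := Num.sqrt ((1 + eps) / (eps * (4 + eps))).

Definition h_eps (p0 eps : R) : R :=
  Num.sqrt ((1 - p0 ^+ 2) / (1 + r_eps eps ^+ 2)).

Definition g_eps (p0 eps : R) : E -> E -> E -> R :=
  g_family (1 + eps) 1 (Num.sqrt (1 + eps) / p0) p0 (r_eps eps * h_eps p0 eps).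

Definition F_eps (eps : R) : E -> set E := u1_foliation (1 + eps) 1.

(* The limits are taken uniformly over the leaves; len eps x is the length of
   the leaf through x after rescaling g_eps by scale eps. *)
Definition almost_1_pinched (N : nat) (M : set E) (p0 : R) : Prop :=
  [/\ forall eps, 0 < eps ->
        mixed_positive_example N M (g_eps p0 eps) (F_eps eps),
      exists delta_mix : R -> R,
        (forall eps, 0 < eps ->
          is_delta_mix N M (g_eps p0 eps) (F_eps eps) (delta_mix eps)) /\
        delta_mix eps @[eps --> 0^'+] --> (1 : R)
    & exists (scale : R -> R) (len : R -> E -> R),
        (forall eps, 0 < eps ->
          let g := rescale (scale eps) (g_eps p0 eps) in
          [/\ 0 < scale eps,
              is_max (mixed_curvatures N M g (F_eps eps)) 1
            & forall x, M x -> leaf_length M g (F_eps eps) x (len eps x)]) /\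
        (forall e, 0 < e -> \forall eps \near (0 : R)^'+,
          forall x, M x -> `|len eps x - 2 * pi| < e)].

End ExplicitFamilies.

(* Main.v *)
(** The leaves are orbits of the linear circle action generated by [K = u_1], a
    unit field for [g] whose dual form [theta] satisfies [d theta (K, .) = 0], so
    that [K] is geodesic.  All metrics here are restrictions of polynomial fields
    of bilinear forms on the ambient space, and for [w] orthogonal to [K] one has
    [nabla_w K = S w] with [2 g (S w, z) = (L_K g) (w, z) + (d theta) (w, z)] and
    [g (R (w, K) K, w) = |S w|^2 - (L_K L_K g) (w, w) / 2].  For the explicit
    parameters this quadratic form is diagonal, with eigenvalues [(1 + eps) / 4]
    and [(1 + tau) / 4], [tau = eps (1 + eps) / (4 + eps)], up to a block in
    [(beta_3, sigma_1)] with eigenvalues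
    [(2 + 5 eps -+ 3 sqrt (eps^2 + 4 tau)) / 8]; these are the extrema, and all
    tend to [1 / 4] while the leaves have length [4 pi / sqrt (1 + eps)].
    The metric is not bundle-like because [(L_K g) (u_2, u_3) = C - A].  The
    fibration is the Hopf fibration [x |-> x x^*] with base a set of rank-one
    hermitian projections, charted by slices orthogonal to [x i]. *)

Require Import Defs.
From HB Require Import structures.
From mathcomp Require Import all_boot all_order all_algebra.
From mathcomp Require Import all_classical all_reals all_analysis.
From mathcomp Require Import ring lra.
Import Order.TTheory GRing.Theory Num.Theory.
Import numFieldNormedType.Exports.
Local Open Scope classical_set_scope.
Local Open Scope ring_scope.

Set Implicit Arguments.
Unset Strict Implicit.
Unset Printing Implicit Defensive.

(** * Directional derivatives *)

Section Directional.
Context {R : realType}.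

(** Curvature is defined by Christoffel symbols in arbitrary charts and smoothness by iterated
    directional derivatives, so the calculus is first rebuilt from these, and no curvature is
    computed in a particular chart. For a unit geodesic field the Jacobi operator involves only the
    covariant derivative of the field and two Lie derivatives; for a linear flow these pull back
    from ambient forms by differentiating [dphi (X) = K (phi)]. The shape operator is not derived: a
    candidate [raise] is written down and identified by the equation that determines it against all
    tangent vectors, which leaves rational identities in a few inner products. The parameters come
    from a normal form. With [p D = sqrt A] and [C = 1] the directions [v_2], [v_3] get the
    eigenvalue [A / 4] of the horizontal ones. In the coordinates [beta_3 + q sigma_1], [h sigma_1]
    the last diagonal entry is [r^2 eps (4 + eps) / 4], and [r_eps] is the value that makes it
    [A / 4] too. Both manifolds share one computation, because S preserves the tangent spaces of the
    product with the circle. *)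

Lemma scaler_R (k y : R) : k *: (y : R^o) = k * y.
Proof. by []. Qed.

Lemma derivable_cvg (V W : normedModType R) (f : V -> W) x v :
  derivable f x v ->
  h^-1 *: (f (h *: v + x) - f x) @[h --> (0 : R)^'] --> 'D_v f x.
Proof. by move=> /cvg_ex[l fl]; rewrite /derive (cvg_lim _ fl). Qed.

Lemma cvg_is_derive (V W : normedModType R) (f : V -> W) x v l :
  h^-1 *: (f (h *: v + x) - f x) @[h --> (0 : R)^'] --> l ->
  is_derive x v f l.
Proof.
move=> fl; split; first by apply/cvg_ex; exists l.
exact: (cvg_lim _ fl).
Qed.

Opaque derive derivable.

Lemma derivable_ray_cvg (V W : normedModType R) (f : V -> W) x v :
  derivable f x v -> f (h *: v + x) @[h --> (0 : R)^'] --> f x.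
Proof.
move=> /derivable_cvg fl.
have : h *: (h^-1 *: (f (h *: v + x) - f x)) + f x @[h --> (0 : R)^'] -->
    0 *: 'D_v f x + f x.
  apply: cvgD; last exact: cvg_cst.
  by apply: cvgZ => //; apply: cvg_within.
rewrite scale0r add0r; apply: cvg_trans; apply: near_eq_cvg.
near=> h; rewrite scalerA divff ?scale1r ?subrK//.
by near: h; exact: nbhs_dnbhs_neq.
Unshelve. all: by end_near. Qed.

Lemma is_derive_ray (V W : normedModType R) (f : V -> W) (x e : V) (s : R) :
  derivable f (x + s *: e) e ->
  is_derive s (1 : R) (fun t => f (x + t *: e)) ('D_e f (x + s *: e)).
Proof.
move=> /derivable_cvg fl; apply: cvg_is_derive; apply: cvg_trans fl.
apply: near_eq_cvg; near=> h => /=.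
by rewrite /= [h *: 1]mulr1 scalerDl [x + (_ + _)]addrCA.
Unshelve. all: by end_near. Qed.

Lemma dnbhs0M_cvg (k : R) : k != 0 -> h * k @[h --> (0 : R)^'] --> (0 : R)^'.
Proof.
move=> k0 P [/= r r0 rP]; exists (r / `|k|) => /=.
  by rewrite divr_gt0// normr_gt0.
move=> h; rewrite /ball_ /= sub0r normrN ltr_pdivlMr ?normr_gt0// => hr h0.
by apply: rP; rewrite ?mulf_neq0//= sub0r normrN normrM.
Qed.

(** Homogeneity in the direction holds as soon as [f] is derivable along [e]; additivity requires
    class C^1 and comes later, with [derive_dirP]. *)
Lemma is_deriveZv (V W : normedModType R) (f : V -> W) (x e : V) (k : R) :
  derivable f x e -> is_derive x (k *: e) f (k *: 'D_e f x).
Proof.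
move=> /derivable_cvg fl; have [->|k0] := eqVneq k 0.
  by rewrite !scale0r; exact: is_derive0.
apply: cvg_is_derive.
have : k *: ((h * k)^-1 *: (f ((h * k) *: e + x) - f x)) @[h --> (0 : R)^'] -->
    k *: 'D_e f x.
  by apply: cvgZl_tmp; apply: (cvg_comp _ _ (dnbhs0M_cvg k0) fl).
apply: cvg_trans; apply: near_eq_cvg; near=> h.
by rewrite !scalerA invfM [k * _]mulrC divfK.
Unshelve. all: by end_near. Qed.

(** Writing the intermediate parameter as [t * s] with [t] in [[0, 1]] covers steps [s] of either
    sign. *)
Lemma mean_value_ray (V : normedModType R) (f : V -> R) (x e : V) (s : R) :
  (forall t : R, 0 <= t <= 1 -> derivable f (x + (t * s) *: e) e) ->
  exists2 t : R, 0 <= t <= 1 &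
    f (x + s *: e) - f x = s * 'D_e f (x + (t * s) *: e).
Proof.
move=> df.
have ds (t : R) : 0 <= t <= 1 ->
    is_derive t (1 : R) (fun t => f (x + t *: (s *: e)))
    (s * 'D_e f (x + (t * s) *: e)).
  move=> /df dt; have [dst Est] := is_deriveZv s dt.
  have -> : s * 'D_e f (x + (t * s) *: e) = 'D_(s *: e) f (x + (t * s) *: e).
    by rewrite Est.
  have := @is_derive_ray V R f x (s *: e) t; rewrite scalerA.
  by move/(_ dst).
have [||t] := @MVT_segment R (fun t => f (x + t *: (s *: e)))
    (fun t => s * 'D_e f (x + (t * s) *: e)) 0 1 ler01.
- by move=> t; rewrite in_itv => /andP[t0 t1]; apply: ds; rewrite !ltW.
- apply: derivable_within_continuous => t; rewrite in_itv => t01.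
  by have := ds _ t01.
rewrite in_itv /= => t01; rewrite scale1r scale0r addr0 subr0 mulr1 => ->.
by exists t.
Qed.

(** The base point [y h] of the difference quotient moves too: the mean value theorem yields a
    derivative at a point squeezed towards [x], and continuity of ['D_e f] concludes. This is one
    edge of the coordinate path in [chain_cvg]. *)
Lemma mean_value_cvg (V : normedModType R) (f : V -> R) (D : set V) (x e : V)
    (y : R -> V) (c : R -> R) (l : R) :
  open D -> D x -> (forall z, D z -> derivable f z e) ->
  {for x, continuous ('D_e f)} ->
  y h @[h --> (0 : R)^'] --> x -> c h @[h --> (0 : R)^'] --> l ->
  h^-1 * (f (y h + (h * c h) *: e) - f (y h)) @[h --> (0 : R)^'] -->
    l * 'D_e f x.
Proof.
move=> oD Dx df fc yx cl.
have half_gt0 (e0 : R) : 0 < e0 -> 0 < e0 / 2 by move=> ?; rewrite divr_gt0.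
have [r r0 rD] : exists2 r : R, 0 < r & forall z, `|x - z| < r -> D z.
  have := open_nbhs_nbhs (conj oD Dx) => /nbhs_ballP[r /= r0 rD].
  by exists r => // z xz; apply: rD; rewrite -ball_normE.
have hc : (h * c h) *: e @[h --> (0 : R)^'] --> (0 : V).
  rewrite -[X in _ --> X](scale0r e) -[X in _ --> X *: _](mul0r l).
  by apply: cvgZr_tmp; apply: cvgM => //; apply: cvg_within.
pose good (h : R) z := `|z - x| <= `|y h - x| + `|(h * c h) *: e| /\
   h^-1 * (f (y h + (h * c h) *: e) - f (y h)) = c h * 'D_e f z.
have near_good : \forall h \near (0 : R)^', exists z, good h z.
  near=> h.
  have yr : `|x - y h| < r / 2.
    by near: h; move/cvgrPdist_lt : yx => /(_ _ (half_gt0 _ r0)).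
  have cr : `|(h * c h) *: e| < r / 2.
    near: h; move/cvgrPdist_lt : hc => /(_ _ (half_gt0 _ r0)).
    by apply: filterS => h; rewrite sub0r normrN.
  have tle (t : R) : 0 <= t <= 1 ->
      `|(t * (h * c h)) *: e| <= `|(h * c h) *: e|.
    move=> /andP[t0 t1]; rewrite -scalerA normrZ ger0_norm//.
    by rewrite ler_piMl.
  have [t t01 E] : exists2 t : R, 0 <= t <= 1 &
     f (y h + (h * c h) *: e) - f (y h) =
     (h * c h) * 'D_e f (y h + (t * (h * c h)) *: e).
    apply: mean_value_ray => t t01; apply/df/rD.
    rewrite opprD addrA (le_lt_trans (ler_normB _ _))// (splitr r).
    by rewrite ltrD// (le_lt_trans (tle _ t01)).
  exists (y h + (t * (h * c h)) *: e); split.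
    rewrite -addrAC (le_trans (ler_normD _ _))// lerD2l.
    exact: tle.
  rewrite E -mulrA mulKf//.
  by near: h; exact: nbhs_dnbhs_neq.
(* A choice of intermediate points; the default value [x] does no harm to the convergence of [z h]
   to [x]. *)
pose z h := if pselect (exists z, good h z) is left ex then sval (cid ex) else x.
have zx : z h @[h --> (0 : R)^'] --> x.
  apply/cvgrPdist_lt => eps eps0; near=> h.
  rewrite /z; case: pselect => [ex|]; last by rewrite subrr normr0.
  case: cid => /= w [+ _]; rewrite distrC => /le_lt_trans -> //.
  rewrite (splitr eps) ltrD//.
    near: h; move/cvgrPdist_lt : yx => /(_ _ (half_gt0 _ eps0)).
    by apply: filterS => h; rewrite distrC.
  near: h; move/cvgrPdist_lt : hc => /(_ _ (half_gt0 _ eps0)).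
  by apply: filterS => h; rewrite sub0r normrN.
have : c h * 'D_e f (z h) @[h --> (0 : R)^'] --> l * 'D_e f x.
  by apply: cvgM => //; apply: (cvg_comp _ _ zx fc).
apply: cvg_trans; apply: near_eq_cvg; near=> h.
rewrite /z; case: pselect => [ex|nex]; last by case: nex; near: h.
by case: cid => /= w [].
Unshelve. all: by end_near. Qed.

(** Two mean value steps, along [a] for the increment [f (h b + z) - f z] and then along [b] for
    ['D_a f], turn the second difference into a value of the mixed derivative near [x]. The second
    difference is symmetric in [a] and [b], whence [schwarz_scalar]. *)
Lemma second_difference_cvg (V : normedModType R) (f : V -> R) (D : set V)
    (x a b : V) :
  open D -> D x -> (forall z, D z -> derivable f z a) ->
  (forall z, D z -> derivable ('D_a f) z b) ->
  {for x, continuous ('D_b ('D_a f))} ->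
  h^-1 * (h^-1 * ((f (h *: b + (h *: a + x)) - f (h *: b + x)) -
    (f (h *: a + x) - f x))) @[h --> (0 : R)^'] --> 'D_b ('D_a f) x.
Proof.
move=> oD Dx da db fc.
have [r r0 rD] : exists2 r : R, 0 < r & forall z, `|x - z| < r -> D z.
  have := open_nbhs_nbhs (conj oD Dx) => /nbhs_ballP[r /= r0 rD].
  by exists r => // z xz; apply: rD; rewrite -ball_normE.
have half_gt0 (e0 : R) : 0 < e0 -> 0 < e0 / 2 by move=> ?; rewrite divr_gt0.
have small (v : V) : h *: v @[h --> (0 : R)^'] --> (0 : V).
  by rewrite -[X in _ --> X](scale0r v); apply: cvgZr_tmp; apply: cvg_within.
pose Q h := h^-1 * (h^-1 * ((f (h *: b + (h *: a + x)) - f (h *: b + x)) -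
    (f (h *: a + x) - f x))).
pose good (h : R) z := `|x - z| <= `|h *: a| + `|h *: b| /\ Q h = 'D_b ('D_a f) z.
have near_good : \forall h \near (0 : R)^', exists z, good h z.
  near=> h.
  have h0 : h != 0 by near: h; exact: nbhs_dnbhs_neq.
  have ar : `|h *: a| < r / 2.
    near: h; move/cvgrPdist_lt : (small a) => /(_ _ (half_gt0 _ r0)).
    by apply: filterS => h; rewrite sub0r normrN.
  have br : `|h *: b| < r / 2.
    near: h; move/cvgrPdist_lt : (small b) => /(_ _ (half_gt0 _ r0)).
    by apply: filterS => h; rewrite sub0r normrN.
  have tle (t : R) (v : V) : 0 <= t <= 1 -> `|(t * h) *: v| <= `|h *: v|.
    by move=> /andP[t0 t1]; rewrite -scalerA normrZ ger0_norm// ler_piMl.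
  have near_x (s t : R) : 0 <= s <= 1 -> 0 <= t <= 1 ->
      `|x - (x + (s * h) *: a + (t * h) *: b)| <= `|h *: a| + `|h *: b|.
    move=> s01 t01; rewrite -[x + _ + _]addrA opprD addrA subrr sub0r normrN.
    by rewrite (le_trans (ler_normD _ _))// lerD ?tle.
  have inD (s t : R) : 0 <= s <= 1 -> 0 <= t <= 1 ->
      D (x + (s * h) *: a + (t * h) *: b).
    move=> s01 t01; apply: rD; apply: le_lt_trans (near_x _ _ s01 t01) _.
    by rewrite (splitr r) ltrD.
  have zo : 0 <= (0 : R) <= 1 by rewrite lexx ler01.
  have oo : 0 <= (1 : R) <= 1 by rewrite lexx ler01.
  pose g z := f (h *: b + z) - f z.
  have dg (s : R) : 0 <= s <= 1 -> is_derive (x + (s * h) *: a) a g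
      ('D_a f (h *: b + (x + (s * h) *: a)) - 'D_a f (x + (s * h) *: a)).
    move=> s01; apply: cvg_is_derive.
    have D0 : D (x + (s * h) *: a).
      by have := inD s 0 s01 zo; rewrite mul0r scale0r addr0.
    have D1 : D (h *: b + (x + (s * h) *: a)).
      by have := inD s 1 s01 oo; rewrite mul1r addrC.
    apply: cvg_trans (cvgB (derivable_cvg (da _ D1)) (derivable_cvg (da _ D0))).
    apply: near_eq_cvg; near=> k; rewrite !fctE -scalerBr /g; congr (_ *: _).
    by rewrite [k *: a + (h *: b + _)]addrCA; lra.
  have [s s01 Es] : exists2 s : R, 0 <= s <= 1 &
      g (x + h *: a) - g x = h * 'D_a g (x + (s * h) *: a).
    by apply: mean_value_ray => s /dg [].
  have [t t01 Et] : exists2 t : R, 0 <= t <= 1 &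
      'D_a f (x + (s * h) *: a + h *: b) - 'D_a f (x + (s * h) *: a) =
      h * 'D_b ('D_a f) (x + (s * h) *: a + (t * h) *: b).
    by apply: (mean_value_ray (f := 'D_a f)) => t t01; apply: db; apply: inD.
  exists (x + (s * h) *: a + (t * h) *: b); split; first exact: near_x.
  move: Es; have [_ ->] := dg _ s01; rewrite [h *: b + _]addrC Et /g => Es.
  rewrite /Q -(mulKf h0 ('D_b _ _)) -(mulKf h0 (h * 'D_b _ _)) -Es.
  by rewrite [x + h *: a]addrC; congr (_ * (_ * _)); lra.
pose z h := if pselect (exists z, good h z) is left ex then sval (cid ex) else x.
have zx : z h @[h --> (0 : R)^'] --> x.
  apply/cvgrPdist_lt => eps eps0; near=> h.
  rewrite /z; case: pselect => [ex|]; last by rewrite subrr normr0.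
  case: cid => /= w [+ _]; move=> /le_lt_trans -> //.
  rewrite (splitr eps) ltrD//.
    near: h; move/cvgrPdist_lt : (small a) => /(_ _ (half_gt0 _ eps0)).
    by apply: filterS => h; rewrite sub0r normrN.
  near: h; move/cvgrPdist_lt : (small b) => /(_ _ (half_gt0 _ eps0)).
  by apply: filterS => h; rewrite sub0r normrN.
apply: cvg_trans (cvg_comp _ _ zx fc).
apply: near_eq_cvg; near=> h.
rewrite /= /z; case: pselect => [ex|nex]; last by case: nex; near: h.
by case: cid => /= w [_ <-].
Unshelve. all: by end_near. Qed.

Lemma schwarz_scalar (V : normedModType R) (f : V -> R) (D : set V) (x a b : V) :
  open D -> D x ->
  (forall z, D z -> derivable f z a) -> (forall z, D z -> derivable f z b) ->
  (forall z, D z -> derivable ('D_a f) z b) ->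
  (forall z, D z -> derivable ('D_b f) z a) ->
  {for x, continuous ('D_b ('D_a f))} -> {for x, continuous ('D_a ('D_b f))} ->
  'D_b ('D_a f) x = 'D_a ('D_b f) x.
Proof.
move=> oD Dx da db dab dba cab cba.
have ab := second_difference_cvg oD Dx da dab cab.
have ba := second_difference_cvg oD Dx db dba cba.
have ab' : h^-1 * (h^-1 * ((f (h *: b + (h *: a + x)) - f (h *: b + x)) -
    (f (h *: a + x) - f x))) @[h --> (0 : R)^'] --> 'D_a ('D_b f) x.
  apply: cvg_trans ba; apply: near_eq_cvg; near=> h; congr (_ * (_ * _)).
  rewrite [h *: b + (_ + _)]addrCA; lra.
have e1 := cvg_lim (@Rhausdorff R) ab; have e2 := cvg_lim (@Rhausdorff R) ab'.
exact: etrans (esym (e1 _)) (e2 _).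
Unshelve. all: by end_near. Qed.

End Directional.

Section ScalarChain.
Context {R : realType}.

Lemma is_derive_comp_scalar (V : normedModType R) (f : V -> R) (F : R -> R)
    (x v : V) (d : R) :
  derivable f x v -> is_derive (f x) (1 : R) F d ->
  is_derive x v (F \o f) (d * 'D_v f x).
Proof.
move=> df dF; apply: cvg_is_derive => /=.
pose g h := f (h *: v + x) - f x.
have gx : f (h *: v + x) @[h --> (0 : R)^'] --> f x.
  exact: derivable_ray_cvg df.
(* Caratheodory slope: the difference quotient of [F], extended by [d] at [f x], is continuous
   there, so increments along which [f] returns to the value [f x] cause no division by zero. *)
pose q y := if y == f x then d else (F y - F (f x)) / (y - f x).
have qc : {for f x, continuous q}.
  have dFc := derivable_cvg (@ex_derive _ _ _ _ _ _ _ dF).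
  have qx : q (f x) = d by rewrite /q eqxx.
  apply/(@cvgrPdist_lt _ _) => e e0; rewrite qx.
  move/cvgrPdist_lt : dFc => /(_ e e0) [r /= r0 rP].
  exists r => //= y; rewrite /ball_ /= /q => yr.
  have [_|yx] := eqVneq y (f x); first by rewrite subrr normr0.
  have := rP (y - f x); rewrite /ball_ /= sub0r normrN distrC subr_eq0.
  move=> /(_ yr yx); rewrite derive_val scaler_R [(_ - _) *: 1]mulr1 subrK.
  by rewrite [_ / _]mulrC.
have : q (f (h *: v + x)) * (h^-1 *: (f (h *: v + x) - f x)) @[h --> (0 : R)^']
    --> q (f x) * 'D_v f x.
  by apply: cvgM; [exact: (cvg_comp _ _ gx qc)|exact: derivable_cvg].
rewrite {2}/q eqxx; apply: cvg_trans; apply: near_eq_cvg; near=> h.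
rewrite /q !scaler_R; have [->|ne] := eqVneq (f (h *: v + x)) (f x).
  by rewrite !subrr !mulr0.
by rewrite mulrCA divfK// subr_eq0.
Unshelve. all: by end_near. Qed.

(** The increment is telescoped along coordinate edges, each handled by [mean_value_cvg]. Letting
    the direction [w h] vary gives the chain rule; a constant [w] gives linearity of the derivative
    in the direction. *)
Lemma chain_cvg n (f : 'rV[R]_n -> R) (D : set 'rV[R]_n) (x : 'rV[R]_n)
    (w : R -> 'rV[R]_n) (w0 : 'rV[R]_n) :
  open D -> D x ->
  (forall i y, D y -> derivable f y (delta_mx 0 i)) ->
  (forall i, {for x, continuous ('D_(delta_mx 0 i) f)}) ->
  (forall i, w h 0 i @[h --> (0 : R)^'] --> w0 0 i) ->
  h^-1 * (f (x + h *: w h) - f x) @[h --> (0 : R)^'] -->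
    \sum_i w0 0 i * 'D_(delta_mx 0 i) f x.
Proof.
move=> oD Dx df fc wc.
pose P (s : seq 'I_n) h := x + h *: (\sum_(i <- s) w h 0 i *: delta_mx 0 i).
have Pc s : P s h @[h --> (0 : R)^'] --> x.
  have sc : \sum_(i <- s) w h 0 i *: (delta_mx 0 i : 'rV[R]_n) @[h --> (0 : R)^']
      --> \sum_(i <- s) w0 0 i *: (delta_mx 0 i : 'rV[R]_n).
    elim: s => [|i s IH].
      rewrite big_nil; under eq_fun do rewrite big_nil; exact: cvg_cst.
    rewrite big_cons; under eq_fun do rewrite big_cons.
    by apply: cvgD => //; apply: cvgZr_tmp.
  have : x + h *: (\sum_(i <- s) w h 0 i *: (delta_mx 0 i : 'rV[R]_n))
      @[h --> (0 : R)^'] --> x + 0 *: \sum_(i <- s) w0 0 i *: (delta_mx 0 i : 'rV[R]_n).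
    by apply: cvgD; [exact: cvg_cst|apply: cvgZ => //; exact: cvg_within].
  by rewrite scale0r addr0.
have main s : h^-1 * (f (P s h) - f x) @[h --> (0 : R)^'] -->
    \sum_(i <- s) w0 0 i * 'D_(delta_mx 0 i) f x.
  elim: s => [|i s IH].
    rewrite big_nil /P; under eq_fun do rewrite big_nil scaler0 addr0 subrr mulr0.
    exact: cvg_cst.
  rewrite big_cons.
  have st := mean_value_cvg oD Dx (df i) (fc i) (Pc s) (wc i).
  apply: cvg_trans (cvgD st IH); apply: near_eq_cvg; near=> h.
  rewrite fctE -mulrDr; congr (_ * _).
  by rewrite /P big_cons scalerDr scalerA [x + (_ + _)]addrA addrAC subrKA.
have := main (index_enum 'I_n); apply: cvg_trans; apply: near_eq_cvg; near=> h.
rewrite /P; congr (_ * (f (_ + _ *: _) - _)).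
by rewrite [RHS]row_sum_delta.
Unshelve. all: by end_near. Qed.

End ScalarChain.

(** * Maps of class C^k *)

Section CkCalculus.
Context {R : realType}.
Implicit Types V W Z : normedModType R.

Lemma Ck_cont V W k D (f : V -> W) x : Ck k D f -> D x -> {for x, continuous f}.
Proof. by case: k => [|k] [fc _]; exact: fc. Qed.

Lemma CkS_derivable V W k D (f : V -> W) x v :
  Ck k.+1 D f -> D x -> derivable f x v.
Proof. by move=> [_ /(_ v) [df _]]; exact: df. Qed.

Lemma CkS_D V W k D (f : V -> W) v : Ck k.+1 D f -> Ck k D ('D_v f).
Proof. by move=> [_ /(_ v) []]. Qed.

Lemma CkW V W k D (f : V -> W) : Ck k.+1 D f -> Ck k D f.
Proof.
elim: k f => [|k IH] f fC; first by split=> // x; exact: Ck_cont fC.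
by split=> [x|v]; [exact: Ck_cont fC|split=> [x|];
  [exact: CkS_derivable fC|exact/IH/CkS_D]].
Qed.

Lemma near_eq_open V W D (f g : V -> W) x : open D ->
  (forall y, D y -> f y = g y) -> D x -> {near x, f =1 g}.
Proof. by move=> oD fg Dx; apply: filterS (open_nbhs_nbhs (conj oD Dx)). Qed.

Lemma eq_derivable V W D (f g : V -> W) x v : open D ->
  (forall y, D y -> f y = g y) -> D x -> derivable f x v -> derivable g x v.
Proof. by move=> oD fg Dx; apply: near_eq_derivable; exact: near_eq_open Dx. Qed.

Lemma eq_derive V W D (f g : V -> W) x v : open D ->
  (forall y, D y -> f y = g y) -> D x -> 'D_v f x = 'D_v g x.
Proof. by move=> oD fg Dx; apply: near_eq_derive; exact: near_eq_open Dx. Qed.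

Lemma eq_Ck V W k D (f g : V -> W) : open D ->
  (forall y, D y -> f y = g y) -> Ck k D f -> Ck k D g.
Proof.
move=> oD; elim: k f g => [|k IH] f g fg fC.
  split=> // x Dx; have fx := Ck_cont fC Dx.
  rewrite /prop_for /continuous_at -fg//; apply: cvg_trans fx.
  by apply: near_eq_cvg; apply: (near_eq_open oD _ Dx) => y /fg.
split=> [x Dx|v].
  rewrite /prop_for /continuous_at -fg//; apply: cvg_trans (Ck_cont fC Dx).
  by apply: near_eq_cvg; apply: (near_eq_open oD _ Dx) => y /fg.
split=> [x Dx|].
  by apply: (eq_derivable oD fg Dx); apply: CkS_derivable fC Dx.
apply: IH (CkS_D v fC) => x Dx; exact: (eq_derive _ oD fg Dx).
Qed.

Lemma Ck_cst V W k D (c : W) : Ck k D (fun _ : V => c).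
Proof.
elim: k c => [|k IH] c; first by split=> // x _; exact: cvg_cst.
split=> [x _|v]; first exact: cvg_cst.
split=> [x _|]; first exact: derivable_cst.
have -> : 'D_v (fun _ : V => c) = fun _ => 0 by apply/funext => x; exact: derive_cst.
exact: IH.
Qed.

Lemma CkD V W k D (f g : V -> W) : open D ->
  Ck k D f -> Ck k D g -> Ck k D (fun x => f x + g x).
Proof.
move=> oD; elim: k f g => [|k IH] f g fC gC.
  by split=> // x Dx; apply: cvgD; [apply: (Ck_cont fC)|apply: (Ck_cont gC)].
split=> [x Dx|v]; first by apply: cvgD; [apply: (Ck_cont fC)|apply: (Ck_cont gC)].
split=> [x Dx|].
  by apply: derivableD; [apply: CkS_derivable fC Dx|apply: CkS_derivable gC Dx].
apply: eq_Ck oD _ (IH _ _ (CkS_D v fC) (CkS_D v gC)) => x Dx.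
by rewrite -deriveD//; [apply: CkS_derivable fC Dx|apply: CkS_derivable gC Dx].
Qed.

Lemma Ck_sum V W k D (I : Type) (s : seq I) (P : pred I) (f : I -> V -> W) :
  open D -> (forall i, Ck k D (f i)) -> Ck k D (fun x => \sum_(i <- s | P i) f i x).
Proof.
move=> oD fC; elim: s => [|i s IH].
  by under eq_fun do rewrite big_nil; exact: Ck_cst.
by under eq_fun do rewrite big_cons; case: (P i) => //; exact: CkD.
Qed.

End CkCalculus.

(** * Continuous linear and bilinear maps *)

Section Bilinear.
Context {R : realType}.

(* Bilinearity and continuity as plain hypotheses, so that partial
   applications need not be registered as structures. *)
Record cont_bilinear (V W Z : normedModType R) (B : V -> W -> Z) : Prop := {
  cbDl : forall x x' y, B (x + x') y = B x y + B x' y;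
  cbDr : forall x y y', B x (y + y') = B x y + B x y';
  cbZl : forall a x y, B (a *: x) y = a *: B x y;
  cbZr : forall a x y, B x (a *: y) = a *: B x y;
  cb_cont : continuous (fun z : V * W => B z.1 z.2) }.

Record cont_linear (V W : normedModType R) (L : V -> W) : Prop := {
  clD : forall x y, L (x + y) = L x + L y;
  clZ : forall a x, L (a *: x) = a *: L x;
  cl_cont : continuous L }.

Section LinearTheory.
Context {V W : normedModType R}.

Lemma clN (L : V -> W) : cont_linear L -> forall x, L (- x) = - L x.
Proof. by move=> cL x; rewrite -scaleN1r (clZ cL) scaleN1r. Qed.

Lemma clB (L : V -> W) : cont_linear L -> forall x y, L (x - y) = L x - L y.
Proof. by move=> cL x y; rewrite (clD cL) (clN cL). Qed.

Lemma cl0 (L : V -> W) : cont_linear L -> L 0 = 0.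
Proof. by move=> cL; rewrite -(scale0r 0) (clZ cL) scale0r. Qed.

Lemma cl_sum (L : V -> W) : cont_linear L -> forall I (s : seq I) P (F : I -> V),
  L (\sum_(i <- s | P i) F i) = \sum_(i <- s | P i) L (F i).
Proof.
by move=> cL I s P F; apply: (big_morph L (clD cL) (cl0 cL)).
Qed.

End LinearTheory.

Context {U V W Z : normedModType R}.

Lemma cb_linl (B : V -> W -> Z) y : cont_bilinear B -> cont_linear (B ^~ y).
Proof.
move=> cB; split=> [x x'|a x|x]; [exact: (cbDl cB)|exact: (cbZl cB)|].
by apply: (cvg_comp2 _ _ (@cb_cont _ _ _ _ cB (x, y))); [exact: cvg_id|exact: cvg_cst].
Qed.

Lemma cb_linr (B : V -> W -> Z) x : cont_bilinear B -> cont_linear (B x).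
Proof.
move=> cB; split=> [y y'|a y|y]; [exact: (cbDr cB)|exact: (cbZr cB)|].
by apply: (cvg_comp2 _ _ (@cb_cont _ _ _ _ cB (x, y))); [exact: cvg_cst|exact: cvg_id].
Qed.

Lemma is_derive_lin (L : V -> W) (f : U -> V) x v : cont_linear L ->
  derivable f x v -> is_derive x v (fun u => L (f u)) (L ('D_v f x)).
Proof.
move=> cL /derivable_cvg df; apply: cvg_is_derive.
apply: cvg_trans (cvg_comp _ _ df (@cl_cont _ _ _ cL _)).
by apply: near_eq_cvg; near=> h; rewrite /= (clZ cL) (clB cL).
Unshelve. all: by end_near. Qed.

Lemma is_derive_bilin (B : V -> W -> Z) (f : U -> V) (g : U -> W) x v :
  cont_bilinear B -> derivable f x v -> derivable g x v ->
  is_derive x v (fun u => B (f u) (g u)) (B ('D_v f x) (g x) + B (f x) ('D_v g x)).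
Proof.
move=> cB df dg; apply: cvg_is_derive.
have q1 : B (h^-1 *: (f (h *: v + x) - f x)) (g (h *: v + x)) @[h --> (0 : R)^']
    --> B ('D_v f x) (g x).
  apply: (cvg_comp2 _ _ (@cb_cont _ _ _ _ cB ('D_v f x, g x))).
    exact: derivable_cvg.
  exact: derivable_ray_cvg.
have q2 : B (f x) (h^-1 *: (g (h *: v + x) - g x)) @[h --> (0 : R)^']
    --> B (f x) ('D_v g x).
  apply: (cvg_comp2 _ _ (@cb_cont _ _ _ _ cB (f x, 'D_v g x))).
    exact: cvg_cst.
  exact: derivable_cvg.
apply: cvg_trans (cvgD q1 q2); apply: near_eq_cvg; near=> h.
rewrite fctE (cbZl cB) (cbZr cB) -scalerDr; congr (_ *: _).
by rewrite (clB (cb_linl _ cB)) (clB (cb_linr _ cB)) addrA subrK.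
Unshelve. all: by end_near. Qed.

Lemma Ck_lin k D (L : V -> W) (f : U -> V) : open D -> cont_linear L ->
  Ck k D f -> Ck k D (fun u => L (f u)).
Proof.
move=> oD cL; have fc (f' : U -> V) x : {for x, continuous f'} ->
    {for x, continuous (fun u => L (f' u))}.
  by move=> f'x; apply: (cvg_comp _ _ f'x (@cl_cont _ _ _ cL _)).
elim: k f => [|k IH] f fC; first by split=> // x Dx; exact/fc/(Ck_cont fC).
split=> [x Dx|v]; first exact/fc/(Ck_cont fC).
have df x : D x -> is_derive x v (fun u => L (f u)) (L ('D_v f x)).
  by move=> Dx; apply: is_derive_lin => //; exact: CkS_derivable fC Dx.
split=> [x /df []//|].
by apply: eq_Ck oD _ (IH _ (CkS_D v fC)) => x /df [_ ->].
Qed.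

Lemma Ck_bilin k D (B : V -> W -> Z) (f : U -> V) (g : U -> W) : open D ->
  cont_bilinear B -> Ck k D f -> Ck k D g -> Ck k D (fun u => B (f u) (g u)).
Proof.
move=> oD cB; have fc (f' : U -> V) (g' : U -> W) x :
    {for x, continuous f'} -> {for x, continuous g'} ->
    {for x, continuous (fun u => B (f' u) (g' u))}.
  by move=> f'x g'x; apply: (cvg_comp2 f'x g'x (@cb_cont _ _ _ _ cB (f' x, g' x))).
elim: k f g => [|k IH] f g fC gC.
  by split=> // x Dx; apply: fc; [exact: (Ck_cont fC)|exact: (Ck_cont gC)].
split=> [x Dx|v]; first by apply: fc; [exact: (Ck_cont fC)|exact: (Ck_cont gC)].
have df x : D x -> is_derive x v (fun u => B (f u) (g u))
    (B ('D_v f x) (g x) + B (f x) ('D_v g x)).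
  move=> Dx; apply: is_derive_bilin => //; first exact: CkS_derivable fC Dx.
  exact: CkS_derivable gC Dx.
split=> [x /df []//|].
apply: eq_Ck oD _ (CkD oD (IH _ _ (CkS_D v fC) (CkW gC))
  (IH _ _ (CkW fC) (CkS_D v gC))) => x /df [_ ->] //.
Qed.

End Bilinear.

Section Instances.
Context {R : realType}.
Implicit Types U V W Z : normedModType R.

Lemma cl_id V : cont_linear (@id V).
Proof. by split=> // x; exact: cvg_id. Qed.

Lemma cl_comp U V W (L : V -> W) (K : U -> V) :
  cont_linear L -> cont_linear K -> cont_linear (fun x => L (K x)).
Proof.
move=> cL cK; split=> [x y|a x|x]; rewrite ?(clD cK) ?(clD cL) ?(clZ cK) ?(clZ cL)//.
exact: (cvg_comp _ _ (@cl_cont _ _ _ _ cK x) (@cl_cont _ _ _ _ cL _)).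
Qed.

Lemma cl_add V W (L K : V -> W) :
  cont_linear L -> cont_linear K -> cont_linear (fun x => L x + K x).
Proof.
move=> cL cK; split=> [x y|a x|x].
- by rewrite (clD cK) (clD cL) addrACA.
- by rewrite (clZ cK) (clZ cL) scalerDr.
- by apply: cvgD; [exact: (cl_cont cL)|exact: (cl_cont cK)].
Qed.

Lemma cl_fst V W : cont_linear (fun x : V * W => x.1).
Proof. by split=> // x; exact: cvg_fst. Qed.

Lemma cl_snd V W : cont_linear (fun x : V * W => x.2).
Proof. by split=> // x; exact: cvg_snd. Qed.

Lemma cl_inl V W : cont_linear (fun x : V => (x, 0) : V * W).
Proof.
split=> [x y|a x|x].
- by congr pair; rewrite addr0.
- by congr pair; rewrite scaler0.
- by apply: (@cvg_pair _ _ _ _ (nbhs x) (nbhs (0 : W))); [exact: cvg_id|exact: cvg_cst].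
Qed.

Lemma cl_inr V W : cont_linear (fun y : W => (0, y) : V * W).
Proof.
split=> [x y|a x|x].
- by congr pair; rewrite addr0.
- by congr pair; rewrite scaler0.
- by apply: (@cvg_pair _ _ _ _ (nbhs (0 : V)) (nbhs x)); [exact: cvg_cst|exact: cvg_id].
Qed.

Lemma cb_scale V : cont_bilinear (fun (k : R) (x : V) => k *: x).
Proof.
split=> [x x' y|x y y'|a x y|a x y|z].
- exact: scalerDl.
- exact: scalerDr.
- by rewrite scalerA.
- by rewrite !scalerA mulrC.
- by apply: cvgZ; [exact: cvg_fst|exact: cvg_snd].
Qed.

Lemma cb_mul : cont_bilinear (fun x y : R => x * y).
Proof. exact: (cb_scale R). Qed.

Lemma cl_scale V (k : R) : cont_linear (fun x : V => k *: x).
Proof. exact: (cb_linr k (cb_scale V)). Qed.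

Lemma cb_comp U U' V W Z (B : V -> W -> Z) (L : U -> V) (K : U' -> W) :
  cont_bilinear B -> cont_linear L -> cont_linear K ->
  cont_bilinear (fun x y => B (L x) (K y)).
Proof.
move=> cB cL cK; split=> [x x' y|x y y'|a x y|a x y|z].
- by rewrite (clD cL) (cbDl cB).
- by rewrite (clD cK) (cbDr cB).
- by rewrite (clZ cL) (cbZl cB).
- by rewrite (clZ cK) (cbZr cB).
- apply: (cvg_comp2 _ _ (@cb_cont _ _ _ _ _ cB (L z.1, K z.2))).
    exact: (cl_cont (cl_comp cL (cl_fst U U'))).
  exact: (cl_cont (cl_comp cK (cl_snd U U'))).
Qed.

Lemma cl_entry m n i j : cont_linear (fun M : 'M[R]_(m, n) => M i j).
Proof.
split=> [x y|a x|]; [by rewrite mxE|by rewrite mxE|exact: coord_continuous].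
Qed.

Lemma cvg_sumr (T : Type) (F : set_system T) {FF : Filter F} V (I : Type)
    (s : seq I) (P : pred I) (f : I -> T -> V) (l : I -> V) :
  (forall i, f i x @[x --> F] --> l i) ->
  \sum_(i <- s | P i) f i x @[x --> F] --> \sum_(i <- s | P i) l i.
Proof.
move=> fl; elim: s => [|i s IH].
  by rewrite big_nil; under eq_fun do rewrite big_nil; exact: cvg_cst.
rewrite big_cons; under eq_fun do rewrite big_cons.
by case: (P i) => //; apply: cvgD.
Qed.

Lemma cl_mx m n W (L : 'M[R]_(m, n) -> W) :
  (forall x y, L (x + y) = L x + L y) -> (forall a x, L (a *: x) = a *: L x) ->
  cont_linear L.
Proof.
move=> LD LZ; split=> // x.
have L0 : L 0 = 0 by rewrite -(scale0r 0) LZ scale0r.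
have [c E] : exists c : 'I_m -> 'I_n -> W, L = fun y => \sum_i \sum_j y i j *: c i j.
  exists (fun i j => L (delta_mx i j)); apply/funext => y.
  rewrite {1}[y]matrix_sum_delta (big_morph L LD L0); apply: eq_bigr => i _.
  by rewrite (big_morph L LD L0); apply: eq_bigr => j _; rewrite LZ.
rewrite E; apply: (cvg_sumr (F := nbhs x)) => i; apply: (cvg_sumr (F := nbhs x)) => j.
by apply: cvgZr_tmp; exact: (cl_cont (cl_entry i j)).
Qed.

Lemma cb_mx m n m' n' W (B : 'M[R]_(m, n) -> 'M[R]_(m', n') -> W) :
  (forall x x' y, B (x + x') y = B x y + B x' y) ->
  (forall x y y', B x (y + y') = B x y + B x y') ->
  (forall a x y, B (a *: x) y = a *: B x y) ->
  (forall a x y, B x (a *: y) = a *: B x y) -> cont_bilinear B.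
Proof.
move=> BDl BDr BZl BZr; split=> // z.
have B0 y : B 0 y = 0 by rewrite -(scale0r 0) BZl scale0r.
have [c [cc E]] : exists c : 'I_m -> 'I_n -> 'M[R]_(m', n') -> W,
    (forall i j, cont_linear (c i j)) /\ B = fun x y => \sum_i \sum_j x i j *: c i j y.
  exists (fun i j => B (delta_mx i j)); split=> [i j|].
    by apply: cl_mx => *; rewrite ?BDr ?BZr.
  apply/funext => x; apply/funext => y; pose By := B^~ y.
  have ByD x1 x2 : By (x1 + x2) = By x1 + By x2 by exact: BDl.
  rewrite -/(By x) {1}[x]matrix_sum_delta (big_morph By ByD (B0 y)).
  apply: eq_bigr => i _; rewrite (big_morph By ByD (B0 y)).
  by apply: eq_bigr => j _; rewrite /By BZl.
rewrite E; apply: (cvg_sumr (F := nbhs z)) => i; apply: (cvg_sumr (F := nbhs z)) => j.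
apply: cvgZ.
  exact: (cl_cont (cl_comp (cl_entry i j) (cl_fst 'M[R]_(m, n) 'M[R]_(m', n')))).
exact: (cl_cont (cl_comp (cc i j) (cl_snd 'M[R]_(m, n) 'M[R]_(m', n')))).
Qed.

Lemma cb_mulmx m n p : cont_bilinear (@mulmx R m n p).
Proof.
apply: cb_mx => [x x' y|x y y'|a x y|a x y].
- exact: mulmxDl.
- exact: mulmxDr.
- by rewrite -scalemxAl.
- by rewrite -scalemxAr.
Qed.

Lemma cl_trmx m n : cont_linear (@trmx R m n).
Proof. by apply: cl_mx => *; rewrite linearE. Qed.

Lemma cb_dot m : cont_bilinear (@dot R m).
Proof.
apply: cb_mx => [x x' y|x y y'|a x y|a x y]; rewrite /dot ?scaler_sumr -?big_split;
  apply: eq_bigr => i _; rewrite ?scaler_sumr -?big_split; apply: eq_bigr => j _;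
  rewrite /= !mxE ?scaler_R; ring.
Qed.

Lemma row_qmulD m (x y : 'M[R]_(m, 4)) q : rmulq (x + y) q = rmulq x q + rmulq y q.
Proof.
apply/matrixP => i j; rewrite !mxE; case: j => -[|[|[|[|//]]]] ? /=; ring.
Qed.

Lemma rmulqZ m a (x : 'M[R]_(m, 4)) q : rmulq (a *: x) q = a *: rmulq x q.
Proof.
apply/matrixP => i j; rewrite !mxE; case: j => -[|[|[|[|//]]]] ? /=; ring.
Qed.

Lemma cl_rmulq m q : cont_linear (fun x : 'M[R]_(m, 4) => rmulq x q).
Proof. by apply: cl_mx => *; rewrite ?row_qmulD ?rmulqZ. Qed.

Lemma qmul_rmulq (x q : 'rV[R]_4) : qmul x q = rmulq x q.
Proof.
by apply/matrixP => i j; rewrite ord1 [RHS]mxE; congr (qmul _ q 0 j); apply/rowP => k; rewrite mxE.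
Qed.

End Instances.

(** * Closure properties of C^k maps *)

Section SmoothClosure.
Context {R : realType} {U : normedModType R} (D : set U) (oD : open D).
Implicit Types V W Z : normedModType R.

Lemma CkZ k V (f : U -> R) (g : U -> V) :
  Ck k D f -> Ck k D g -> Ck k D (fun x => f x *: g x).
Proof. exact: (Ck_bilin oD (cb_scale V)). Qed.

Lemma CkM k (f g : U -> R) : Ck k D f -> Ck k D g -> Ck k D (fun x => f x * g x).
Proof. exact: (Ck_bilin oD (@cb_mul R)). Qed.

Lemma CkN k V (f : U -> V) : Ck k D f -> Ck k D (fun x => - f x).
Proof.
move=> fC; apply: eq_Ck oD _ (Ck_lin oD (cl_scale V (-1)) fC) => x _.
exact: scaleN1r.
Qed.

Lemma CkB k V (f g : U -> V) : Ck k D f -> Ck k D g -> Ck k D (fun x => f x - g x).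
Proof. by move=> fC gC; apply: CkD => //; exact: CkN. Qed.

Lemma Ck_prod k (I : Type) (s : seq I) (P : pred I) (f : I -> U -> R) :
  (forall i, Ck k D (f i)) -> Ck k D (fun x => \prod_(i <- s | P i) f i x).
Proof.
move=> fC; elim: s => [|i s IH].
  by under eq_fun do rewrite big_nil; exact: Ck_cst.
by under eq_fun do rewrite big_cons; case: (P i) => //; exact: CkM.
Qed.

Lemma Ck_mx k m n (f : U -> 'M[R]_(m, n)) :
  (forall i j, Ck k D (fun u => f u i j)) -> Ck k D f.
Proof.
move=> fC.
have : Ck k D (fun u => \sum_i \sum_j f u i j *: (delta_mx i j : 'M[R]_(m, n))).
  apply: Ck_sum => // i; apply: Ck_sum => // j; apply: CkZ => //; exact: Ck_cst.
by apply: eq_Ck => // u _; rewrite -matrix_sum_delta.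
Qed.

Lemma Ck_pair k V W (f : U -> V) (g : U -> W) :
  Ck k D f -> Ck k D g -> Ck k D (fun u => (f u, g u)).
Proof.
move=> fC gC; apply: eq_Ck oD _ (CkD oD (Ck_lin oD (cl_inl V W) fC)
  (Ck_lin oD (cl_inr V W) gC)) => x _.
by congr pair; rewrite ?addr0 ?add0r.
Qed.

Lemma Ck_linear k V (L : U -> V) : cont_linear L -> Ck k D L.
Proof.
move=> cL; have Lc : {for _, continuous L} by move=> x; exact: (cl_cont cL).
case: k => [|k]; split=> // v.
have dL x : is_derive x v L (L v).
  apply: cvg_is_derive; apply: (cvg_trans (G := L v @[_ --> (0 : R)^'])).
    2: exact: (cvg_cst (L v)).
  apply: near_eq_cvg; near=> h.
  rewrite (clD cL) addrK (clZ cL) scalerA mulVf ?scale1r//.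
  by near: h; exact: nbhs_dnbhs_neq.
split=> [x _|]; first by have [] := dL x.
have -> : 'D_v L = fun=> L v by apply/funext => x; have [] := dL x.
exact: Ck_cst.
Unshelve. all: by end_near. Qed.

Lemma is_derive_inv (f : U -> R) x v d : f x != 0 -> is_derive x v f d ->
  is_derive x v (fun y => (f y)^-1) (- (f x)^-1 ^+ 2 * d).
Proof.
move=> f0 [df <-]; split; first exact: derivableV.
by rewrite deriveV// scaler_R -exprVn.
Qed.

Lemma CkV k (f : U -> R) : (forall x, D x -> f x != 0) ->
  Ck k D f -> Ck k D (fun x => (f x)^-1).
Proof.
move=> f0; have Vc x : D x -> {for x, continuous f} ->
  {for x, continuous (fun x => (f x)^-1)} by move=> Dx; apply: cvgV; exact: f0.
elim: k => [|k IH] fC; first by split=> // x Dx; apply/Vc => //; exact: Ck_cont fC Dx.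
split=> [x Dx|v]; first by apply/Vc => //; exact: Ck_cont fC Dx.
have dV x : D x -> is_derive x v (fun x => (f x)^-1) (- (f x)^-1 ^+ 2 * 'D_v f x).
  move=> Dx; apply: is_derive_inv; first exact: f0.
  by split=> //; exact: CkS_derivable fC Dx.
split=> [x /dV []//|]; have VC := IH (CkW fC).
apply: eq_Ck oD _ (CkN (CkM (CkM VC VC) (CkS_D v fC))) => x /dV [_ ->].
by rewrite -expr2 mulNr.
Qed.

(** The inverse square root [r] is preferred to the root because its derivative [- r ^ 3 f' / 2] is
    polynomial in [r] itself, which closes the induction on [k]. *)
Lemma Ck_rsqrt k (f : U -> R) : (forall x, D x -> 0 < f x) ->
  Ck k D f -> Ck k D (fun x => (Num.sqrt (f x))^-1).
Proof.
move=> f0; have s0 x : D x -> Num.sqrt (f x) != 0.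
  by move=> Dx; rewrite gt_eqF// sqrtr_gt0 f0.
have Vc x : D x -> {for x, continuous f} ->
    {for x, continuous (fun x => (Num.sqrt (f x))^-1)}.
  by move=> Dx fx; apply: cvgV; [exact: s0|exact: (cvg_comp _ _ fx (@sqrt_continuous R (f x)))].
elim: k => [|k IH] fC; first by split=> // x Dx; apply/Vc => //; exact: Ck_cont fC Dx.
split=> [x Dx|v]; first by apply/Vc => //; exact: Ck_cont fC Dx.
have dsq x : D x -> is_derive x v (fun x => Num.sqrt (f x))
    ((2 * Num.sqrt (f x))^-1 * 'D_v f x).
  move=> Dx; apply: is_derive_comp_scalar; first exact: CkS_derivable fC Dx.
  exact/is_derive1_sqrt/f0.
have dV x : D x -> is_derive x v (fun x => (Num.sqrt (f x))^-1)
    (- (Num.sqrt (f x))^-1 ^+ 2 * ((2 * Num.sqrt (f x))^-1 * 'D_v f x)).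
  move=> Dx; apply: (is_derive_inv (f := fun x => Num.sqrt (f x))); first exact: s0.
  exact: dsq.
split=> [x /dV []//|]; have VC := IH (CkW fC).
apply: eq_Ck oD _ (CkM (@Ck_cst R U R k D (- 2^-1))
  (CkM (CkM VC (CkM VC VC)) (CkS_D v fC))) => x Dx.
have [_ ->] := dV x Dx; rewrite invfM.
by move: (Num.sqrt (f x))^-1 ('D_v f x) => r d; ring.
Qed.

(** Each function is the derivative of the other up to sign, so the induction has to carry both. *)
Lemma Ck_cos_sin k (f : U -> R) : Ck k D f ->
  Ck k D (fun x => cos (f x)) /\ Ck k D (fun x => sin (f x)).
Proof.
have cc x : {for x, continuous f} -> {for x, continuous (fun x => cos (f x))}.
  by move=> fx; exact: (cvg_comp _ _ fx (@continuous_cos R (f x))).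
have sc x : {for x, continuous f} -> {for x, continuous (fun x => sin (f x))}.
  by move=> fx; exact: (cvg_comp _ _ fx (@continuous_sin R (f x))).
elim: k => [|k IH] fC.
  by split; split=> // x Dx; [apply: cc|apply: sc]; exact: Ck_cont fC Dx.
have [cC sC] := IH (CkW fC).
have dc v x : D x -> is_derive x v (fun x => cos (f x)) (- sin (f x) * 'D_v f x).
  by move=> Dx; apply: (is_derive_comp_scalar (F := cos)); exact: CkS_derivable fC Dx.
have ds v x : D x -> is_derive x v (fun x => sin (f x)) (cos (f x) * 'D_v f x).
  by move=> Dx; apply: (is_derive_comp_scalar (F := sin)); exact: CkS_derivable fC Dx.
split.
  split=> [x Dx|v]; first by apply: cc; exact: Ck_cont fC Dx.
  split=> [x /(dc v) []//|].
  by apply: eq_Ck oD _ (CkM (CkN sC) (CkS_D v fC)) => x /(dc v) [_ ->].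
split=> [x Dx|v]; first by apply: sc; exact: Ck_cont fC Dx.
split=> [x /(ds v) []//|].
by apply: eq_Ck oD _ (CkM cC (CkS_D v fC)) => x /(ds v) [_ ->].
Qed.

Lemma Ck_det k n (f : U -> 'M[R]_n) :
  (forall i j, Ck k D (fun u => f u i j)) -> Ck k D (fun u => \det (f u)).
Proof.
move=> fC; apply: Ck_sum => // s; apply: CkM; first exact: Ck_cst.
by apply: Ck_prod.
Qed.

Lemma Ck_invmx k n (f : U -> 'M[R]_n) : (forall x, D x -> f x \in unitmx) ->
  (forall i j, Ck k D (fun u => f u i j)) ->
  forall i j, Ck k D (fun u => invmx (f u) i j).
Proof.
move=> fu fC i j.
have adjC : Ck k D (fun u => \adj (f u) i j).
  under eq_fun do rewrite mxE; apply: CkM; first exact: Ck_cst.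
  by apply: Ck_det => a b; under eq_fun do rewrite !mxE.
have detC : Ck k D (fun u => (\det (f u))^-1).
  apply: CkV; last exact: Ck_det.
  by move=> x /fu; rewrite unitmxE unitfE.
apply: eq_Ck oD _ (CkM detC adjC) => x /fu fx.
by rewrite /invmx fx [RHS]mxE.
Qed.

End SmoothClosure.

(** * Vector-valued maps: symmetry of second derivatives and chain rule *)

Section VectorTargets.
Context {R : realType}.
Implicit Types V W : normedModType R.

(** Mean value arguments are scalar; identities between vectors are tested on a point-separating
    family of continuous linear functionals. *)
Definition coord_separated W := exists (I : Type) (l : I -> W -> R),
  (forall i, cont_linear (l i)) /\ forall w, (forall i, l i w = 0) -> w = 0.

Lemma separated_scalar : coord_separated (R : normedModType R).
Proof.
exists unit, (fun=> id); split=> [_|w /(_ tt)//]; exact: cl_id.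
Qed.

Lemma separated_mx m n : coord_separated 'M[R]_(m, n).
Proof.
exists ('I_m * 'I_n)%type, (fun ij (M : 'M[R]_(m, n)) => M ij.1 ij.2); split=> [ij|M M0].
  exact: cl_entry.
by apply/matrixP => i j; rewrite mxE (M0 (i, j)).
Qed.

Lemma separated_pair V W : coord_separated V -> coord_separated W -> coord_separated (V * W)%type.
Proof.
move=> [I [l [lc l0]]] [J [k [kc k0]]].
exists (I + J)%type, (fun i x => match i with inl i => l i x.1 | inr j => k j x.2 end).
split=> [[i|j]|[v w] vw0]; [exact: cl_comp (lc i) (cl_fst _ _)|
  exact: cl_comp (kc j) (cl_snd _ _)|].
have v0 : v = 0 by apply: l0 => i; exact: (vw0 (inl i)).
have w0 : w = 0 by apply: k0 => j; exact: (vw0 (inr j)).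
by rewrite v0 w0.
Qed.

Lemma schwarz V W (D : set V) (f : V -> W) x a b : coord_separated W ->
  open D -> D x -> Ck 2 D f -> 'D_a ('D_b f) x = 'D_b ('D_a f) x.
Proof.
move=> [I [l [lc l0]]] oD Dx fC; apply/eqP; rewrite -subr_eq0; apply/eqP/l0 => i.
rewrite (clB (lc i)); apply/eqP; rewrite subr_eq0; apply/eqP.
have lfC := Ck_lin oD (lc i) fC.
have dl v y : D y -> 'D_v (fun u => l i (f u)) y = l i ('D_v f y).
  move=> Dy; have [//|_ ->//] := @is_derive_lin _ _ _ _ _ f y v (lc i) _.
  exact: CkS_derivable fC Dy.
have dl2 v w : 'D_v ('D_w (fun u => l i (f u))) x = l i ('D_v ('D_w f) x).
  rewrite (eq_derive _ oD (dl w) Dx).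
  have [//|_ ->//] := @is_derive_lin _ _ _ _ _ ('D_w f) x v (lc i) _.
  by apply: CkS_derivable (CkS_D w fC) Dx.
rewrite -!dl2; have d1 v y : D y -> derivable (fun u => l i (f u)) y v.
  exact: CkS_derivable lfC.
have d2 v w y : D y -> derivable ('D_w (fun u => l i (f u))) y v.
  exact: CkS_derivable (CkS_D w lfC).
have c2 v w : {for x, continuous ('D_v ('D_w (fun u => l i (f u))))}.
  by apply: Ck_cont (CkS_D v (CkS_D w lfC)) Dx.
exact: (schwarz_scalar oD Dx (d1 b) (d1 a) (d2 a b) (d2 b a) (c2 a b) (c2 b a)).
Qed.

Lemma derive_dirE n W (D : set 'rV[R]_n) (f : 'rV[R]_n -> W) x a : coord_separated W ->
  open D -> D x -> Ck 1 D f ->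
  'D_a f x = \sum_i a 0 i *: 'D_(delta_mx 0 i) f x.
Proof.
move=> [I [l [lc l0]]] oD Dx fC; apply/eqP; rewrite -subr_eq0; apply/eqP/l0 => i.
rewrite (clB (lc i)) (cl_sum (lc i)); apply/eqP; rewrite subr_eq0; apply/eqP.
have lfC := Ck_lin oD (lc i) fC.
have dl v : 'D_v (fun u => l i (f u)) x = l i ('D_v f x).
  have [//|_ ->//] := @is_derive_lin _ _ _ _ _ f x v (lc i) _.
  exact: CkS_derivable fC Dx.
have := @chain_cvg _ n (fun u => l i (f u)) D x (fun=> a) a oD Dx.
move=> /(_ (fun j y => @CkS_derivable _ _ _ _ _ _ y _ lfC)).
move=> /(_ (fun j => Ck_cont (CkS_D (delta_mx 0 j) lfC) Dx)).
move=> /(_ (fun j => cvg_cst _)) cv.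
have [|_ E] := @cvg_is_derive _ _ _ (fun u => l i (f u)) x a
  (\sum_j a 0 j * 'D_(delta_mx 0 j) (fun u => l i (f u)) x) _.
  by apply: cvg_trans cv; apply: near_eq_cvg; near=> h; rewrite [x + _]addrC.
by rewrite -dl E; apply: eq_bigr => j _; rewrite (clZ (lc i)) dl.
Unshelve. all: by end_near. Qed.

Lemma derive_dirP n W (D : set 'rV[R]_n) (f : 'rV[R]_n -> W) x k a b : coord_separated W ->
  open D -> D x -> Ck 1 D f ->
  'D_(k *: a + b) f x = k *: 'D_a f x + 'D_b f x.
Proof.
move=> sW oD Dx fC; rewrite !(derive_dirE _ sW oD Dx fC) scaler_sumr -big_split.
by apply: eq_bigr => i _; rewrite !mxE scalerDl scalerA.
Qed.

Lemma derive_dirZ n W (D : set 'rV[R]_n) (f : 'rV[R]_n -> W) x k a : coord_separated W ->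
  open D -> D x -> Ck 1 D f -> 'D_(k *: a) f x = k *: 'D_a f x.
Proof.
move=> sW oD Dx fC; rewrite -[k *: a]addr0 (derive_dirP _ _ _ sW oD Dx fC).
by rewrite derive0 addr0.
Qed.

Lemma is_derive_chain n V (D : set 'rV[R]_n) (f : 'rV[R]_n -> R) (u : V -> 'rV[R]_n)
    t v : open D -> D (u t) -> Ck 1 D f -> derivable u t v ->
  is_derive t v (fun s => f (u s)) ('D_('D_v u t) f (u t)).
Proof.
move=> oD Du fC du; apply: cvg_is_derive.
rewrite (derive_dirE _ separated_scalar oD Du fC).
have := @chain_cvg _ n f D (u t) (fun h => h^-1 *: (u (h *: v + t) - u t))
  ('D_v u t) oD Du.
move=> /(_ (fun j y => @CkS_derivable _ _ _ _ _ _ y _ fC)).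
move=> /(_ (fun j => Ck_cont (CkS_D (delta_mx 0 j) fC) Du)).
have du' j : (h^-1 *: (u (h *: v + t) - u t)) 0 j @[h --> (0 : R)^'] --> 'D_v u t 0 j.
  exact: (cvg_comp _ _ (derivable_cvg du) (@cl_cont _ _ _ _ (cl_entry 0 j) _)).
move=> /(_ du'); apply: cvg_trans; apply: near_eq_cvg; near=> h.
rewrite scalerA divff ?scale1r 1?[u t + _]addrC ?subrK//.
by near: h; exact: nbhs_dnbhs_neq.
Unshelve. all: by end_near. Qed.

(** Functionals identify a derivative but do not produce one; hence derivability of the composite is
    assumed, unlike in the scalar [is_derive_chain]. *)
Lemma derive_chain n V W (D : set 'rV[R]_n) (f : 'rV[R]_n -> W) (u : V -> 'rV[R]_n)
    t v : coord_separated W -> open D -> D (u t) -> Ck 1 D f -> derivable u t v ->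
  derivable (fun s => f (u s)) t v ->
  'D_v (fun s => f (u s)) t = 'D_('D_v u t) f (u t).
Proof.
move=> [I [l [lc l0]]] oD Du fC du dfu; apply/eqP; rewrite -subr_eq0; apply/eqP/l0 => i.
rewrite (clB (lc i)); apply/eqP; rewrite subr_eq0; apply/eqP.
have [_ E1] := is_derive_lin (lc i) dfu.
have [_ E2] := is_derive_lin (lc i) (@CkS_derivable _ _ _ _ _ _ (u t) ('D_v u t) fC Du).
rewrite -E1 -E2.
by have [] := is_derive_chain oD Du (Ck_lin oD (lc i) fC) du.
Qed.

End VectorTargets.

(** * Curvature in coordinates *)

Section Inner.
Context {R : realType} {n : nat}.
Implicit Types (H : 'M[R]_n) (a b c : 'rV[R]_n).

Lemma innerE H a b : inner H a b = (a *m H *m b^T) 0 0.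
Proof.
rewrite /inner mxE exchange_big /=; apply: eq_bigr => j _.
rewrite !mxE mulr_suml; apply: eq_bigr => i _; ring.
Qed.

Lemma innerDl H a b c : inner H (a + b) c = inner H a c + inner H b c.
Proof. by rewrite !innerE !mulmxDl mxE. Qed.

Lemma innerDr H a b c : inner H a (b + c) = inner H a b + inner H a c.
Proof. by rewrite !innerE linearD mulmxDr mxE. Qed.

Lemma innerZl H k a b : inner H (k *: a) b = k * inner H a b.
Proof. by rewrite !innerE -!scalemxAl mxE. Qed.

Lemma innerZr H k a b : inner H a (k *: b) = k * inner H a b.
Proof. by rewrite !innerE linearZ -scalemxAr mxE. Qed.

Lemma innerNl H a b : inner H (- a) b = - inner H a b.
Proof. by rewrite -scaleN1r innerZl mulN1r. Qed.

Lemma innerNr H a b : inner H a (- b) = - inner H a b.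
Proof. by rewrite -scaleN1r innerZr mulN1r. Qed.

Lemma innerBl H a b c : inner H (a - b) c = inner H a c - inner H b c.
Proof. by rewrite innerDl innerNl. Qed.

Lemma innerPl H k a b c : inner H (k *: a + b) c = k * inner H a c + inner H b c.
Proof. by rewrite innerDl innerZl. Qed.

Lemma innerPr H k a b c : inner H a (k *: b + c) = k * inner H a b + inner H a c.
Proof. by rewrite innerDr innerZr. Qed.

Lemma inner0l H b : inner H 0 b = 0.
Proof. by rewrite -(scale0r 0) innerZl mul0r. Qed.

Lemma inner0r H b : inner H b 0 = 0.
Proof. by rewrite -(scale0r 0) innerZr mul0r. Qed.

Lemma innerDm H H' a b : inner (H + H') a b = inner H a b + inner H' a b.
Proof. by rewrite !innerE mulmxDr mulmxDl mxE. Qed.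

Lemma innerZm k H a b : inner (k *: H) a b = k * inner H a b.
Proof. by rewrite !innerE -scalemxAr -scalemxAl mxE. Qed.

Lemma innerPm H H' k a b : inner (k *: H + H') a b = k * inner H a b + inner H' a b.
Proof. by rewrite innerDm innerZm. Qed.

Lemma inner_summ (I : Type) (s : seq I) (F : I -> 'M[R]_n) a b :
  inner (\sum_(i <- s) F i) a b = \sum_(i <- s) inner (F i) a b.
Proof.
by rewrite innerE mulmx_sumr mulmx_suml summxE; apply: eq_bigr => i _; rewrite innerE.
Qed.

Lemma inner_sym H a b : H^T = H -> inner H a b = inner H b a.
Proof.
move=> Hs; rewrite [LHS]innerE -[a *m H *m b^T]trmxK mxE !trmx_mul trmxK Hs.
by rewrite innerE mulmxA.
Qed.

Lemma inner_delta H i j : inner H (delta_mx 0 i) (delta_mx 0 j) = H i j.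
Proof. by rewrite innerE -rowE trmx_delta -colE !mxE. Qed.

Lemma inner_eq H a b : (forall c, c != 0 -> 0 < inner H c c) ->
  (forall c, inner H a c = inner H b c) -> a = b.
Proof.
move=> Hp ab; apply/eqP; rewrite -subr_eq0; apply/negP => /negP/Hp.
by rewrite innerBl ab subrr ltxx.
Qed.

End Inner.

Lemma inner_sumE {R : realType} {n : nat} (H : 'M[R]_n) (a b : 'rV[R]_n) :
  inner H a b = \sum_i \sum_j H i j * a 0 i * b 0 j.
Proof. by []. Qed.

Opaque inner.

(* [ring] and [lra] compare atoms up to conversion, which is prohibitive on
   derivatives; these tactics first turn the inner products into variables. *)
Ltac gen_inner := repeat match goal with
  |- context [@inner ?R ?n ?H ?a ?b] =>
    let x := fresh "x" in generalize (@inner R n H a b) => x end.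
Ltac inner_ring := gen_inner; ring.
Ltac inner_lra := gen_inner; lra.

Section DerivativeRules.
Context {R : realType} {n : nat}.

Lemma is_derive_inner (V : normedModType R) (H : V -> 'M[R]_n) (a b : V -> 'rV[R]_n)
    x v : derivable H x v -> derivable a x v -> derivable b x v ->
  is_derive x v (fun u => inner (H u) (a u) (b u))
   (inner ('D_v H x) (a x) (b x) + inner (H x) ('D_v a x) (b x)
    + inner (H x) (a x) ('D_v b x)).
Proof.
move=> dH da db.
have cB : cont_bilinear (fun (y b : 'rV[R]_n) => (y *m b^T) 0 0).
  apply: cb_mx => [c c' d|c d d'|k c d|k c d];
  by rewrite ?linearD ?linearZ /= ?mulmxDl ?mulmxDr -?scalemxAl -?scalemxAr mxE.
have [dM eM] := is_derive_bilin (cb_mulmx 1 n n) da dH.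
have [dI eI] := is_derive_bilin cB dM db.
have E : (fun u => inner (H u) (a u) (b u)) = fun u => (a u *m H u *m (b u)^T) 0 0.
  by apply/funext => u; rewrite innerE.
rewrite E; split=> //; rewrite eI eM !innerE mulmxDl mxE; ring.
Qed.

(** Leibniz rule for the derivative along a varying field: once with [X] frozen at [u], once through
    the derivative of [X]. *)
Lemma is_derive_dirfield (W : normedModType R) (D : set 'rV[R]_n)
    (f : 'rV[R]_n -> W) (X : 'rV[R]_n -> 'rV[R]_n) u v : coord_separated W ->
  open D -> D u -> Ck 2 D f -> derivable X u v ->
  is_derive u v (fun w => 'D_(X w) f w)
    ('D_v ('D_(X u) f) u + 'D_('D_v X u) f u).
Proof.
move=> sW oD Du fC dX.
pose S (c : 'rV[R]_n -> 'rV[R]_n) w := \sum_i c w 0 i *: 'D_(delta_mx 0 i) f w.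
have SE c w : D w -> 'D_(c w) f w = S c w.
  by move=> Dw; rewrite (derive_dirE _ sW oD Dw (CkW fC)).
have dS c : derivable c u v ->
    is_derive u v (S c) (\sum_i ('D_v c u 0 i *: 'D_(delta_mx 0 i) f u +
                                 c u 0 i *: 'D_v ('D_(delta_mx 0 i) f) u)).
  move=> dc; have di i : is_derive u v (fun w => c w 0 i *: 'D_(delta_mx 0 i) f w)
      ('D_v c u 0 i *: 'D_(delta_mx 0 i) f u + c u 0 i *: 'D_v ('D_(delta_mx 0 i) f) u).
    have [dci eci] := is_derive_lin (cl_entry 0 i) dc.
    rewrite -eci; apply: (is_derive_bilin (cb_scale W)) => //.
    exact: CkS_derivable (CkS_D _ fC) Du.
  rewrite /S; elim: (index_enum 'I_n) => [|i s IH].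
    rewrite big_nil; under eq_fun do rewrite big_nil.
    by split; [exact: derivable_cst|exact: derive_cst].
  rewrite big_cons; under eq_fun do rewrite big_cons.
  have [d1 e1] := di i; have [d2 e2] := IH.
  by split; [exact: derivableD|rewrite -e1 -e2; exact: deriveD].
have [dSX eSX] := dS X dX.
have ESX : forall w, D w -> S X w = 'D_(X w) f w by move=> w Dw; rewrite SE.
have [_ eSc] := dS (cst (X u)) (derivable_cst _ _ _).
split; first exact: eq_derivable oD ESX Du dSX.
rewrite -(eq_derive _ oD ESX Du) eSX big_split addrC.
rewrite (derive_dirE ('D_v X u) sW oD Du (CkW fC)); congr (_ + _).
have EC : forall w, D w -> S (cst (X u)) w = 'D_(X u) f w.
  by move=> w Dw; rewrite -(SE (cst (X u)) w Dw).
rewrite -(eq_derive _ oD EC Du) eSc; apply: eq_bigr => i _.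
by rewrite derive_cst mxE scale0r add0r.
Qed.

End DerivativeRules.

Section ChristoffelAlgebra.
Context {R : realType} {n : nat} (g : 'M[R]_n) (dg : 'rV[R]_n -> 'M[R]_n).
Hypothesis dgP : forall k a b, dg (k *: a + b) = k *: dg a + dg b.
Hypotheses (g_tr : g^T = g) (dg_tr : forall a, (dg a)^T = dg a).
Hypothesis g_pos : forall a, a != 0 -> 0 < inner g a a.
Implicit Types (a b c : 'rV[R]_n).

(** Twice the Christoffel symbol of the first kind. The metric and its derivative are frozen at one
    point, so that the Levi-Civita identities below are pure linear algebra. *)
Definition christ1 a b c : R :=
  inner (dg a) b c + inner (dg b) a c - inner (dg c) a b.

(** The Christoffel symbol of the second kind contracted with [a] and [b], kept in the index form of
    [Gamma] so that the two match termwise in [GamE]. *)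
Definition christ2 a b : 'rV[R]_n := \row_k \sum_i \sum_j
  (2^-1 * \sum_l invmx g k l * (dg (delta_mx 0 i) j l + dg (delta_mx 0 j) i l
    - dg (delta_mx 0 l) i j)) * a 0 i * b 0 j.

Lemma pos_unitmx : g \in unitmx.
Proof.
rewrite -row_free_unit -kermx_eq0; apply/rowV0P => a /sub_kermxP ag.
apply/eqP; apply/negP => /negP /g_pos.
by rewrite innerE ag mul0mx mxE ltxx.
Qed.

Lemma christ1E a b c : christ1 a b c =
  \sum_s \sum_i \sum_j c 0 s * (a 0 i * (b 0 j *
    christ1 (delta_mx 0 i) (delta_mx 0 j) (delta_mx 0 s))).
Proof.
have lin1 (F : 'rV[R]_n -> R) (x : 'rV[R]_n) :
    (forall k (y z : 'rV[R]_n), F (k *: y + z) = k * F y + F z) ->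
    F x = \sum_i x 0 i * F (delta_mx 0 i).
  move=> FP; have F0 : F 0 = 0.
    by have := FP (-1) 0 0; rewrite scaler0 addr0 mulN1r addNr.
  have FD y z : F (y + z) = F y + F z by rewrite -[y]scale1r FP mul1r scale1r.
  rewrite {1}[x]row_sum_delta (big_morph F FD F0); apply: eq_bigr => i _.
  by rewrite -[_ *: _]addr0 FP F0 addr0.
rewrite (lin1 (christ1 a b)) => [|k y z]; last first.
  rewrite /christ1 dgP !innerPr innerPm; inner_ring.
apply: eq_bigr => s _.
rewrite (lin1 (fun a => christ1 a b _)) => [|k y z]; last first.
  rewrite /christ1 dgP !innerPl innerPm; inner_ring.
rewrite mulr_sumr; apply: eq_bigr => i _.
rewrite (lin1 (fun b => christ1 _ b _)) => [|k y z]; last first.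
  rewrite /christ1 dgP !innerPr innerPl innerPm; inner_ring.
by rewrite !mulr_sumr.
Qed.

Lemma koszul a b c : 2 * inner g (christ2 a b) c = christ1 a b c.
Proof.
pose K : 'rV[R]_n := \row_s christ1 a b (delta_mx 0 s).
have KE s : K 0 s = \sum_i \sum_j a 0 i * (b 0 j *
    christ1 (delta_mx 0 i) (delta_mx 0 j) (delta_mx 0 s)).
  rewrite mxE christ1E (bigD1 s)//= [X in _ + X]big1 ?addr0; last first.
    move=> l sl; apply: big1 => i _; apply: big1 => j _.
    by rewrite mxE (negPf sl) andbF mul0r.
  by apply: eq_bigr => i _; apply: eq_bigr => j _; rewrite mxE !eqxx mul1r.
have christ2E : christ2 a b = 2^-1 *: (K *m (invmx g)^T).
  apply/rowP => k; rewrite [LHS]mxE [RHS]mxE [X in _ * X]mxE mulr_sumr.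
  under [RHS]eq_bigr => l _.
    rewrite KE mulr_suml mulr_sumr.
    under eq_bigr do rewrite mulr_suml mulr_sumr.
    over.
  rewrite [RHS]exchange_big; apply: eq_bigr => i _.
  rewrite [RHS]exchange_big; apply: eq_bigr => j _.
  rewrite -mulrA mulr_sumr mulr_suml; apply: eq_bigr => l _.
  rewrite mxE /christ1 !inner_delta; ring.
rewrite christ2E innerZl mulrA divff ?mul1r ?pnatr_eq0//.
rewrite innerE -[K *m _ *m _]mulmxA trmx_inv g_tr mulVmx ?pos_unitmx// mulmx1.
rewrite mxE christ1E; apply: eq_bigr => s _; rewrite KE mxE mulr_suml.
apply: eq_bigr => i _; rewrite mulr_suml; apply: eq_bigr => j _; exact: mulrC.
Qed.

Lemma metric_compat a b c :
  inner (dg a) b c = inner g (christ2 a b) c + inner g b (christ2 a c).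
Proof.
rewrite [X in _ = _ + X]inner_sym//.
have := koszul a b c; have := koszul a c b; rewrite /christ1.
rewrite (inner_sym c b)//; inner_lra.
Qed.

Lemma christ2C a b : christ2 a b = christ2 b a.
Proof.
apply: (inner_eq g_pos) => c; have := koszul a b c; have := koszul b a c.
rewrite /christ1 [inner (dg c) b a]inner_sym//; inner_lra.
Qed.

End ChristoffelAlgebra.

Lemma sum3_combine (R : realType) n (A B C E : 'I_n -> 'I_n -> 'I_n -> R) :
  \sum_i \sum_j \sum_k A i j k - \sum_i \sum_j \sum_k B i j k
  + \sum_i \sum_j \sum_k C i j k - \sum_i \sum_j \sum_k E i j k =
  \sum_i \sum_j \sum_k (A i j k - B i j k + C i j k - E i j k).
Proof.
rewrite -!sumrN -!big_split; apply: eq_bigr => i _.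
rewrite -!sumrN -!big_split; apply: eq_bigr => j _.
by rewrite -!sumrN -!big_split.
Qed.

Section Curvature.
Context {R : realType} {n : nat} (D : set 'rV[R]_n) (G : 'rV[R]_n -> 'M[R]_n).
Hypotheses (oD : open D) (mG : metric_on D G).
Implicit Types (a b c d u : 'rV[R]_n).

Lemma metric_Ck k : Ck k D G.
Proof. by case: mG => GC _ _; apply: Ck_mx => // i j; apply: GC. Qed.

Lemma metric_tr u : D u -> (G u)^T = G u.
Proof. by case: mG => _ + _; apply. Qed.

Lemma metric_pos u a : D u -> a != 0 -> 0 < inner (G u) a a.
Proof. by case: mG => _ _ +; apply. Qed.

Lemma metric_derivable u v : D u -> derivable G u v.
Proof. by move=> Du; apply: CkS_derivable (metric_Ck 1) Du. Qed.

Lemma metric_entryE u v i j : D u ->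
  'D_v (fun w => G w i j) u = ('D_v G u) i j.
Proof. by move=> Du; rewrite derive_mx ?mxE//; exact: metric_derivable. Qed.

Lemma metricD_tr u v : D u -> ('D_v G u)^T = 'D_v G u.
Proof.
move=> Du; apply/matrixP => i j; rewrite mxE -!metric_entryE//.
by apply: (eq_derive _ oD _ Du) => w Dw; rewrite -[in LHS](metric_tr Dw) mxE.
Qed.

Lemma metric_dirP u k a b : D u -> 'D_(k *: a + b) G u = k *: 'D_a G u + 'D_b G u.
Proof.
by move=> Du; apply: derive_dirP (@separated_mx R n n) oD Du (metric_Ck 1).
Qed.

Definition Gam u a b : 'rV[R]_n := christ2 (G u) (fun v => 'D_v G u) a b.

Lemma Gam_koszul u a b c : D u -> 2 * inner (G u) (Gam u a b) c =
  inner ('D_a G u) b c + inner ('D_b G u) a c - inner ('D_c G u) a b.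
Proof.
move=> Du; rewrite koszul//; first by move=> *; exact: metric_dirP.
  exact: metric_tr.
by move=> *; exact: metric_pos.
Qed.

Lemma Gam_compat u a b c : D u -> inner ('D_a G u) b c =
  inner (G u) (Gam u a b) c + inner (G u) b (Gam u a c).
Proof.
move=> Du; apply: (metric_compat (dg := fun v => 'D_v G u)).
- by move=> *; exact: metric_dirP.
- exact: metric_tr.
- by move=> *; exact: metricD_tr.
- by move=> *; exact: metric_pos.
Qed.

Lemma GamC u a b : D u -> Gam u a b = Gam u b a.
Proof.
move=> Du; apply: christ2C.
- by move=> *; exact: metric_dirP.
- exact: metric_tr.
- by move=> *; exact: metricD_tr.
- by move=> *; exact: metric_pos.
Qed.

Definition Gmx l u : 'M[R]_n := \matrix_(i, j) Gamma G u l i j.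

Lemma GamE u a b l : D u -> Gam u a b 0 l = inner (Gmx l u) a b.
Proof.
move=> Du; rewrite /Gam /christ2 mxE inner_sumE; apply: eq_bigr => i _.
apply: eq_bigr => j _; rewrite mxE /Gamma /partial; congr (_ * _ * _ * _).
by apply: eq_bigr => s _; rewrite !metric_entryE.
Qed.

Lemma Gmx_Ck k l : Ck k D (Gmx l).
Proof.
apply: Ck_mx => // i j; under eq_fun do rewrite mxE.
have dC v i' j' : Ck k D ('D_v (fun w => G w i' j')).
  by apply: CkS_D; exact: (Ck_lin oD (cl_entry i' j') (metric_Ck k.+1)).
apply: CkM => //; first exact: Ck_cst.
apply: Ck_sum => // s; apply: CkM => //.
  apply: (Ck_invmx oD) => [u Du|i' j'].
    by apply: pos_unitmx => a; exact: metric_pos.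
  exact: (Ck_lin oD (cl_entry i' j') (metric_Ck k)).
by apply: CkB => //; [apply: CkD => //|]; exact: dC.
Qed.

Lemma Gam_derive u v b c : D u ->
  is_derive u v (fun w => Gam w b c) (\row_l inner ('D_v (Gmx l) u) b c).
Proof.
move=> Du.
pose F w : 'rV[R]_n := \row_l inner (Gmx l w) b c.
have FE w : D w -> F w = Gam w b c.
  by move=> Dw; apply/rowP => l; rewrite mxE GamE.
have dl l : is_derive u v (fun w => inner (Gmx l w) b c) (inner ('D_v (Gmx l) u) b c).
  have dG : derivable (Gmx l) u v := CkS_derivable (Gmx_Ck 1 l) Du.
  have [dI eI] := is_derive_inner dG (derivable_cst b u v) (derivable_cst c u v).
  by split=> //; rewrite eI !derive_cst inner0l inner0r !addr0.
have dF : derivable F u v.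
  apply/derivable_mxP => i l; under eq_fun do rewrite mxE.
  by have [] := dl l.
split; first exact: eq_derivable oD FE Du dF.
rewrite -(eq_derive _ oD FE Du) derive_mx//; apply/rowP => l; rewrite !mxE.
under eq_fun do rewrite mxE.
by have [] := dl l.
Qed.

(** This is [R(a, b) b] for constant coordinate fields [a] and [b], whose bracket vanishes. *)
Definition Rvec u a b : 'rV[R]_n :=
  'D_a (fun w => Gam w b b) u - 'D_b (fun w => Gam w a b) u
  + Gam u a (Gam u b b) - Gam u b (Gam u a b).

Lemma Rvec_Riem u a b l : D u -> Rvec u a b 0 l =
  \sum_i \sum_j \sum_k Riem G u l i j k * a 0 i * b 0 j * b 0 k.
Proof.
move=> Du; have GmxD v w : inner ('D_v (Gmx l) u) w b =
    \sum_i \sum_j \sum_k 'D_(delta_mx 0 i) (fun w => Gamma G w l j k) u *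
      v 0 i * w 0 j * b 0 k.
  rewrite (derive_dirE _ (@separated_mx R n n) oD Du (Gmx_Ck 1 l)) inner_summ.
  apply: eq_bigr => i _; rewrite innerZm inner_sumE mulr_sumr; apply: eq_bigr => j _.
  rewrite mulr_sumr; apply: eq_bigr => k _.
  have E : 'D_(delta_mx 0 i) (Gmx l) u j k =
      'D_(delta_mx 0 i) (fun w => Gamma G w l j k) u.
    rewrite derive_mx ?mxE; last exact: CkS_derivable (Gmx_Ck 1 l) Du.
    by under eq_fun do rewrite mxE.
  by rewrite E; move: ('D_ _ _ _) => x; ring.
have dGam v b' c' : 'D_v (fun w => Gam w b' c') u 0 l = inner ('D_v (Gmx l) u) b' c'.
  by have [_ ->] := Gam_derive v b' c' Du; rewrite mxE.
have T3 : inner (Gmx l u) a (Gam u b b) = \sum_i \sum_j \sum_k \sum_s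
    Gamma G u l i s * Gamma G u s j k * a 0 i * b 0 j * b 0 k.
  rewrite inner_sumE; apply: eq_bigr => i _.
  under [RHS]eq_bigr do rewrite exchange_big.
  rewrite [RHS]exchange_big; apply: eq_bigr => s _.
  rewrite mxE GamE// inner_sumE mulr_sumr; apply: eq_bigr => j _.
  rewrite mulr_sumr; apply: eq_bigr => k _; rewrite mxE; ring.
have T4 : inner (Gmx l u) b (Gam u a b) = \sum_i \sum_j \sum_k \sum_s
    Gamma G u l j s * Gamma G u s i k * a 0 i * b 0 j * b 0 k.
  rewrite exchange_big inner_sumE; apply: eq_bigr => j _.
  under [RHS]eq_bigr do rewrite exchange_big.
  rewrite [RHS]exchange_big; apply: eq_bigr => s _.
  rewrite mxE GamE// inner_sumE mulr_sumr; apply: eq_bigr => i _.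
  rewrite mulr_sumr; apply: eq_bigr => k _; rewrite mxE; ring.
have T2 : inner ('D_b (Gmx l) u) a b = \sum_i \sum_j \sum_k
    'D_(delta_mx 0 j) (fun w => Gamma G w l i k) u * a 0 i * b 0 j * b 0 k.
  rewrite GmxD exchange_big; apply: eq_bigr => i _; apply: eq_bigr => j _.
  by apply: eq_bigr => k _; move: ('D_ _ _ _) => x; ring.
have mxE4 (w x y z : 'rV[R]_n) : (w - x + y - z) 0 l = w 0 l - x 0 l + y 0 l - z 0 l.
  by rewrite !mxE.
rewrite /Rvec mxE4 !dGam (GamE a (Gam u b b) l Du) (GamE b (Gam u a b) l Du).
move: (GmxD a b) T2 T3 T4; gen_inner => -> -> -> ->.
rewrite sum3_combine; apply: eq_bigr => i _; apply: eq_bigr => j _.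
apply: eq_bigr => k _; rewrite /Riem /partial sumrB.
move: ('D_ _ _ _) ('D_ _ _ _) => dp dq; rewrite -!mulr_suml; ring.
Qed.

End Curvature.

Lemma is_derive_add (R : realType) (V W : normedModType R) (f g : V -> W) x v df dg :
  is_derive x v f df -> is_derive x v g dg ->
  is_derive x v (fun w => f w + g w) (df + dg).
Proof. exact: is_deriveD. Qed.

Lemma is_derive_sub (R : realType) (V W : normedModType R) (f g : V -> W) x v df dg :
  is_derive x v f df -> is_derive x v g dg ->
  is_derive x v (fun w => f w - g w) (df - dg).
Proof. exact: is_deriveB. Qed.

Lemma is_derive_unique (R : realType) (V W : normedModType R) (D : set V)
    (f g : V -> W) x v df dg : open D -> D x -> (forall w, D w -> f w = g w) ->
  is_derive x v f df -> is_derive x v g dg -> df = dg.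
Proof. by move=> oD Dx fg [_ <-] [_ <-]; exact: eq_derive oD fg Dx. Qed.

Section InnerDerive.
Context {R : realType} {n : nat} {V : normedModType R}.
Variables (H : V -> 'M[R]_n) (H' : 'M[R]_n) (x v : V).
Hypothesis dH : is_derive x v H H'.

Lemma is_derive_inner3 (a b : V -> 'rV[R]_n) a' b' :
  is_derive x v a a' -> is_derive x v b b' ->
  is_derive x v (fun u => inner (H u) (a u) (b u))
    (inner H' (a x) (b x) + inner (H x) a' (b x) + inner (H x) (a x) b').
Proof. by case: dH => dH1 <- [da <-] [db <-]; exact: is_derive_inner. Qed.

Lemma is_derive_inner_cstr (a : V -> 'rV[R]_n) a' b : is_derive x v a a' ->
  is_derive x v (fun u => inner (H u) (a u) b)
    (inner H' (a x) b + inner (H x) a' b).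
Proof.
move=> da; have := is_derive_inner3 da (is_derive_cst b x v).
by rewrite inner0r addr0.
Qed.

Lemma is_derive_inner_cst (a b : 'rV[R]_n) :
  is_derive x v (fun u => inner (H u) a b) (inner H' a b).
Proof.
by have := is_derive_inner_cstr b (is_derive_cst a x v); rewrite inner0l addr0.
Qed.

End InnerDerive.

(** * Sectional curvature from second derivatives of the metric *)

Section SectionalCurvature.
Context {R : realType} {n : nat} (D : set 'rV[R]_n) (G : 'rV[R]_n -> 'M[R]_n).
Hypotheses (oD : open D) (mG : metric_on D G).
Implicit Types (a b c d u : 'rV[R]_n).
Local Notation Gam := (Gam G).

Definition sec_num u a b : R := \sum_i \sum_j \sum_k \sum_l \sum_s
  G u l s * Riem G u l i j k * a 0 i * b 0 j * b 0 k * a 0 s.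

Lemma sec_num_Rvec u a b : D u -> sec_num u a b = inner (G u) (Rvec G u a b) a.
Proof.
move=> Du; rewrite inner_sumE.
have ex3 (F : 'I_n -> 'I_n -> 'I_n -> 'I_n -> R) :
    \sum_l \sum_i \sum_j \sum_k F l i j k = \sum_i \sum_j \sum_k \sum_l F l i j k.
  rewrite exchange_big; apply: eq_bigr => i _.
  by rewrite exchange_big; apply: eq_bigr => j _; rewrite exchange_big.
transitivity (\sum_l \sum_s \sum_i \sum_j \sum_k
    G u l s * Riem G u l i j k * a 0 i * b 0 j * b 0 k * a 0 s).
  by under [RHS]eq_bigr do rewrite ex3; rewrite ex3.
apply: eq_bigr => l _; apply: eq_bigr => s _; rewrite (Rvec_Riem oD mG _ _ _ Du).
rewrite mulr_sumr mulr_suml; apply: eq_bigr => i _.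
rewrite mulr_sumr mulr_suml; apply: eq_bigr => j _.
rewrite mulr_sumr mulr_suml; apply: eq_bigr => k _.
by move: (Riem _ _ _ _ _ _) => r; ring.
Qed.

Lemma metricDD_tr u v w : D u -> ('D_v ('D_w G) u)^T = 'D_v ('D_w G) u.
Proof.
move=> Du; have dd : derivable ('D_w G) u v.
  by apply: CkS_derivable (CkS_D w (metric_Ck oD mG 2)) Du.
have [_ <-] := is_derive_lin (cl_trmx n n) dd.
by apply: (eq_derive _ oD _ Du) => x Dx; rewrite (metricD_tr oD mG).
Qed.

(** Differentiating the Koszul formula instead of the symbols themselves keeps the inverse metric
    out of the computation. *)
Lemma lower_DGam u a b c d : D u ->
  2 * inner (G u) ('D_a (fun w => Gam w b c) u) d =
  inner ('D_a ('D_b G) u) c d + inner ('D_a ('D_c G) u) b d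
  - inner ('D_a ('D_d G) u) b c - 2 * inner ('D_a G u) (Gam u b c) d.
Proof.
move=> Du.
have dG : is_derive u a G ('D_a G u).
  by apply: derivableP; exact: (metric_derivable oD mG).
have ddG v : is_derive u a ('D_v G) ('D_a ('D_v G) u).
  by apply: derivableP; apply: CkS_derivable (CkS_D v (metric_Ck oD mG 2)) Du.
have dGam : is_derive u a (fun w => Gam w b c) ('D_a (fun w => Gam w b c) u).
  by apply: derivableP; have [] := Gam_derive oD mG a b c Du.
have d1 := is_derive_inner_cstr dG d dGam.
have d2 := is_derive_inner_cst (ddG b) c d.
have d3 := is_derive_inner_cst (ddG c) b d.
have d4 := is_derive_inner_cst (ddG d) b c.
have kE w : D w -> inner ('D_b G w) c d + inner ('D_c G w) b d - inner ('D_d G w) b c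
    = inner (G w) (Gam w b c) d + inner (G w) (Gam w b c) d.
  by move=> Dw; rewrite -(Gam_koszul oD mG _ _ _ Dw) mulr2n mulrDl mul1r.
have := is_derive_unique oD Du kE (is_derive_sub (is_derive_add d2 d3) d4)
  (is_derive_add d1 d1).
by gen_inner; lra.
Qed.

(** The classical expression of the lowered curvature tensor. Metric compatibility, applied to
    [Gam u b b] and [Gam u a b], absorbs the first-derivative terms left by [lower_DGam]. *)
Lemma sec_numE u a b : D u -> 2 * sec_num u a b =
  2 * inner ('D_a ('D_b G) u) a b - inner ('D_a ('D_a G) u) b b
  - inner ('D_b ('D_b G) u) a a - 2 * inner (G u) (Gam u b b) (Gam u a a)
  + 2 * inner (G u) (Gam u a b) (Gam u a b).
Proof.
move=> Du; rewrite sec_num_Rvec// /Rvec innerBl innerDl innerBl.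
move: (inner_sym b a (metricDD_tr a b Du)) (inner_sym b a (metricDD_tr b a Du)).
move: (lower_DGam a b b a Du) (lower_DGam b a b a Du).
move: (Gam_compat oD mG a (Gam u b b) a Du) (Gam_compat oD mG b (Gam u a b) a Du).
move: (GamC oD mG b a Du); generalize (Gam u b a) => g ->.
by gen_inner; lra.
Qed.

(** * Curvature along a unit geodesic field *)

Section UnitGeodesicField.
Variable X : 'rV[R]_n -> 'rV[R]_n.
Hypothesis XC : Ck 2 D X.
Hypothesis X_unit : forall u, D u -> inner (G u) (X u) (X u) = 1.
Hypothesis X_closed : forall u c, D u ->
  'D_(X u) (fun w => inner (G w) (X w) c) u = 'D_c (fun w => inner (G w) (X w) (X u)) u.

Lemma field_derivable u v : D u -> derivable X u v.
Proof. by move=> Du; apply: CkS_derivable XC Du. Qed.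

(** Twice [g(nabla_X X, c) = 0], from [d theta (X, c) = 0] and the derivative of [|X|^2 = 1]. The
    lowered form is the one that [sec_num_field] differentiates once more. *)
Lemma field_geodesic u c : D u ->
  2 * inner (G u) ('D_(X u) X u) c + 2 * inner ('D_(X u) G u) (X u) c
  - inner ('D_c G u) (X u) (X u) = 0.
Proof.
move=> Du; have dG v : is_derive u v G ('D_v G u).
  by apply: derivableP; exact: (metric_derivable oD mG).
have dX v : is_derive u v X ('D_v X u) by apply: derivableP; exact: field_derivable.
have E1 : 'D_(X u) (fun w => inner (G w) (X w) c) u =
    inner ('D_(X u) G u) (X u) c + inner (G u) ('D_(X u) X u) c.
  by have [_] := is_derive_inner_cstr (dG (X u)) c (dX (X u)).
have E2 : 'D_c (fun w => inner (G w) (X w) (X u)) u =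
    inner ('D_c G u) (X u) (X u) + inner (G u) ('D_c X u) (X u).
  by have [_] := is_derive_inner_cstr (dG c) (X u) (dX c).
move: (etrans (esym E1) (etrans (X_closed c Du) E2)).
move: (is_derive_unique oD Du X_unit (is_derive_inner3 (dG c) (dX c) (dX c))
  (is_derive_cst (1 : R) u c)).
move: (inner_sym (X u) ('D_c X u) (metric_tr mG Du)).
by gen_inner; lra.
Qed.

Lemma field_autoparallel u : D u -> 'D_(X u) X u + Gam u (X u) (X u) = 0.
Proof.
move=> Du; apply: (@inner_eq _ _ (G u)) => [c|c]; first exact: (metric_pos mG).
rewrite inner0l innerDl; have := field_geodesic c Du.
have := Gam_koszul oD mG (X u) (X u) c Du; gen_inner; lra.
Qed.

(** The Lie derivative [(L_X g)(b, c)] on constant coordinate vectors. *)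
Definition lie1 u b c : R := inner ('D_(X u) G u) b c + inner (G u) ('D_b X u) c
  + inner (G u) b ('D_c X u).

(** The second Lie derivative [(L_X L_X g)(b, b)]; its last term comes from [[X, b] = - 'D_b X] for
    constant [b]. *)
Definition lie2 u b : R :=
  'D_(X u) (fun w => lie1 w b b) u + 2 * lie1 u ('D_b X u) b.

(** The symmetric part of the covariant derivative of [X] is half of [L_X g], the skew part half of
    [d theta]. *)
Lemma covD_fieldE u b c : D u ->
  2 * inner (G u) ('D_b X u + Gam u b (X u)) c =
  lie1 u b c + ('D_b (fun w => inner (G w) (X w) c) u
                - 'D_c (fun w => inner (G w) (X w) b) u).
Proof.
move=> Du; have dG v : is_derive u v G ('D_v G u).
  by apply: derivableP; exact: (metric_derivable oD mG).
have dX v : is_derive u v X ('D_v X u) by apply: derivableP; exact: field_derivable.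
have E v w : 'D_v (fun x => inner (G x) (X x) w) u =
    inner ('D_v G u) (X u) w + inner (G u) ('D_v X u) w.
  by have [_] := is_derive_inner_cstr (dG v) w (dX v).
move: (E b c) (E c b); rewrite /lie1 innerDl.
move: ('D_b (fun _ => _) u) ('D_c (fun _ => _) u) => t1 t2 -> ->.
move: (Gam_koszul oD mG b (X u) c Du).
move: (inner_sym b (X u) (metricD_tr oD mG c Du)).
move: (inner_sym b ('D_c X u) (metric_tr mG Du)).
by gen_inner; lra.
Qed.

(** If [b] is extended invariantly along the flow, then [nabla_X b = nabla_b X], and half the second
    derivative of [g(b, b)] along [X] is [|nabla_b X|^2] minus the curvature term. For the constant
    extension used here, the same identity is a linear combination of the differentiated geodesic
    equation, [sec_numE] and Koszul formulas. *)
Lemma sec_num_field u b : D u -> 2 * sec_num u (X u) b =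
  2 * inner (G u) ('D_b X u + Gam u b (X u)) ('D_b X u + Gam u b (X u)) - lie2 u b.
Proof.
move=> Du; have GC2 := metric_Ck oD mG 2.
have dG v : is_derive u v G ('D_v G u).
  by apply: derivableP; exact: (metric_derivable oD mG).
have dX v : is_derive u v X ('D_v X u) by apply: derivableP; exact: field_derivable.
have ddG v w : is_derive u w ('D_v G) ('D_w ('D_v G) u).
  by apply: derivableP; apply: CkS_derivable (CkS_D v GC2) Du.
have ddX v w : is_derive u w ('D_v X) ('D_w ('D_v X) u).
  by apply: derivableP; apply: CkS_derivable (CkS_D v XC) Du.
have sG := @separated_mx R n n; have sX := @separated_mx R 1 n.
have dXX v : is_derive u v (fun w => 'D_(X w) X w)
    ('D_v ('D_(X u) X) u + 'D_('D_v X u) X u).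
  exact: (is_derive_dirfield sX oD Du XC (@ex_derive _ _ _ _ _ _ _ (dX v))).
have dXG v : is_derive u v (fun w => 'D_(X w) G w)
    ('D_v ('D_(X u) G) u + 'D_('D_v X u) G u).
  exact: (is_derive_dirfield sG oD Du GC2 (@ex_derive _ _ _ _ _ _ _ (dX v))).
(* The geodesic equation [field_geodesic], tested on [b], differentiated along [b]. *)
have geo : 2 * (inner ('D_b G u) ('D_(X u) X u) b
      + inner (G u) ('D_b ('D_(X u) X) u + 'D_('D_b X u) X u) b)
    + 2 * (inner ('D_b ('D_(X u) G) u + 'D_('D_b X u) G u) (X u) b
      + inner ('D_(X u) G u) ('D_b X u) b)
    - (inner ('D_b ('D_b G) u) (X u) (X u) + inner ('D_b G u) ('D_b X u) (X u)
      + inner ('D_b G u) (X u) ('D_b X u)) = 0.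
  have d1 := is_derive_inner_cstr (dG b) b (dXX b).
  have d2 := is_derive_inner_cstr (dXG b) b (dX b).
  have d3 := is_derive_inner3 (ddG b b) (dX b) (dX b).
  have gE w : D w -> (inner (G w) ('D_(X w) X w) b + inner ('D_(X w) G w) (X w) b)
      + (inner (G w) ('D_(X w) X w) b + inner ('D_(X w) G w) (X w) b)
      = inner ('D_b G w) (X w) (X w).
    by move=> Dw; have := field_geodesic b Dw; gen_inner; lra.
  move: (is_derive_unique oD Du gE
    (is_derive_add (is_derive_add d1 d2) (is_derive_add d1 d2)) d3).
  by gen_inner; lra.
have lie1D : 'D_(X u) (fun w => lie1 w b b) u =
    inner ('D_(X u) ('D_(X u) G) u + 'D_('D_(X u) X u) G u) b b
    + 2 * (inner ('D_(X u) G u) ('D_b X u) b + inner (G u) ('D_(X u) ('D_b X) u) b).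
  have d1 := is_derive_inner_cst (dXG (X u)) b b.
  have d2 := is_derive_inner_cstr (dG (X u)) b (ddX b (X u)).
  have d3 := is_derive_inner3 (dG (X u)) (is_derive_cst b u (X u)) (ddX b (X u)).
  have [_ E] := is_derive_add (is_derive_add d1 d2) d3; apply: etrans E _.
  move: (inner_sym b ('D_b X u) (metricD_tr oD mG (X u) Du)).
  move: (inner_sym b ('D_(X u) ('D_b X) u) (metric_tr mG Du)).
  by rewrite /cst inner0l; gen_inner; lra.
rewrite /lie2; move: lie1D geo; set a := X u => lie1D geo.
have Gaa : Gam u a a = - 'D_a X u.
  by apply/eqP; rewrite -addr_eq0 addrC; apply/eqP; exact: field_autoparallel.
rewrite /lie1 -/a.
move: geo lie1D (sec_numE a b Du) (Gam_koszul oD mG b b ('D_a X u) Du).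
move: (Gam_koszul oD mG b a ('D_b X u) Du).
move: Gaa; generalize (Gam u a a) => g1 ->.
move: (GamC oD mG a b Du); generalize (Gam u a b) => g2 ->.
(* Once mixed derivatives are identified by symmetry, the claim is linear in the inner products. *)
have S1 : 'D_b ('D_a G) u = 'D_a ('D_b G) u by exact: (schwarz b a sG oD Du GC2).
have S2 : 'D_b ('D_a X) u = 'D_a ('D_b X) u by exact: (schwarz b a sX oD Du XC).
move: S1; generalize ('D_b ('D_a G) u) => g3 S1; subst g3.
move: S2; generalize ('D_b ('D_a X) u) => g4 S2; subst g4.
move: (inner_sym (Gam u b a) ('D_b X u) (metric_tr mG Du)).
move: (inner_sym b ('D_b X u) (metricD_tr oD mG a Du)).
move: (inner_sym b ('D_a X u) (metricD_tr oD mG b Du)).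
move: (inner_sym b a (metricD_tr oD mG ('D_b X u) Du)).
move: (inner_sym ('D_b X u) a (metricD_tr oD mG b Du)).
generalize ('D_a ('D_b G) u) ('D_b ('D_b G) u) ('D_a ('D_a G) u) => hab hbb haa.
generalize ('D_('D_b X u) G u) ('D_('D_a X u) G u) => hb ha.
generalize ('D_a ('D_b X) u) ('D_('D_b X u) X u) => xab xb.
generalize ('D_a G u) ('D_b G u) => ga gb.
generalize ('D_a X u) ('D_b X u) (Gam u b a) (Gam u b b) => xa y gba gbb.
rewrite innerNr !innerDl !innerDr !innerDm.
by gen_inner; lra.
Qed.

End UnitGeodesicField.
End SectionalCurvature.

(** * Geodesic flows of linear vector fields *)

Section SmoothForms.
Context {R : realType} {V : normedModType R}.
Implicit Types (g : V -> V -> V -> R) (dg : V -> V -> V -> V -> R).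

(* [g] is a smooth field of bilinear forms and [dg x z] is the derivative of its
   coefficients at x in the direction z. *)
Record smooth_form g dg : Prop := SmoothForm {
  sf_linl : forall x k v v' w, g x (k *: v + v') w = k * g x v w + g x v' w;
  sf_linr : forall x v k w w', g x v (k *: w + w') = k * g x v w + g x v w';
  sf_Ck : forall (W : normedModType R) k (D : set W) (x v w : W -> V), open D ->
    Ck k D x -> Ck k D v -> Ck k D w -> Ck k D (fun u => g (x u) (v u) (w u));
  sf_D : forall (W : normedModType R) (x v w : W -> V) t c x' v' w',
    is_derive t c x x' -> is_derive t c v v' -> is_derive t c w w' ->
    is_derive t c (fun u => g (x u) (v u) (w u))
      (dg (x t) x' (v t) (w t) + g (x t) v' (w t) + g (x t) (v t) w') }.

Context {g : V -> V -> V -> R} {dg : V -> V -> V -> V -> R} (gS : smooth_form g dg).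

Lemma sf0l x w : g x 0 w = 0.
Proof. by have := sf_linl gS x (-1) 0 0 w; rewrite scaler0 addr0 mulN1r addNr. Qed.

Lemma sf0r x v : g x v 0 = 0.
Proof. by have := sf_linr gS x v (-1) 0 0; rewrite scaler0 addr0 mulN1r addNr. Qed.

Lemma sfDl x v v' w : g x (v + v') w = g x v w + g x v' w.
Proof. by rewrite -[v]scale1r (sf_linl gS) mul1r scale1r. Qed.

Lemma sfDr x v w w' : g x v (w + w') = g x v w + g x v w'.
Proof. by rewrite -[w]scale1r (sf_linr gS) mul1r scale1r. Qed.

Lemma sfZl x k v w : g x (k *: v) w = k * g x v w.
Proof. by rewrite -[k *: v]addr0 (sf_linl gS) sf0l addr0. Qed.

Lemma sfZr x v k w : g x v (k *: w) = k * g x v w.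
Proof. by rewrite -[k *: w]addr0 (sf_linr gS) sf0r addr0. Qed.

Lemma sf_suml x I (s : seq I) P (F : I -> V) w :
  g x (\sum_(i <- s | P i) F i) w = \sum_(i <- s | P i) g x (F i) w.
Proof. exact: (big_morph (g x ^~ w) (fun a b => sfDl x a b w) (sf0l x w)). Qed.

Lemma sf_sumr x v I (s : seq I) P (F : I -> V) :
  g x v (\sum_(i <- s | P i) F i) = \sum_(i <- s | P i) g x v (F i).
Proof. exact: (big_morph (g x v) (sfDr x v) (sf0r x v)). Qed.

Definition lie_form (K : V -> V) x v w := dg x (K x) v w + g x (K v) w + g x v (K w).

Definition ext_form (K : V -> V) x v w :=
  (dg x v (K x) w + g x (K v) w) - (dg x w (K x) v + g x (K w) v).

End SmoothForms.

Section Pullback.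
Context {R : realType} {V : normedModType R} {n : nat}.
Variables (g g2 : V -> V -> V -> R) (dg dg2 : V -> V -> V -> V -> R) (K : V -> V).
Hypotheses (sV : coord_separated V) (gS : smooth_form g dg) (g2S : smooth_form g2 dg2).
Hypotheses (g_sym : forall x v w, g x v w = g x w v)
  (g2_sym : forall x v w, g2 x v w = g2 x w v).
Hypotheses (KL : cont_linear K).
Hypothesis (g2E : forall x v w, lie_form (g := g) (dg := dg) K x v w = g2 x v w).
Variables (D : set 'rV[R]_n) (phi : 'rV[R]_n -> V).
Hypotheses (oD : open D) (phiC : forall k, Ck k D phi).
Hypothesis (phi_imm : forall u a, D u -> 'D_a phi u = 0 -> a = 0).
Hypothesis (g_pos : forall u a, D u -> 'D_a phi u != 0 ->
  0 < g (phi u) ('D_a phi u) ('D_a phi u)).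
Implicit Types (a b c u : 'rV[R]_n).
Local Notation G := (gram g phi).

Lemma dphi_lin k u a b : D u -> 'D_(k *: a + b) phi u = k *: 'D_a phi u + 'D_b phi u.
Proof. by move=> Du; apply: derive_dirP sV oD Du (phiC 1). Qed.

Lemma dphi_inj u a b : D u -> 'D_a phi u = 'D_b phi u -> a = b.
Proof.
move=> Du ab; apply/eqP; rewrite -subr_eq0; apply/eqP/(phi_imm Du).
by rewrite addrC -scaleN1r dphi_lin// ab scaleN1r addNr.
Qed.

Lemma gramE u a b : D u -> inner (G u) a b = g (phi u) ('D_a phi u) ('D_b phi u).
Proof.
move=> Du; rewrite (derive_dirE a sV oD Du (phiC 1)) (derive_dirE b sV oD Du (phiC 1)).
rewrite (sf_suml gS) inner_sumE; apply: eq_bigr => i _.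
rewrite (sf_sumr gS); apply: eq_bigr => j _.
by rewrite (sfZl gS) (sfZr gS) mxE; move: (g _ _ _) => r; ring.
Qed.

Lemma dphiC k a : Ck k D ('D_a phi).
Proof. exact/CkS_D. Qed.

Lemma gram_metric : metric_on D G.
Proof.
split=> [i j k|u Du|u a Du a0].
- under eq_fun do rewrite mxE; apply: (sf_Ck gS oD) => //; exact: dphiC.
- by apply/matrixP => i j; rewrite !mxE g_sym.
- rewrite gramE//; apply: g_pos => //; apply: contraNneq a0 => /(phi_imm Du) ->.
  exact: eqxx.
Qed.

Hypothesis K_tan : forall u, D u -> exists a, 'D_a phi u = K (phi u).

(** The coordinates of [K] are solved for with the Gram matrix instead of choosing preimages, so
    that smoothness in [u] is visible. *)
Definition pull_field u : 'rV[R]_n :=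
  (\row_i g (phi u) (K (phi u)) ('D_(delta_mx 0 i) phi u)) *m invmx (G u).
Local Notation X := pull_field.

Lemma pull_fieldE u : D u -> 'D_(X u) phi u = K (phi u).
Proof.
move=> Du; have [a aK] := K_tan Du; rewrite -aK; congr ('D_ _ phi u).
rewrite /X -aK.
have -> : (\row_i g (phi u) ('D_a phi u) ('D_(delta_mx 0 i) phi u)) = a *m G u.
  by apply/rowP => i; rewrite mxE -gramE// innerE trmx_delta -colE mxE.
rewrite mulmxK//; apply: pos_unitmx => b; exact: (metric_pos gram_metric Du).
Qed.

Lemma pull_fieldC k : Ck k D X.
Proof.
apply: (Ck_bilin oD (cb_mulmx 1 n n)).
  apply: Ck_mx => // i j; under eq_fun do rewrite mxE.
  by apply: (sf_Ck gS oD) => //; [exact: Ck_lin|exact: dphiC].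
apply: Ck_mx => // i j; apply: (Ck_invmx oD) => [u Du|i' j'].
  apply: pos_unitmx => b; exact: (metric_pos gram_metric Du).
by have [GC _ _] := gram_metric; exact: GC.
Qed.

Lemma dphi_is_derive u a : D u -> is_derive u a phi ('D_a phi u).
Proof. by move=> Du; apply: derivableP; apply: CkS_derivable (phiC 1) Du. Qed.

Lemma ddphi_is_derive u a b : D u -> is_derive u a ('D_b phi) ('D_a ('D_b phi) u).
Proof. by move=> Du; apply: derivableP; apply: CkS_derivable (dphiC 1 b) Du. Qed.

Lemma Kphi_is_derive u a : D u -> is_derive u a (fun w => K (phi w)) (K ('D_a phi u)).
Proof.
by move=> Du; apply: is_derive_lin => //; apply: CkS_derivable (phiC 1) Du.
Qed.

(** Derivative of ['D_(X u) phi u = K (phi u)] along [b]. As [K] is linear, this trades derivatives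
    of the coordinate field for values of [K], and so moves Lie derivatives to the ambient space. *)
Lemma dphi_flow u b : D u ->
  'D_(X u) ('D_b phi) u + 'D_('D_b X u) phi u = K ('D_b phi u).
Proof.
move=> Du; have dX : derivable X u b := CkS_derivable (pull_fieldC 1) Du.
have S : 'D_b ('D_(X u) phi) u = 'D_(X u) ('D_b phi) u.
  exact: schwarz sV oD Du (phiC 2).
have dF : is_derive u b (fun w => 'D_(X w) phi w)
  ('D_b ('D_(X u) phi) u + 'D_('D_b X u) phi u).
  exact: is_derive_dirfield sV oD Du (phiC 2) dX.
have := is_derive_unique oD Du pull_fieldE dF (Kphi_is_derive b Du).
by move: S; generalize ('D_b ('D_(X u) phi) u) => z S; subst z.
Qed.

Lemma X_form_unit : (forall u, D u -> g (phi u) (K (phi u)) (K (phi u)) = 1) ->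
  forall u, D u -> inner (G u) (X u) (X u) = 1.
Proof. by move=> gK u Du; rewrite gramE// pull_fieldE// gK. Qed.

Lemma theta_derive u b c : D u ->
  'D_b (fun w => inner (G w) (X w) c) u =
  dg (phi u) ('D_b phi u) (K (phi u)) ('D_c phi u)
  + g (phi u) (K ('D_b phi u)) ('D_c phi u)
  + g (phi u) (K (phi u)) ('D_b ('D_c phi) u).
Proof.
move=> Du.
have E w : D w -> inner (G w) (X w) c = g (phi w) (K (phi w)) ('D_c phi w).
  by move=> Dw; rewrite gramE// pull_fieldE.
have [_ <-] := sf_D gS (dphi_is_derive b Du) (Kphi_is_derive b Du)
  (ddphi_is_derive b c Du).
exact: eq_derive oD E Du.
Qed.

(** The second derivatives of the chart cancel by symmetry, leaving the exterior derivative of the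
    ambient one-form [g(K, .)]. *)
Lemma ext_formE u b c : D u ->
  'D_b (fun w => inner (G w) (X w) c) u - 'D_c (fun w => inner (G w) (X w) b) u =
  ext_form (g := g) (dg := dg) K (phi u) ('D_b phi u) ('D_c phi u).
Proof.
move=> Du; have S : 'D_b ('D_c phi) u = 'D_c ('D_b phi) u.
  exact: schwarz sV oD Du (phiC 2).
rewrite /ext_form; move: (theta_derive b c Du) (theta_derive c b Du).
move: S; generalize ('D_b ('D_c phi) u) => z S; subst z.
move: ('D_b (fun _ => _) u) ('D_c (fun _ => _) u) => t1 t2 -> ->.
by rewrite [X in _ - X = _]addrC opprD addrA addrK.
Qed.

Lemma lie1E u b c : D u -> lie1 G X u b c = g2 (phi u) ('D_b phi u) ('D_c phi u).
Proof.
move=> Du; rewrite /lie1 -g2E /lie_form !gramE//.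
have dG : is_derive u (X u) G ('D_(X u) G u).
  by apply: derivableP; exact: (metric_derivable oD gram_metric).
have gE w : D w -> inner (G w) b c = g (phi w) ('D_b phi w) ('D_c phi w).
  by move=> Dw; rewrite gramE.
move: (is_derive_unique oD Du gE (is_derive_inner_cst dG b c)
  (sf_D gS (dphi_is_derive (X u) Du) (ddphi_is_derive (X u) b Du)
  (ddphi_is_derive (X u) c Du))).
move: (dphi_flow b Du) (dphi_flow c Du) (pull_fieldE Du).
generalize (K ('D_b phi u)) (K ('D_c phi u)) (K (phi u)) => kb kc k <- <- <-.
move: ('D_(X u) ('D_b phi) u) ('D_(X u) ('D_c phi) u) => xb xc.
move: (inner _ _ _) => t ->; rewrite (sfDl gS) (sfDr gS).
by move: (dg _ _ _ _) (g _ _ _) (g _ _ _) (g _ _ _) (g _ _ _) => *; ring.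
Qed.

Lemma lie2E u b : D u -> lie2 G X u b =
  dg2 (phi u) (K (phi u)) ('D_b phi u) ('D_b phi u)
  + 2 * g2 (phi u) (K ('D_b phi u)) ('D_b phi u).
Proof.
move=> Du; rewrite /lie2 lie1E//.
have gE w : D w -> lie1 G X w b b = g2 (phi w) ('D_b phi w) ('D_b phi w).
  by move=> Dw; rewrite lie1E.
have [_ d2] := sf_D g2S (dphi_is_derive (X u) Du)
  (ddphi_is_derive (X u) b Du) (ddphi_is_derive (X u) b Du).
move: (etrans (eq_derive (X u) oD gE Du) d2).
move: (dphi_flow b Du) (pull_fieldE Du).
generalize (K ('D_b phi u)) (K (phi u)) => kb k <- <-.
move: ('D_(X u) ('D_b phi) u) ('D_(X u) (fun _ => _) u) => xb t ->.
rewrite (sfDl g2S) [g2 _ ('D_b phi u) xb]g2_sym.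
by move: (dg2 _ _ _ _) (g2 _ _ _) (g2 _ _ _) => *; ring.
Qed.

Hypothesis K_unit : forall u, D u -> g (phi u) (K (phi u)) (K (phi u)) = 1.
Hypothesis K_closed : forall u c, D u ->
  ext_form (g := g) (dg := dg) K (phi u) (K (phi u)) ('D_c phi u) = 0.

Lemma pull_field_closed u c : D u ->
  'D_(X u) (fun w => inner (G w) (X w) c) u = 'D_c (fun w => inner (G w) (X w) (X u)) u.
Proof.
move=> Du; apply/eqP; rewrite -subr_eq0; apply/eqP.
by rewrite ext_formE// pull_fieldE// K_closed.
Qed.

(** The vector [s] stands for [nabla_b X]; positivity of the metric makes its inner products with
    tangent vectors determine it. *)
Lemma sec_num_pull u b (s : V) : D u -> (exists a, 'D_a phi u = s) ->
  (forall c, 2 * g (phi u) s ('D_c phi u) = g2 (phi u) ('D_b phi u) ('D_c phi u)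
    + ext_form (g := g) (dg := dg) K (phi u) ('D_b phi u) ('D_c phi u)) ->
  2 * sec_num G u (X u) b = 2 * g (phi u) s s
   - (dg2 (phi u) (K (phi u)) ('D_b phi u) ('D_b phi u)
     + 2 * g2 (phi u) (K ('D_b phi u)) ('D_b phi u)).
Proof.
move=> Du [a as_] sE.
rewrite (sec_num_field oD gram_metric (pull_fieldC 2) (X_form_unit K_unit)
  pull_field_closed b Du) (lie2E b Du).
suff -> : 'D_b X u + Gam G u b (X u) = a by rewrite gramE// as_.
apply: (@inner_eq _ _ (G u)) => [c|c]; first exact: (metric_pos gram_metric Du).
have two : (2 : R) != 0 by rewrite pnatr_eq0.
apply: (mulfI two).
rewrite (covD_fieldE oD gram_metric (pull_fieldC 2) b c Du) lie1E// ext_formE//.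
by rewrite -sE gramE// as_.
Qed.

End Pullback.

Lemma sec_numZ (R : realType) n (G : 'rV[R]_n -> 'M[R]_n) u (r : R) a b :
  sec_num G u (r *: a) b = r ^+ 2 * sec_num G u a b.
Proof.
rewrite /sec_num.
rewrite mulr_sumr; apply: eq_bigr => i _; rewrite mulr_sumr; apply: eq_bigr => j _.
rewrite mulr_sumr; apply: eq_bigr => k _; rewrite mulr_sumr; apply: eq_bigr => l _.
rewrite mulr_sumr; apply: eq_bigr => s _; rewrite !mxE.
by move: (Riem _ _ _ _ _ _) => x; ring.
Qed.

(** * Homothetic changes of the metric *)

Section Rescaling.
Context {R : realType} {n : nat} (D : set 'rV[R]_n) (G : 'rV[R]_n -> 'M[R]_n).
Hypotheses (oD : open D) (mG : metric_on D G).
Variable (r : R).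
Hypothesis r0 : r != 0.
Local Notation rG := (fun w => r *: G w).

Lemma Gamma_scale u k i j : D u -> Gamma rG u k i j = Gamma G u k i j.
Proof.
move=> Du; rewrite /Gamma; congr (_ * _); apply: eq_bigr => l _.
have P v i' j' : partial v (fun w => (r *: G w) i' j') u =
    r * partial v (fun w => G w i' j') u.
  rewrite /partial; under eq_fun do rewrite mxE.
  have dG : derivable (fun w => G w i' j') u (delta_mx 0 v).
    by apply: CkS_derivable (Ck_lin oD (cl_entry i' j') (metric_Ck oD mG 1)) Du.
  by have [_ ->] := is_derive_lin (cl_scale R r) dG.
have uG : r *: G u \in unitmx.
  by rewrite unitmxZ ?unitfE//; apply: pos_unitmx => a; exact: (metric_pos mG).
rewrite !P (invmxZ uG) mxE.
by move: (partial _ _ _) (partial _ _ _) (partial _ _ _) => x y z; field.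
Qed.

Lemma Riem_scale u l i j k : D u -> Riem rG u l i j k = Riem G u l i j k.
Proof.
move=> Du.
have dE a b c e : partial a (fun w => Gamma rG w b c e) u =
    partial a (fun w => Gamma G w b c e) u.
  by rewrite /partial; apply: (eq_derive _ oD _ Du) => w Dw; exact: Gamma_scale.
have sE : \sum_s (Gamma rG u l i s * Gamma rG u s j k - Gamma rG u l j s * Gamma rG u s i k)
    = \sum_s (Gamma G u l i s * Gamma G u s j k - Gamma G u l j s * Gamma G u s i k).
  by apply: eq_bigr => s _; rewrite !(Gamma_scale _ _ _ Du).
rewrite /Riem; move: (dE i l j k) (dE j l i k) sE.
by move: (partial _ _ _) (partial _ _ _) (\sum_s _) => x y z -> -> ->.
Qed.

Lemma sec_scale u a b : D u -> sec rG u a b = r^-1 * sec G u a b.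
Proof.
move=> Du; rewrite /sec -/(sec_num rG u a b) -/(sec_num G u a b).
have -> : sec_num rG u a b = r * sec_num G u a b.
  rewrite /sec_num.
  rewrite mulr_sumr; apply: eq_bigr => i _; rewrite mulr_sumr; apply: eq_bigr => j _.
  rewrite mulr_sumr; apply: eq_bigr => k _; rewrite mulr_sumr; apply: eq_bigr => l _.
  rewrite mulr_sumr; apply: eq_bigr => s _; rewrite mxE Riem_scale//.
  by move: (Riem _ _ _ _ _ _) => x; ring.
rewrite !innerZm; move: (sec_num G u a b) => N; gen_inner.
set d := x * x0 - x1 ^+ 2.
have -> : r * x * (r * x0) - (r * x1) ^+ 2 = r ^+ 2 * d by rewrite /d; ring.
by rewrite invfM mulrACA; congr (_ * _); rewrite expr2 invfM mulrA divff// mul1r.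
Qed.

End Rescaling.

Lemma mixed_curvatures_rescale (R : realType) (V : normedModType R) n (M : set V)
    (g : V -> V -> V -> R) (F : V -> set V) (r k : R) : 0 < r -> riemannian n M g ->
  mixed_curvatures n M (rescale r g) F k <-> mixed_curvatures n M g F (r * k).
Proof.
move=> r0 gR; have rn0 : r != 0 by rewrite gt_eqF.
have gramZ m (phi : 'rV[R]_m -> V) : gram (rescale r g) phi = fun u => r *: gram g phi u.
  by apply/funext => u; apply/matrixP => i j; rewrite !mxE.
have secE x v w k' : sect_curv n M (rescale r g) x v w k' <-> sect_curv n M g x v w (r * k').
  split=> -[D [phi [u [a [b [[pD Du ux] [av bw kE]]]]]]]; exists D, phi, u, a, b;
    split=> //; split=> //; have [mG _] := gR _ _ pD; have oD : open D by case: pD.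
    by rewrite kE gramZ (sec_scale oD mG rn0 _ _ Du) mulrA divff// mul1r.
  by rewrite gramZ (sec_scale oD mG rn0 _ _ Du) -kE mulrA mulVf// mul1r.
split=> -[x [v [w [Fv v0 w0 perp sc]]]]; exists x, v, w; split=> //.
- move=> v' /perp /eqP; rewrite /rescale mulf_eq0 (negPf rn0) => /eqP //.
- exact/secE.
- by move=> v' /perp; rewrite /rescale => ->; rewrite mulr0.
- exact/secE.
Qed.

(* [T] is the field of tangent spaces of [M]; [K] generates a linear flow whose
   velocity field is a geodesic unit field for [g], and [g2] is the Lie
   derivative of [g] along it. *)
Record geodesic_flow (R : realType) (V : normedModType R) n (M : set V) (T : V -> set V)
    (g g2 : V -> V -> V -> R) (dg dg2 : V -> V -> V -> V -> R) (K : V -> V) : Prop :=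
  GeodesicFlow {
  gf_sep : coord_separated V;
  gf_form : smooth_form g dg;
  gf_form2 : smooth_form g2 dg2;
  gf_sym : forall x v w, g x v w = g x w v;
  gf_sym2 : forall x v w, g2 x v w = g2 x w v;
  gf_lin : cont_linear K;
  gf_lie : forall x v w, lie_form (g := g) (dg := dg) K x v w = g2 x v w;
  gf_chart : forall (D : set 'rV[R]_n) phi, parametrization M D phi ->
    forall u, D u -> forall v, T (phi u) v <-> exists a, 'D_a phi u = v;
  gf_sub : submanifold n M;
  gf_pos : forall x v, M x -> T x v -> v != 0 -> 0 < g x v v;
  gf_tan : forall x, M x -> T x (K x);
  gf_unit : forall x, M x -> g x (K x) (K x) = 1;
  gf_closed : forall x w, M x -> T x w ->
    ext_form (g := g) (dg := dg) K x (K x) w = 0 }.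

Definition flow_lines (R : realType) (V : normedModType R) (K : V -> V) (x : V) : set V :=
  [set v | exists s : R, v = s *: K x].

Section GeodesicFlow.
Context {R : realType} {V : normedModType R} {n : nat}.
Context {M : set V} {T : V -> set V}.
Context {g g2 : V -> V -> V -> R} {dg dg2 : V -> V -> V -> V -> R} {K : V -> V}.
Hypothesis gf : geodesic_flow n M T g g2 dg dg2 K.

Let sV : coord_separated V.
Proof. exact: (gf_sep gf). Qed.
Let gS : smooth_form g dg.
Proof. exact: (gf_form gf). Qed.
Let g2S : smooth_form g2 dg2.
Proof. exact: (gf_form2 gf). Qed.
Let g_sym : forall x v w, g x v w = g x w v.
Proof. exact: (gf_sym gf). Qed.
Let g2_sym : forall x v w, g2 x v w = g2 x w v.
Proof. exact: (gf_sym2 gf). Qed.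
Let KL : cont_linear K.
Proof. exact: (gf_lin gf). Qed.
Let g2E : forall x v w, lie_form (g := g) (dg := dg) K x v w = g2 x v w.
Proof. exact: (gf_lie gf). Qed.
Let T_chart : forall (D : set 'rV[R]_n) phi, parametrization M D phi ->
  forall u, D u -> forall v, T (phi u) v <-> exists a, 'D_a phi u = v.
Proof. exact: (gf_chart gf). Qed.
Let M_chart : submanifold n M.
Proof. exact: (gf_sub gf). Qed.
Let g_pos : forall x v, M x -> T x v -> v != 0 -> 0 < g x v v.
Proof. exact: (gf_pos gf). Qed.
Let T_K : forall x, M x -> T x (K x).
Proof. exact: (gf_tan gf). Qed.
Let K_unit : forall x, M x -> g x (K x) (K x) = 1.
Proof. exact: (gf_unit gf). Qed.
Let K_closed : forall x w, M x -> T x w -> ext_form (g := g) (dg := dg) K x (K x) w = 0.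
Proof. exact: (gf_closed gf). Qed.

Local Notation F := (flow_lines K).

Section Chart.
Variables (D : set 'rV[R]_n) (phi : 'rV[R]_n -> V).
Hypothesis pD : parametrization M D phi.

Lemma chart_open : open D. Proof. by case: pD. Qed.
Lemma chart_Ck k : Ck k D phi. Proof. by case: pD => _ pC _ _ _; exact: pC. Qed.
Lemma chart_imm u a : D u -> 'D_a phi u = 0 -> a = 0.
Proof. by case: pD => _ _ pI _ _; exact: pI. Qed.

Lemma chart_in u : D u -> M (phi u).
Proof.
case: pD => oD _ _ _ hom Du; have [W _ E] := hom D oD (fun _ h => h).
have [] // : (M `&` W) (phi u) by rewrite -E; exists u.
Qed.

Lemma chart_tan u a : D u -> T (phi u) ('D_a phi u).
Proof. by move=> Du; exact: ((T_chart pD Du _).2 (ex_intro _ a erefl)). Qed.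

Lemma chart_pos u a : D u -> 'D_a phi u != 0 -> 0 < g (phi u) ('D_a phi u) ('D_a phi u).
Proof.
move=> Du a0; apply: g_pos => //; first exact: (chart_in Du).
exact: chart_tan.
Qed.

Lemma chart_K u : D u -> exists a, 'D_a phi u = K (phi u).
Proof. by move=> Du; exact: ((T_chart pD Du _).1 (T_K (chart_in Du))). Qed.

Lemma chart_Kunit u : D u -> g (phi u) (K (phi u)) (K (phi u)) = 1.
Proof. by move=> Du; exact/K_unit/chart_in. Qed.

Lemma chart_closed u c : D u ->
  ext_form (g := g) (dg := dg) K (phi u) (K (phi u)) ('D_c phi u) = 0.
Proof.
move=> Du; apply: K_closed; first exact: (chart_in Du).
exact: chart_tan.
Qed.

Definition chart_metric := gram_metric sV gS g_sym chart_open chart_Ck chart_imm chart_pos.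

Definition chart_field := pull_field g K phi.

Lemma chart_fieldE u : D u -> 'D_(chart_field u) phi u = K (phi u).
Proof.
exact: (pull_fieldE sV gS g_sym chart_open chart_Ck chart_imm chart_pos chart_K).
Qed.

Lemma chart_fieldC k : Ck k D chart_field.
Proof.
exact: (pull_fieldC sV gS g_sym KL chart_open chart_Ck chart_imm chart_pos).
Qed.

Lemma chart_gramE u a b : D u ->
  inner (gram g phi u) a b = g (phi u) ('D_a phi u) ('D_b phi u).
Proof. exact: (gramE sV gS chart_open chart_Ck). Qed.

Lemma chart_inj u a b : D u -> 'D_a phi u = 'D_b phi u -> a = b.
Proof. exact: (dphi_inj sV chart_open chart_Ck chart_imm). Qed.

Lemma chart_autoparallel u : D u ->
  'D_(chart_field u) chart_field u
  + Gam (gram g phi) u (chart_field u) (chart_field u) = 0.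
Proof.
apply: (field_autoparallel chart_open chart_metric (chart_fieldC 2)).
- exact: (X_form_unit sV gS g_sym chart_open chart_Ck chart_imm chart_pos chart_K
    chart_Kunit).
- exact: (pull_field_closed sV gS g_sym KL chart_open chart_Ck chart_imm chart_pos
    chart_K chart_closed).
Qed.

Lemma chart_dirZ u k a : D u -> 'D_(k *: a) phi u = k *: 'D_a phi u.
Proof. by move=> Du; apply: derive_dirZ sV chart_open Du (chart_Ck 1). Qed.

End Chart.

Lemma flow_riemannian : riemannian n M g.
Proof.
move=> D phi pD; split; first exact: (chart_metric pD).
by move=> u a b Du; rewrite (chart_gramE pD).
Qed.

Lemma flow_foliation : foliation1 n M F.
Proof.
move=> x Mx; have [D [phi [pD phix]]] := M_chart Mx.
exists D, phi, (chart_field phi); split=> //.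
  by move=> k; exact: chart_fieldC pD k.
move=> u Du; have E := chart_fieldE pD Du; split; last by rewrite /flow_lines E.
apply/eqP => X0; move: E; rewrite X0 derive0 => /esym K0.
have := chart_Kunit pD Du; rewrite K0 (sf0l gS) => /esym/eqP.
by rewrite oner_eq0.
Qed.

(** A unit-speed tangent curve has velocity [sg K] with [sg ^ 2 = 1]. The sign has zero derivative,
    so the second derivative of the curve is that of the autoparallel field, the sign entering only
    squared. *)
Lemma flow_geodesic (J : set R) (c : R -> V) : open J ->
  tangent_curve M F J c -> unit_speed g J c -> geodesic_on n M g J c.
Proof.
move=> oJ [cC cT] cU D phi I u pD oI IJ uC uc t k It.
have oD := chart_open pD; have phC := chart_Ck pD.
set X := chart_field phi.
have cI : forall s, I s -> phi (u s) = c s by move=> s /uc [].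
have uI s : I s -> D (u s) by move=> /uc [].
have dc s : I s -> derivable c s 1 by move=> /IJ; exact: CkS_derivable (cC 1%N).
have du s : I s -> derivable u s 1 by exact: CkS_derivable (uC 1%N).
have dcE s : I s -> derive1 c s = 'D_('D_1 u s) phi (u s).
  move=> Is; rewrite derive1E.
  have E : forall s, I s -> c s = phi (u s) by move=> r /cI.
  have dpu : derivable (fun r => phi (u r)) s 1 by exact: eq_derivable oI E Is (dc s Is).
  by rewrite (eq_derive (1 : R) oI E Is) (derive_chain sV oD (uI _ Is) (phC 1) (du _ Is) dpu).
pose sg s := g (c s) ('D_1 c s) (K (c s)).
have uX s : I s -> 'D_1 u s = sg s *: X (u s).
  move=> Is; apply: (chart_inj pD (uI _ Is)); rewrite -dcE// (chart_dirZ pD)//; last exact: uI.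
  rewrite (chart_fieldE pD (uI _ Is)) cI// /sg.
  have [_ [r Er]] := cT s (IJ _ Is); rewrite -derive1E Er (sfZl gS).
  by rewrite K_unit ?mulr1//; have [] := cT s (IJ _ Is).
have sg2 s : I s -> sg s * sg s = 1.
  move=> Is; have := cU s (IJ _ Is); rewrite dcE// uX// (chart_dirZ pD); last exact: uI.
  rewrite (chart_fieldE pD (uI _ Is)) cI// (sfZl gS) (sfZr gS) K_unit ?mulr1//.
  by have [] := cT s (IJ _ Is).
have sgD : derivable sg t 1.
  have cC1 k' : Ck k' J ('D_1 c) by exact: CkS_D (cC k'.+1).
  apply: (@CkS_derivable _ _ _ 0 J) (IJ _ It).
  by apply: (sf_Ck gS oJ); [exact: cC|exact: cC1|exact: Ck_lin (cC 1%N)].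
have sg'0 : 'D_1 sg t = 0.
  (* Differentiating [sg ^ 2 = 1] works at each point, on a domain that may be disconnected. *)
  have [d e] := is_derive_bilin (@cb_mul R) sgD sgD.
  have := eq_derive (1 : R) oI sg2 It; rewrite e derive_cst => E.
  have : sg t * 'D_1 sg t = 0.
    by move: E; rewrite mulrC; move: ('D_1 sg t) (sg t) => p q; lra.
  move/eqP; rewrite mulf_eq0 => /orP[/eqP s0|/eqP //].
  by have := sg2 t It; rewrite s0 mul0r => /esym/eqP; rewrite oner_eq0.
have d2u : derive1 (derive1 u) t 0 k = ('D_(X (u t)) X (u t)) 0 k.
  have -> : derive1 u = 'D_1 u by apply/funext => s; exact: derive1E.
  rewrite derive1E.
  have ddu : derivable ('D_1 u) t 1 by apply: CkS_derivable (CkS_D (1 : R) (uC 2%N)) It.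
  have [_ <-] := is_derive_lin (cl_entry 0 k) ddu.
  have E s : I s -> 'D_1 u s 0 k = sg s * X (u s) 0 k.
    by move=> Is; rewrite uX// mxE.
  rewrite (eq_derive (1 : R) oI E It).
  have XkC : Ck 1 D (fun w => X w 0 k) := Ck_lin oD (cl_entry 0 k) (chart_fieldC pD 1).
  have [dXk eXk] := is_derive_chain oD (uI _ It) XkC (du _ It).
  have [_ ->] := is_derive_bilin (@cb_mul R) sgD dXk.
  rewrite sg'0 mul0r add0r eXk uX//.
  rewrite (derive_dirZ _ _ (@separated_scalar R) oD (uI _ It) XkC) scaler_R mulrA sg2// mul1r.
  by have [_ ->] := is_derive_lin (cl_entry 0 k)
    (CkS_derivable (chart_fieldC pD 1) (uI _ It) : derivable X (u t) (X (u t))).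
rewrite d2u derive1E -/(inner _ _ _).
have -> : \sum_i \sum_j Gamma (gram g phi) (u t) k i j * 'D_1 u t 0 i * 'D_1 u t 0 j
    = Gam (gram g phi) (u t) ('D_1 u t) ('D_1 u t) 0 k.
  rewrite (GamE oD (chart_metric pD) _ _ _ (uI _ It)) inner_sumE.
  by apply: eq_bigr => i _; apply: eq_bigr => j _; rewrite mxE.
have GZ : Gam (gram g phi) (u t) ('D_1 u t) ('D_1 u t) 0 k =
    Gam (gram g phi) (u t) (X (u t)) (X (u t)) 0 k.
  rewrite uX// !(GamE oD (chart_metric pD) _ _ _ (uI _ It)) innerZl innerZr.
  by rewrite mulrA sg2// mul1r.
rewrite GZ; have := chart_autoparallel pD (uI _ It).
by move/(congr1 (fun v : 'rV[R]_n => v 0 k)); rewrite !mxE.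
Qed.

Section MixedCurvature.
Variable s : V -> V -> V.
Hypothesis sE : forall x w, M x -> T x w -> T x (s x w) /\
  forall z, T x z -> 2 * g x (s x w) z = g2 x w z + ext_form (g := g) (dg := dg) K x w z.

(** The unnormalised curvature [g(R(w, K) K, w)] for [w] orthogonal to [K]; the subtracted bracket
    is half the second Lie derivative of [g]. *)
Definition jacobi_form x w : R :=
  g x (s x w) (s x w) - (dg2 x (K x) w w / 2 + g2 x (K w) w).

Lemma sec_flow (D : set 'rV[R]_n) phi u b (r : R) : parametrization M D phi -> D u ->
  r != 0 -> g (phi u) (K (phi u)) ('D_b phi u) = 0 ->
  sec (gram g phi) u (r *: chart_field phi u) b =
  jacobi_form (phi u) ('D_b phi u) / g (phi u) ('D_b phi u) ('D_b phi u).
Proof.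
move=> pD Du r0 perp; set X := chart_field phi.
have Mu := chart_in pD Du; have Tb := chart_tan pD b Du.
have [Ts sz] := sE Mu Tb.
have N := sec_num_pull sV gS g2S g_sym g2_sym KL g2E (chart_open pD) (chart_Ck pD)
  (chart_imm pD) (chart_pos pD) (chart_K pD) (chart_Kunit pD)
  (chart_closed pD) Du ((T_chart pD Du _).1 Ts) (fun c => sz _ (chart_tan pD c Du)).
have {}N : sec_num (gram g phi) u (X u) b = jacobi_form (phi u) ('D_b phi u).
  rewrite /jacobi_form; move: N; rewrite -/(chart_field phi) -/X.
  by move: (sec_num _ _ _ _) (g _ _ _) (g2 _ _ _) (dg2 _ _ _ _) => *; lra.
rewrite /sec -/(sec_num (gram g phi) u (r *: X u) b) sec_numZ N.
rewrite !innerZl !innerZr !(chart_gramE pD _ _ Du) (chart_fieldE pD Du) perp.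
rewrite (chart_Kunit pD Du) mulr1 mulr0 expr0n subr0 -expr2.
by rewrite invfM mulrACA divff ?mul1r// expf_neq0.
Qed.

Lemma mixed_curvaturesP k : mixed_curvatures n M g F k <->
  exists x w, [/\ M x, T x w, w != 0, g x (K x) w = 0 & k = jacobi_form x w / g x w w].
Proof.
split=> [[x [v [w [[r vE] v0 w0 perp]]]]|[x [w [Mx Tw w0 perp kE]]]].
  move=> [D [phi [u [a [b [[pD Du ux] [av bw kE]]]]]]].
  subst x; have perp1 : g (phi u) (K (phi u)) w = 0.
    by apply: perp; exists 1; rewrite scale1r.
  have r0 : r != 0 by apply: contraNneq v0 => r0; rewrite vE r0 scale0r.
  have aE : a = r *: chart_field phi u.
    apply: (chart_inj pD Du); rewrite av (chart_dirZ pD _ _ Du).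
    by rewrite (chart_fieldE pD Du).
  exists (phi u), w; split=> //; first exact: (chart_in pD Du).
    by rewrite -bw; exact: (chart_tan pD b Du).
  by rewrite kE aE (sec_flow pD Du r0) bw.
have [D [phi [pD [u Du ux]]]] := M_chart Mx.
have [b bw] : exists b, 'D_b phi u = w by apply: (T_chart pD Du _).1; rewrite ux.
exists x, (K x), w; split=> //.
- by exists 1; rewrite scale1r.
- apply/eqP => K0; have := K_unit Mx; rewrite K0 (sf0l gS) => /eqP.
  by rewrite eq_sym oner_eq0.
- by move=> v' [r ->]; rewrite (sfZl gS) perp mulr0.
exists D, phi, u, (1 *: chart_field phi u), b; split=> //; split=> //.
  by rewrite scale1r (chart_fieldE pD Du) ux.
have o0 : (1 : R) != 0 by rewrite oner_eq0.
have perp' : g (phi u) (K (phi u)) ('D_b phi u) = 0 by rewrite ux bw.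
by rewrite (sec_flow pD Du o0 perp') bw ux.
Qed.

End MixedCurvature.

(** For a Riemannian submersion the transverse part [g - theta theta] is pulled back from the base,
    hence invariant along the leaves. On vectors orthogonal to [K] its Lie derivative equals that of
    [g], namely [g2], which would then vanish. *)
Lemma flow_not_bundle_like x v w : M x -> T x v -> T x w -> g x (K x) v = 0 ->
  g x (K x) w = 0 -> g2 x v w != 0 -> ~ bundle_like n M g F.
Proof.
move=> Mx Tv Tw v_hor w_hor g2n0 BL; move/eqP: g2n0; apply.
have [D [phi [B [h [f [[pD [u Du ux] oO mh] [fC fDO fker fhor]]]]]]] := BL x Mx.
have oD := chart_open pD; set X := chart_field phi.
have sW := @separated_mx R 1 n.-1.
have [a av] : exists a, 'D_a phi u = v by apply: (T_chart pD Du _).1; rewrite ux.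
have [b bw] : exists b, 'D_b phi u = w by apply: (T_chart pD Du _).1; rewrite ux.
pose th c y := g (phi y) (K (phi y)) ('D_c phi y).
have fX y : D y -> 'D_(X y) f y = 0.
  by move=> Dy; apply/(fker _ _ Dy); exists 1; rewrite scale1r (chart_fieldE pD Dy).
(* The hypothesis speaks of horizontal vectors only. Projecting turns it into the identity [key]
   between arbitrary coordinate vectors on all of [D], which can be differentiated. *)
pose hor c y := c - th c y *: X y.
have f_hor c y : D y -> 'D_(hor c y) f y = 'D_c f y.
  move=> Dy; rewrite /hor addrC -scaleNr (derive_dirP _ _ _ sW oD Dy (fC 1%N)).
  by rewrite fX// scaler0 add0r.
have phi_hor c y : D y -> 'D_(hor c y) phi y = 'D_c phi y - th c y *: K (phi y).
  move=> Dy; rewrite /hor addrC -scaleNr (derive_dirP _ _ _ sV oD Dy (chart_Ck pD 1)).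
  by rewrite (chart_fieldE pD Dy) scaleNr addrC.
have hor_perp c y : D y -> forall z, F (phi y) z -> g (phi y) z ('D_(hor c y) phi y) = 0.
  move=> Dy z [r ->]; rewrite phi_hor// (sfZl gS) -scaleNr (sfDr gS) (sfZr gS).
  by rewrite (chart_Kunit pD Dy) mulr1 subrr mulr0.
have proj z P Q k : g z k k = 1 -> g z (P - g z k P *: k) (Q - g z k Q *: k) =
    g z P Q - g z k P * g z k Q.
  move=> k1; rewrite -!(scaleNr _ k) !(sfDl gS) !(sfDr gS) !(sfZl gS) !(sfZr gS) k1.
  rewrite (g_sym z P k).
  by move: (g z P Q) (g z k P) (g z k Q) => p q s; ring.
have key c d y : D y -> g (phi y) ('D_c phi y) ('D_d phi y) - th c y * th d y =
    inner (h (f y)) ('D_c f y) ('D_d f y).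
  move=> Dy; rewrite -(f_hor c y Dy) -(f_hor d y Dy).
  have E := fhor y _ _ Dy (hor_perp c y Dy) (hor_perp d y Dy).
  apply: etrans E; rewrite (phi_hor c y Dy) (phi_hor d y Dy).
  exact/esym/proj/(chart_Kunit pD Dy).
have th_a : th a u = 0 by rewrite /th av ux.
have th_b : th b u = 0 by rewrite /th bw ux.
have thD c : is_derive u (X u) (th c) ('D_(X u) (th c) u).
  apply: derivableP; apply: CkS_derivable (_ : Ck 1 D (th c)) Du.
  apply: (sf_Ck gS oD); [exact: chart_Ck pD 1|exact: Ck_lin (chart_Ck pD 1)|].
  by apply: CkS_D; exact: chart_Ck pD 2.
have dG : is_derive u (X u) (gram g phi) ('D_(X u) (gram g phi) u).
  by apply: derivableP; exact: (metric_derivable oD (chart_metric pD)).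
(* The map [f] is constant along the flow, so the base metric contributes nothing. *)
have dh : is_derive u (X u) (fun y => h (f y)) 0.
  have de i j : is_derive u (X u) (fun y => h (f y) i j) 0.
    have dfu : derivable f u (X u) := CkS_derivable (fC 1%N) Du.
    have Ofu : B (f u) by apply: fDO; exists u.
    have [hC _ _] := mh; have := is_derive_chain oO Ofu (hC i j 1%N) dfu.
    by rewrite fX// derive0.
  have dm : derivable (fun y => h (f y)) u (X u).
    by apply/derivable_mxP => i j; have [] := de i j.
  split=> //; rewrite derive_mx//; apply/matrixP => i j; rewrite !mxE.
  by have [_ ->] := de i j.
(* From the derivative of ['D_(X y) f y = 0] along [c], after exchanging derivatives. *)
have ddf c : is_derive u (X u) ('D_c f) (- 'D_('D_c X u) f u).
  have d1 : derivable ('D_c f) u (X u) by apply: CkS_derivable (CkS_D c (fC 2%N)) Du.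
  have dX : derivable X u c by exact: CkS_derivable (chart_fieldC pD 1) Du.
  have dF : is_derive u c (fun y => 'D_(X y) f y)
      ('D_c ('D_(X u) f) u + 'D_('D_c X u) f u).
    exact: is_derive_dirfield sW oD Du (fC 2%N) dX.
  have S : 'D_c ('D_(X u) f) u = 'D_(X u) ('D_c f) u by exact: schwarz sW oD Du (fC 2%N).
  have E0 : 'D_c ('D_(X u) f) u + 'D_('D_c X u) f u = 0.
    exact: (is_derive_unique oD Du fX dF (is_derive_cst 0 u c)).
  split; first exact: d1.
  move: E0 S; generalize ('D_c ('D_(X u) f) u) ('D_(X u) ('D_c f) u).
  generalize ('D_('D_c X u) f u) => p q r E0 <-.
  by apply/eqP; rewrite -addr_eq0 E0.
have lhs y : D y -> inner (gram g phi y) a b - th a y * th b y =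
    inner (h (f y)) ('D_a f y) ('D_b f y).
  by move=> Dy; rewrite (chart_gramE pD _ _ Dy) key.
have := is_derive_unique oD Du lhs (is_derive_sub (is_derive_inner_cst dG a b)
  (is_derive_bilin (@cb_mul R) (@ex_derive _ _ _ _ _ _ _ (thD a))
     (@ex_derive _ _ _ _ _ _ _ (thD b)))) (is_derive_inner3 dh (ddf a) (ddf b)).
have z0 y z : inner (0 : 'M[R]_n.-1) y z = 0 by rewrite -(scale0r 0) innerZm mul0r.
rewrite th_a th_b mulr0 mul0r addr0 subr0 z0 innerNl innerNr add0r.
move: (key ('D_a X u) b u Du) (key a ('D_b X u) u Du).
rewrite th_a th_b mulr0 mul0r !subr0.
have := lie1E sV gS g_sym KL g2E oD (chart_Ck pD) (chart_imm pD) (chart_pos pD)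
  (chart_K pD) a b Du.
rewrite /lie1; move: (chart_gramE pD ('D_a X u) b Du) (chart_gramE pD a ('D_b X u) Du).
rewrite av bw ux -/(chart_field phi) -/X.
by gen_inner; move: (g _ _ _) (g _ _ _) (g2 _ _ _) => *; lra.
Qed.

End GeodesicFlow.

(** * Quaternions *)

Section Quaternions.
Context {R : realType}.

Lemma sum_ord4 (F : 'I_4 -> R) : \sum_s F s = F o0 + F o1 + F o2 + F o3.
Proof.
by rewrite !big_ord_recr big_ord0 /= add0r; congr (F _ + F _ + F _ + F _); apply: val_inj.
Qed.

Section Rows.
Context {m : nat}.
Implicit Types (x y v w : 'M[R]_(m, 4)).
Local Notation Ri x := (rmulq x qi).
Local Notation Rj x := (rmulq x qj).
Local Notation Rk x := (rmulq x qk).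

Lemma row4_eq x y : (forall r, x r o0 = y r o0) -> (forall r, x r o1 = y r o1) ->
  (forall r, x r o2 = y r o2) -> (forall r, x r o3 = y r o3) -> x = y.
Proof.
move=> h0 h1 h2 h3; apply/matrixP => r s; case: s => -[|[|[|[|//]]]] h.
- by rewrite (_ : Ordinal h = o0) ?h0//; apply: val_inj.
- by rewrite (_ : Ordinal h = o1) ?h1//; apply: val_inj.
- by rewrite (_ : Ordinal h = o2) ?h2//; apply: val_inj.
- by rewrite (_ : Ordinal h = o3) ?h3//; apply: val_inj.
Qed.

Lemma rmulq_iE x r : (Ri x r o0 = - x r o1) * (Ri x r o1 = x r o0) *
  (Ri x r o2 = x r o3) * (Ri x r o3 = - x r o2).
Proof. by do !split; rewrite !mxE /=; ring. Qed.

Lemma rmulq_jE x r : (Rj x r o0 = - x r o2) * (Rj x r o1 = - x r o3) *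
  (Rj x r o2 = x r o0) * (Rj x r o3 = x r o1).
Proof. by do !split; rewrite !mxE /=; ring. Qed.

Lemma rmulq_kE x r : (Rk x r o0 = - x r o3) * (Rk x r o1 = x r o2) *
  (Rk x r o2 = - x r o1) * (Rk x r o3 = x r o0).
Proof. by do !split; rewrite !mxE /=; ring. Qed.

Lemma oppmx_entry x r s : (- x) r s = - x r s.
Proof. by rewrite mxE. Qed.

Lemma qjE (s : 'I_4) : (qj : 'rV[R]_4) 0 s = (s == o2)%:R.
Proof. by rewrite !mxE. Qed.

Lemma qkE (s : 'I_4) : (qk : 'rV[R]_4) 0 s = (s == o3)%:R.
Proof. by rewrite !mxE. Qed.

Opaque qi qj qk.
Definition rmulqE := (rmulq_iE, rmulq_jE, rmulq_kE, oppmx_entry, @opprK R).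

Lemma rmulq_ii x : Ri (Ri x) = - x.
Proof. by apply: row4_eq => r; rewrite !rmulqE. Qed.
Lemma rmulq_ij x : Rj (Ri x) = Rk x.
Proof. by apply: row4_eq => r; rewrite !rmulqE. Qed.
Lemma rmulq_ik x : Rk (Ri x) = - Rj x.
Proof. by apply: row4_eq => r; rewrite !rmulqE. Qed.
Lemma rmulq_ji x : Ri (Rj x) = - Rk x.
Proof. by apply: row4_eq => r; rewrite !rmulqE. Qed.
Lemma rmulq_jj x : Rj (Rj x) = - x.
Proof. by apply: row4_eq => r; rewrite !rmulqE. Qed.
Lemma rmulq_jk x : Rk (Rj x) = Ri x.
Proof. by apply: row4_eq => r; rewrite !rmulqE. Qed.
Lemma rmulq_ki x : Ri (Rk x) = Rj x.
Proof. by apply: row4_eq => r; rewrite !rmulqE. Qed.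
Lemma rmulq_kj x : Rj (Rk x) = - Ri x.
Proof. by apply: row4_eq => r; rewrite !rmulqE. Qed.
Lemma rmulq_kk x : Rk (Rk x) = - x.
Proof. by apply: row4_eq => r; rewrite !rmulqE. Qed.

Definition rmulq2 := (rmulq_ii, rmulq_ij, rmulq_ik, rmulq_ji, rmulq_jj, rmulq_jk,
  rmulq_ki, rmulq_kj, rmulq_kk).

Lemma dotC x y : dot x y = dot y x.
Proof. by apply: eq_bigr => r _; apply: eq_bigr => s _; rewrite mulrC. Qed.

Lemma dotDl x y z : dot (x + y) z = dot x z + dot y z.
Proof. exact: (cbDl (cb_dot m)). Qed.
Lemma dotDr x y z : dot z (x + y) = dot z x + dot z y.
Proof. exact: (cbDr (cb_dot m)). Qed.
Lemma dotZl a x z : dot (a *: x) z = a * dot x z.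
Proof. exact: (cbZl (cb_dot m)). Qed.
Lemma dotZr a x z : dot z (a *: x) = a * dot z x.
Proof. exact: (cbZr (cb_dot m)). Qed.
Lemma dotNl x z : dot (- x) z = - dot x z.
Proof. by rewrite -scaleN1r dotZl mulN1r. Qed.
Lemma dotNr x z : dot z (- x) = - dot z x.
Proof. by rewrite -scaleN1r dotZr mulN1r. Qed.
Lemma dot0l z : dot (0 : 'M[R]_(m, 4)) z = 0.
Proof. by rewrite -(scale0r 0) dotZl mul0r. Qed.
Lemma dot0r z : dot z (0 : 'M[R]_(m, 4)) = 0.
Proof. by rewrite dotC dot0l. Qed.

Lemma dot_i x y : dot x (Ri y) = - dot (Ri x) y.
Proof.
rewrite /dot -sumrN; apply: eq_bigr => r _; rewrite !sum_ord4 !rmulqE; ring.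
Qed.
Lemma dot_j x y : dot x (Rj y) = - dot (Rj x) y.
Proof.
rewrite /dot -sumrN; apply: eq_bigr => r _; rewrite !sum_ord4 !rmulqE; ring.
Qed.
Lemma dot_k x y : dot x (Rk y) = - dot (Rk x) y.
Proof.
rewrite /dot -sumrN; apply: eq_bigr => r _; rewrite !sum_ord4 !rmulqE; ring.
Qed.

Definition dotq := (dot_i, dot_j, dot_k, rmulq2, dotNl, dotNr, @opprK R).

Lemma dot_xi x : dot (Ri x) x = 0.
Proof. by have := dot_i x x; rewrite dotC; move: (dot _ _) => a; lra. Qed.
Lemma dot_xj x : dot (Rj x) x = 0.
Proof. by have := dot_j x x; rewrite dotC; move: (dot _ _) => a; lra. Qed.
Lemma dot_xk x : dot (Rk x) x = 0.
Proof. by have := dot_k x x; rewrite dotC; move: (dot _ _) => a; lra. Qed.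

Lemma dot_ge0 x : 0 <= dot x x.
Proof. by apply: sumr_ge0 => r _; apply: sumr_ge0 => s _; rewrite -expr2 sqr_ge0. Qed.

Lemma dot_eq0 x : dot x x = 0 -> x = 0.
Proof.
move=> x0; apply/matrixP => r s; rewrite mxE.
have ge r' : 0 <= \sum_s x r' s * x r' s by apply: sumr_ge0 => s' _; rewrite -expr2 sqr_ge0.
have /allP/(_ r (mem_index_enum _)) : all (fun r => (true ==> (\sum_s x r s * x r s == 0)))
    (index_enum 'I_m).
  by rewrite -psumr_eq0 ?x0//=; apply/eqP.
rewrite psumr_eq0; last by move=> s' _; rewrite -expr2 sqr_ge0.
by move=> /allP/(_ s (mem_index_enum _)) /=; rewrite -expr2 sqrf_eq0 => /eqP.
Qed.

Lemma rmulqN x q : rmulq (- x) q = - rmulq x q.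
Proof. by rewrite -scaleN1r rmulqZ scaleN1r. Qed.

Definition rmulq_lin := (@row_qmulD R m, @rmulqZ R m, rmulqN).

End Rows.

(** For [y] nonzero, [y], [y i], [y j], [y k] form an orthogonal basis of H; the factor [dot y y]
    avoids a division. *)
Lemma quat_decomp (y w : 'rV[R]_4) : dot y y *: w = dot y w *: y
  + dot (rmulq y qi) w *: rmulq y qi + dot (rmulq y qj) w *: rmulq y qj
  + dot (rmulq y qk) w *: rmulq y qk.
Proof.
have E (z : 'rV[R]_4) a r s : (a *: z) r s = a * z r s by rewrite mxE.
have A (x z : 'rV[R]_4) r s : (x + z) r s = x r s + z r s by rewrite mxE.
apply: row4_eq => r; rewrite ord1 !A !E /dot !big_ord1 !sum_ord4 !rmulqE; ring.
Qed.

End Quaternions.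

(** * The family of metrics *)

Section FormClosure.
Context {R : realType} {V : normedModType R}.

Lemma sf_const (B : V -> V -> R) : cont_bilinear B ->
  smooth_form (fun _ v w => B v w) (fun _ _ _ _ => 0).
Proof.
move=> cB; split.
- by move=> x k v v' w; rewrite (cbDl cB) (cbZl cB).
- by move=> x v k w w'; rewrite (cbDr cB) (cbZr cB).
- by move=> W k D x v w oD xC vC wC; exact: (Ck_bilin oD cB).
- move=> W x v w t c x' v' w' _ [dv <-] [dw <-]; rewrite add0r.
  exact: is_derive_bilin.
Qed.

Lemma sf_prod (a b : V -> V -> R) : cont_bilinear a -> cont_bilinear b ->
  smooth_form (fun x v w => a x v * b x w)
    (fun x z v w => a z v * b x w + a x v * b z w).
Proof.
move=> ca cb; split.
- move=> x k v v' w; rewrite (cbDr ca) (cbZr ca) scaler_R; ring.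
- move=> x v k w w'; rewrite (cbDr cb) (cbZr cb) scaler_R; ring.
- by move=> W k D x v w oD xC vC wC; apply: (CkM oD); exact: Ck_bilin.
- move=> W x v w t c x' v' w' [dx <-] [dv <-] [dw <-].
  have [d1 e1] := is_derive_bilin ca dx dv.
  have [d2 e2] := is_derive_bilin cb dx dw.
  have [d3 e3] := is_derive_bilin (@cb_mul R) d1 d2.
  split=> //; rewrite e3 e1 e2; move: (a _ _) (a _ _) (a _ _) (b _ _) (b _ _) (b _ _) => *.
  ring.
Qed.

Lemma sf_add (g g' : V -> V -> V -> R) dg dg' : smooth_form g dg -> smooth_form g' dg' ->
  smooth_form (fun x v w => g x v w + g' x v w) (fun x z v w => dg x z v w + dg' x z v w).
Proof.
move=> gS gS'; split.
- move=> x k v v' w; rewrite (sf_linl gS) (sf_linl gS'); ring.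
- move=> x v k w w'; rewrite (sf_linr gS) (sf_linr gS'); ring.
- by move=> W k D x v w oD xC vC wC; apply: (CkD oD); [exact: (sf_Ck gS)|exact: (sf_Ck gS')].
- move=> W x v w t c x' v' w' dx dv dw.
  have := is_derive_add (sf_D gS dx dv dw) (sf_D gS' dx dv dw).
  set d1 := (X in is_derive _ _ _ X -> _); set d2 := (X in _ -> is_derive _ _ _ X).
  by rewrite (_ : d1 = d2)// /d1 /d2; ring.
Qed.

Lemma sf_scale (g : V -> V -> V -> R) dg (k : R) : smooth_form g dg ->
  smooth_form (fun x v w => k * g x v w) (fun x z v w => k * dg x z v w).
Proof.
move=> gS; split.
- move=> x r v v' w; rewrite (sf_linl gS); ring.
- move=> x v r w w'; rewrite (sf_linr gS); ring.
- move=> W j D x v w oD xC vC wC; apply: (CkM oD); first exact: Ck_cst.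
  exact: (sf_Ck gS).
- move=> W x v w t c x' v' w' dx dv dw.
  have [d e] := sf_D gS dx dv dw.
  have [d1 e1] := is_derive_lin (cl_scale R k) d.
  by split=> //; rewrite e1 e scaler_R; ring.
Qed.

End FormClosure.

Ltac gen_dot := repeat match goal with
  |- context [@dot ?R ?n ?a ?b] =>
    let x := fresh "x" in generalize (@dot R n a b) => x end.

Section HopfForms.
Context {R : realType} {m : nat}.
Local Notation E := ('M[R]_(m, 4) * 'rV[R]_4)%type.
Implicit Types (x v w z : E).

Definition heta (q : 'rV[R]_4) x v : R := dot (rmulq x.1 q) v.1.
Definition hsig (q : 'rV[R]_4) x v : R := dot (rmulq x.2 q) v.2.

Lemma cb_eta q : cont_bilinear (heta q).
Proof.
apply: (cb_comp (cb_dot m)); last exact: cl_fst.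
exact: (cl_comp (cl_rmulq m q) (cl_fst _ _)).
Qed.

Lemma cb_sig q : cont_bilinear (hsig q).
Proof.
apply: (cb_comp (cb_dot 1)); last exact: cl_snd.
exact: (cl_comp (cl_rmulq 1 q) (cl_snd _ _)).
Qed.

Lemma cb_dot1 : cont_bilinear (fun v w : E => dot v.1 w.1).
Proof. by apply: (cb_comp (cb_dot m)); exact: cl_fst. Qed.

Lemma cb_dot2 : cont_bilinear (fun v w : E => dot v.2 w.2).
Proof. by apply: (cb_comp (cb_dot 1)); exact: cl_snd. Qed.

End HopfForms.

Ltac gen_eta := repeat match goal with
  | |- context [heta ?a ?b ?c] => let x := fresh "x" in generalize (heta a b c) => x
  | |- context [hsig ?a ?b ?c] => let x := fresh "x" in generalize (hsig a b c) => x
  end.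

Section HopfFlow.
Context {R : realType} {m : nat}.
Local Notation E := ('M[R]_(m, 4) * 'rV[R]_4)%type.
Implicit Types (x v w z : E).

Variables (om l2 d2 e2 pp qq : R).

(** The coefficients stay independent because the Lie derivative and [d theta] are linear in them;
    [fam_form] inserts the geometric values. *)
Definition hopf_form x v w : R :=
  l2 * dot v.1 w.1 + d2 * dot v.2 w.2 + e2 * (heta qj x v * heta qj x w)
  + pp * (heta qi x v * hsig qi x w + hsig qi x v * heta qi x w)
  + qq * (heta qk x v * hsig qi x w + hsig qi x v * heta qk x w).

(** The zero terms come from the constant forms; they keep the expression convertible to what
    [sf_add], [sf_scale] and [sf_prod] assemble. *)
Definition hopf_dform x z v w : R :=
  l2 * 0 + d2 * 0 + e2 * (heta qj z v * heta qj x w + heta qj x v * heta qj z w)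
  + pp * (heta qi z v * hsig qi x w + heta qi x v * hsig qi z w
          + (hsig qi z v * heta qi x w + hsig qi x v * heta qi z w))
  + qq * (heta qk z v * hsig qi x w + heta qk x v * hsig qi z w
          + (hsig qi z v * heta qk x w + hsig qi x v * heta qk z w)).

Lemma hopf_smooth : smooth_form hopf_form hopf_dform.
Proof.
have P a b := sf_prod (@cb_eta R m a) (@cb_sig R m b).
have Q a b := sf_prod (@cb_sig R m a) (@cb_eta R m b).
exact: (sf_add (sf_add (sf_add (sf_add (sf_scale l2 (sf_const (@cb_dot1 R m)))
  (sf_scale d2 (sf_const (@cb_dot2 R m)))) (sf_scale e2 (sf_prod (@cb_eta R m qj) (@cb_eta R m qj))))
  (sf_scale pp (sf_add (P qi qi) (Q qi qi)))) (sf_scale qq (sf_add (P qk qi) (Q qi qk)))).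
Qed.

(** The flow rotates the pair [eta_2], [eta_3] with angular speed [2 om] and fixes [eta_1] and
    [sigma_1], so only the [e2] and [qq] terms of the metric vary. *)
Definition hopf_lie x v w : R :=
  2 * om * e2 * (heta qj x v * heta qk x w + heta qk x v * heta qj x w)
  + - (2 * om * qq) * (heta qj x v * hsig qi x w + hsig qi x v * heta qj x w).

Definition hopf_dlie x z v w : R :=
  2 * om * e2 * (heta qj z v * heta qk x w + heta qj x v * heta qk z w
                 + (heta qk z v * heta qj x w + heta qk x v * heta qj z w))
  + - (2 * om * qq) * (heta qj z v * hsig qi x w + heta qj x v * hsig qi z w
                 + (hsig qi z v * heta qj x w + hsig qi x v * heta qj z w)).

Lemma hopf_lie_smooth : smooth_form hopf_lie hopf_dlie.
Proof.
exact: (sf_add (sf_scale (2 * om * e2) (sf_add (sf_prod (@cb_eta R m qj) (@cb_eta R m qk))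
  (sf_prod (@cb_eta R m qk) (@cb_eta R m qj)))) (sf_scale (- (2 * om * qq))
  (sf_add (sf_prod (@cb_eta R m qj) (@cb_sig R m qi)) (sf_prod (@cb_sig R m qi) (@cb_eta R m qj))))).
Qed.

Lemma hopf_sym x v w : hopf_form x v w = hopf_form x w v.
Proof.
rewrite /hopf_form (dotC v.1) (dotC v.2).
by move: (heta _ _ _) (heta _ _ _) (heta _ _ _) (hsig _ _ _) => *; ring.
Qed.

Lemma hopf_lie_sym x v w : hopf_lie x v w = hopf_lie x w v.
Proof.
by rewrite /hopf_lie; move: (heta _ _ _) (heta _ _ _) (heta _ _ _) (hsig _ _ _) => *; ring.
Qed.

Definition hopf_gen x : E := (om *: rmulq x.1 qi, 0).

Lemma hopf_gen_linear : cont_linear hopf_gen.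
Proof.
apply: (cl_comp (cl_inl _ _)); apply: (cl_comp (cl_scale _ om)).
exact: (cl_comp (cl_rmulq m qi) (cl_fst _ _)).
Qed.

Lemma sig_gen q x v : hsig q (hopf_gen x) v = 0.
Proof. by rewrite /hsig /= -(scale0r 0) rmulqZ !scale0r dot0l. Qed.

Lemma sig_genr q x v : hsig q x (hopf_gen v) = 0.
Proof. by rewrite /hsig /= dot0r. Qed.

Lemma lie_eta_i x v : heta qi (hopf_gen x) v + heta qi x (hopf_gen v) = 0.
Proof. by rewrite /heta /= rmulqZ dotZl dotZr !dotq; gen_dot; ring. Qed.

Lemma lie_eta_j x v :
  heta qj (hopf_gen x) v + heta qj x (hopf_gen v) = 2 * om * heta qk x v.
Proof. by rewrite /heta /= rmulqZ dotZl dotZr !dotq; gen_dot; ring. Qed.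

Lemma lie_eta_k x v :
  heta qk (hopf_gen x) v + heta qk x (hopf_gen v) = - (2 * om) * heta qj x v.
Proof. by rewrite /heta /= rmulqZ dotZl dotZr !dotq; gen_dot; ring. Qed.

Lemma hopf_lieE x v w :
  lie_form (g := hopf_form) (dg := hopf_dform) hopf_gen x v w = hopf_lie x v w.
Proof.
rewrite /lie_form /hopf_form /hopf_dform /hopf_lie !sig_gen !sig_genr.
have d1 : dot (hopf_gen v).1 w.1 = - dot v.1 (hopf_gen w).1.
  by rewrite /= dotZl dotZr !dotq; gen_dot; ring.
have d2' : dot (hopf_gen v).2 w.2 = 0 by rewrite /= dot0l.
have d3 : dot v.2 (hopf_gen w).2 = 0 by rewrite /= dot0r.
have Ei u : heta qi x (hopf_gen u) = - heta qi (hopf_gen x) u.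
  by have := lie_eta_i x u; move: (heta _ _ _) (heta _ _ _) => *; lra.
have Ej u : heta qj x (hopf_gen u) = 2 * om * heta qk x u - heta qj (hopf_gen x) u.
  by have := lie_eta_j x u; move: (heta _ _ _) (heta _ _ _) (heta _ _ _) => *; lra.
have Ek u : heta qk x (hopf_gen u) = - (2 * om) * heta qj x u - heta qk (hopf_gen x) u.
  by have := lie_eta_k x u; move: (heta _ _ _) (heta _ _ _) (heta _ _ _) => *; lra.
rewrite d1 d2' d3 !Ei !Ej !Ek; gen_dot.
by gen_eta; ring.
Qed.

Definition tangent x v := dot x.1 v.1 = 0 /\ dot x.2 v.2 = 0.

Lemma gen_tangent x : tangent x (hopf_gen x).
Proof. by split; rewrite /= ?dot0r// dotZr !dotq dot_xi oppr0 mulr0. Qed.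

Lemma eta_gen_vals x : dot x.1 x.1 = 1 -> (heta qi x (hopf_gen x) = om) *
  (heta qj x (hopf_gen x) = 0) * (heta qk x (hopf_gen x) = 0).
Proof.
move=> x1; rewrite /heta /= !dotZr; do !split; rewrite !dotq ?dotNl.
- by rewrite x1 mulr1.
- by rewrite dot_xk mulr0.
- by rewrite dot_xj oppr0 mulr0.
Qed.

Lemma hopf_unit x : dot x.1 x.1 = 1 -> l2 * om ^+ 2 = 1 ->
  hopf_form x (hopf_gen x) (hopf_gen x) = 1.
Proof.
move=> x1 lo; rewrite /hopf_form !sig_genr !(eta_gen_vals x1) /= dot0l dotZl dotZr !dotq x1.
by rewrite -[RHS]lo; ring.
Qed.

(** On tangent vectors [theta] is [l2 om] times [heta qi] plus [pp om] times [hsig qi], and the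
    exterior derivative of [heta qi] is [2 <v i, w>], similarly for [hsig qi]. *)
Lemma hopf_ext x v w : dot x.1 x.1 = 1 -> tangent x v -> tangent x w ->
  ext_form (g := hopf_form) (dg := hopf_dform) hopf_gen x v w =
  2 * l2 * om * dot (rmulq v.1 qi) w.1 + 2 * pp * om * hsig qi v w.
Proof.
move=> x1 [v1 v2] [w1 w2].
have ti z : dot x.1 z.1 = 0 -> heta qi z (hopf_gen x) = 0 /\ heta qi x (hopf_gen z) = 0.
  by move=> z0; rewrite /heta /= !dotZr !dotq [dot z.1 _]dotC z0 mulr0.
have tj z : heta qj z (hopf_gen x) = - om * heta qk x z /\ heta qj x (hopf_gen z) = om * heta qk x z.
  by split; rewrite /heta /= !dotZr !dotq ?[dot _ x.1]dotC ?dot_k ?dot_j; gen_dot; ring.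
have tk z : heta qk z (hopf_gen x) = om * heta qj x z /\ heta qk x (hopf_gen z) = - om * heta qj x z.
  by split; rewrite /heta /= !dotZr !dotq ?[dot _ x.1]dotC ?dot_k ?dot_j; gen_dot; ring.
have [v3 v4] := ti v v1; have [v5 v6] := tj v; have [v7 v8] := tk v.
have [w3 w4] := ti w w1; have [w5 w6] := tj w; have [w7 w8] := tk w.
have sC : hsig qi w v = - hsig qi v w by rewrite /hsig dotC dot_i.
have dC : dot (rmulq w.1 qi) v.1 = - dot (rmulq v.1 qi) w.1 by rewrite dotC dot_i.
rewrite /ext_form /hopf_form /hopf_dform !sig_genr !(eta_gen_vals x1) v3 v4 v5 v6 v7 v8.
rewrite w3 w4 w5 w6 w7 w8 sC.
have g1 a : (hopf_gen a).1 = om *: rmulq a.1 qi by [].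
have g2 a : (hopf_gen a).2 = 0 by [].
rewrite !g1 !g2 !dotZl !dot0l dC.
by gen_dot; gen_eta; ring.
Qed.

(** Multiplying [K] by [i] gives a multiple of the normal [x.1], and [K] has no component in the
    second factor; both terms of [d theta] vanish. *)
Lemma hopf_closed x w : dot x.1 x.1 = 1 -> tangent x w ->
  ext_form (g := hopf_form) (dg := hopf_dform) hopf_gen x (hopf_gen x) w = 0.
Proof.
move=> x1 Tw; rewrite (hopf_ext x1 (gen_tangent x) Tw) sig_gen.
by rewrite /= rmulqZ dotZl !dotq (Tw.1); ring.
Qed.

End HopfFlow.

(** * Shape operator and Jacobi form of the family *)

Section FamilyForms.
Context {R : realType} {m : nat}.
Local Notation E := ('M[R]_(m, 4) * 'rV[R]_4)%type.
Implicit Types (x v w z : E).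
Variables (A D p q om : R).
Hypotheses (A0 : A != 0) (D0 : D != 0) (om0 : om != 0).
Hypothesis h0 : 1 - p ^+ 2 - q ^+ 2 != 0.
(** Taking [om = sqrt (A C) / 2] as parameter instead of [C] keeps square roots out of the
    identities below. *)
Local Notation C := (4 * om ^+ 2 / A).
Local Notation h2 := (1 - p ^+ 2 - q ^+ 2).

Definition fam_l2 : R := (om ^+ 2)^-1.
Definition fam_d2 : R := (2 / D) ^+ 2.
Definition fam_e2 : R := (2 / A) ^+ 2 - (om ^+ 2)^-1.
Definition fam_pp : R := 2 * p / (om * D).
Definition fam_qq : R := 2 * q / (om * D).
Definition fam_form := hopf_form (m := m) fam_l2 fam_d2 fam_e2 fam_pp fam_qq.
Definition fam_dform := hopf_dform (m := m) fam_l2 fam_d2 fam_e2 fam_pp fam_qq.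
Definition fam_lie := hopf_lie (m := m) om fam_e2 fam_qq.
Definition fam_dlie := hopf_dlie (m := m) om fam_e2 fam_qq.
Local Notation K := (hopf_gen om).
Local Notation ext := (ext_form (g := fam_form) (dg := fam_dform) K).

Definition b1 x v := heta qi x v / om.
Definition b2 x v := 2 / A * heta qj x v.
Definition b3 x v := heta qk x v / om.
Definition s1 x v := 2 / D * hsig qi x v.
Definition s2 x v := 2 / D * hsig qj x v.
Definition s3 x v := 2 / D * hsig qk x v.
(** Squared length, for the metric, of the part of [v.1] orthogonal to [xi_1], [xi_2], [xi_3]. *)
Definition hor_sq x v := (dot v.1 v.1 - heta qi x v ^+ 2 - heta qj x v ^+ 2
  - heta qk x v ^+ 2) / om ^+ 2.

(* Solves [2 g(s, z) = (L g)(w, z) + (d theta)(w, z)]; the coefficient along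
   [v_1] comes from inverting the Gram matrix of [u_1, u_3, v_1]. *)
Definition raise_v x w := q * (A - C) / (2 * h2) * b2 x w.
Definition raise x w : E :=
  (om *: (rmulq w.1 qi + heta qi x w *: x.1 + heta qj x w *: rmulq x.1 qk
          - heta qk x w *: rmulq x.1 qj)
   - (p * raise_v x w * om) *: rmulq x.1 qi
   + ((C * b3 x w - q * A * s1 x w) / 2 * (A / 2)) *: rmulq x.1 qj
   + (((C - 2 * A) * b2 x w / 2 - q * raise_v x w) * om) *: rmulq x.1 qk,
   (raise_v x w * (D / 2)) *: rmulq x.2 qi
   + (p * D * s3 x w / 2 * (D / 2)) *: rmulq x.2 qj
   - (p * D * s2 x w / 2 * (D / 2)) *: rmulq x.2 qk).

Section AtPoint.
Variables (x : E).
Hypotheses (x1 : dot x.1 x.1 = 1) (x2 : dot x.2 x.2 = 1).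

Lemma frame_dots (k : nat) (y : 'M[R]_(k, 4)) : dot y y = 1 ->
  (dot (rmulq y qi) (rmulq y qi) = 1) * (dot (rmulq y qj) (rmulq y qj) = 1) *
  (dot (rmulq y qk) (rmulq y qk) = 1) * (dot (rmulq y qi) (rmulq y qj) = 0) *
  (dot (rmulq y qi) (rmulq y qk) = 0) * (dot (rmulq y qj) (rmulq y qi) = 0) *
  (dot (rmulq y qj) (rmulq y qk) = 0) * (dot (rmulq y qk) (rmulq y qi) = 0) *
  (dot (rmulq y qk) (rmulq y qj) = 0).
Proof.
move=> y1; do !split; rewrite ?dotq ?dotNl ?opprK ?y1 ?dot_xi ?dot_xj ?dot_xk ?oppr0//.
Qed.

Lemma raise_tangent w : tangent x w -> tangent x (raise x w).
Proof.
move=> [w1 w2]; split.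
  rewrite /raise /=; rewrite !dotDr !dotNr !dotZr !dotDr !dotNr !dotZr !dotq.
  rewrite dot_xi dot_xj dot_xk x1 -/(heta qi x w); gen_eta; ring.
by rewrite /raise /= !dotDr !dotNr !dotZr !dotq dot_xi dot_xj dot_xk; ring.
Qed.

Lemma raise_eta_i w : tangent x w -> heta qi x (raise x w) = - p * raise_v x w * om.
Proof.
move=> [w1 w2]; rewrite {1}/heta /raise /=.
rewrite !dotDr !dotNr !dotZr !dotDr !dotNr !dotZr !(frame_dots x1).
rewrite (dot_i (rmulq x.1 qi) w.1) rmulq_ii dotNl w1 dot_xi.
by move: (raise_v _ _) (b3 _ _) (b2 _ _) (s1 _ _); gen_eta => *; ring.
Qed.

Lemma raise_eta_j w : tangent x w ->
  heta qj x (raise x w) = (C * b3 x w - q * A * s1 x w) / 2 * (A / 2).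
Proof.
move=> [w1 w2]; rewrite {1}/heta /raise /=.
rewrite !dotDr !dotNr !dotZr !dotDr !dotNr !dotZr !(frame_dots x1).
rewrite (dot_i (rmulq x.1 qj) w.1) rmulq_ji dotNl dot_xj -/(heta qk x w).
by move: (raise_v _ _) (b3 _ _) (b2 _ _) (s1 _ _); gen_eta => *; ring.
Qed.

Lemma raise_eta_k w : tangent x w ->
  heta qk x (raise x w) = ((C - 2 * A) * b2 x w / 2 - q * raise_v x w) * om.
Proof.
move=> [w1 w2]; rewrite {1}/heta /raise /=.
rewrite !dotDr !dotNr !dotZr !dotDr !dotNr !dotZr !(frame_dots x1).
rewrite (dot_i (rmulq x.1 qk) w.1) rmulq_ki dot_xk -/(heta qj x w).
by move: (raise_v _ _) (b3 _ _) (b2 _ _) (s1 _ _); gen_eta => *; ring.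
Qed.

Lemma raise_sig_i w : hsig qi x (raise x w) = raise_v x w * (D / 2).
Proof.
rewrite {1}/hsig /raise /= !dotDr !dotNr !dotZr !(frame_dots x2).
by move: (raise_v _ _) (s2 _ _) (s3 _ _) => *; ring.
Qed.

Lemma raise_dot1 w z : dot (raise x w).1 z.1 =
  om * (dot (rmulq w.1 qi) z.1 + heta qi x w * dot x.1 z.1 + heta qj x w * heta qk x z
        - heta qk x w * heta qj x z)
  - p * raise_v x w * om * heta qi x z
  + (C * b3 x w - q * A * s1 x w) / 2 * (A / 2) * heta qj x z
  + ((C - 2 * A) * b2 x w / 2 - q * raise_v x w) * om * heta qk x z.
Proof. by rewrite /raise /= !dotDl !dotNl !dotZl !dotDl !dotNl !dotZl. Qed.

Lemma raise_dot2 w z : dot (raise x w).2 z.2 =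
  raise_v x w * (D / 2) * hsig qi x z + p * D * s3 x w / 2 * (D / 2) * hsig qj x z
  - p * D * s2 x w / 2 * (D / 2) * hsig qk x z.
Proof. by rewrite /raise /= !dotDl !dotNl !dotZl. Qed.

Lemma sig_decomp w : tangent x w -> w.2 = hsig qi x w *: rmulq x.2 qi
  + hsig qj x w *: rmulq x.2 qj + hsig qk x w *: rmulq x.2 qk.
Proof.
move=> [_ w2]; have := quat_decomp x.2 w.2; rewrite x2 scale1r w2 scale0r add0r.
by [].
Qed.

(** Up to scale, the structure equation of S^3 that expresses [d sigma_1] through [sigma_2] and
    [sigma_3]. *)
Lemma sig_wedge w z : tangent x w -> tangent x z ->
  hsig qi w z = hsig qk x w * hsig qj x z - hsig qj x w * hsig qk x z.
Proof.
move=> Tw [_ z2]; rewrite {1}/hsig (sig_decomp Tw) !rmulq_lin !rmulq2.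
rewrite !dotDl !dotZl !dotNl z2 -/(hsig qj x z) -/(hsig qk x z); gen_eta; ring.
Qed.

Lemma raiseE w z : tangent x w -> tangent x z ->
  2 * fam_form x (raise x w) z = fam_lie x w z + ext x w z.
Proof.
move=> Tw Tz; rewrite (hopf_ext _ _ _ _ _ _ x1 Tw Tz) (sig_wedge Tw Tz).
rewrite /fam_form /fam_lie /hopf_form /hopf_lie raise_dot1 raise_dot2 Tz.1.
rewrite (raise_eta_i Tw) (raise_eta_j Tw) (raise_eta_k Tw) raise_sig_i.
rewrite /raise_v /b2 /b3 /s1 /s2 /s3 /fam_l2 /fam_d2 /fam_e2 /fam_pp /fam_qq.
gen_dot; gen_eta; field.
by rewrite A0 D0 om0 h0.
Qed.

Lemma sig_normE w : tangent x w ->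
  dot w.2 w.2 = hsig qi x w ^+ 2 + hsig qj x w ^+ 2 + hsig qk x w ^+ 2.
Proof.
move=> Tw; rewrite {1}(sig_decomp Tw) !dotDl !dotZl.
by rewrite -/(hsig qi x w) -/(hsig qj x w) -/(hsig qk x w); gen_eta; ring.
Qed.

Lemma fam_normE w : tangent x w -> fam_form x w w =
  hor_sq x w + b1 x w ^+ 2 + b2 x w ^+ 2 + b3 x w ^+ 2 + s1 x w ^+ 2 + s2 x w ^+ 2
  + s3 x w ^+ 2 + 2 * p * b1 x w * s1 x w + 2 * q * b3 x w * s1 x w.
Proof.
move=> Tw; rewrite /fam_form /hopf_form (sig_normE Tw).
rewrite /hor_sq /b1 /b2 /b3 /s1 /s2 /s3 /fam_l2 /fam_d2 /fam_e2 /fam_pp /fam_qq.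
gen_dot; gen_eta; field.
by rewrite A0 D0 om0.
Qed.

Lemma fam_perpE w : fam_form x (K x) w = b1 x w + p * s1 x w.
Proof.
rewrite /fam_form /hopf_form !sig_genr !(eta_gen_vals _ x1) /= dotZl dot0l.
rewrite -/(heta qi x w) /b1 /s1 /fam_l2 /fam_d2 /fam_e2 /fam_pp /fam_qq.
gen_eta; field.
by rewrite D0 om0.
Qed.

Lemma fam_jacobiE w : tangent x w ->
  jacobi_form (g := fam_form) (g2 := fam_lie) (dg2 := fam_dlie) (K := K) raise x w =
  A * C / 4 * hor_sq x w + (p * D) ^+ 2 / 4 * (s2 x w ^+ 2 + s3 x w ^+ 2)
  + (C * b3 x w - q * A * s1 x w) ^+ 2 / 4 + (A - C) * C * b3 x w ^+ 2
  + q * A * C * b3 x w * s1 x w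
  + (((1 - p ^+ 2) * (C - 2 * A) ^+ 2 + q ^+ 2 * (2 * A * C - 3 * A ^+ 2)) / (4 * h2)
     - (A - C) * A) * b2 x w ^+ 2.
Proof.
move=> Tw; have Ts := raise_tangent Tw.
(* Pairing the defining equation of [raise] with [raise x w] itself makes the squared norm linear in
   the shape operator. *)
have N : fam_form x (raise x w) (raise x w) =
    (fam_lie x w (raise x w) + ext x w (raise x w)) / 2.
  by rewrite -(raiseE Tw Ts); field.
rewrite /jacobi_form N (hopf_ext _ _ _ _ _ _ x1 Tw Ts) (sig_wedge Tw Ts).
(* Half the second Lie derivative; rotating [eta_2] and [eta_3] once more produces the difference of
   squares. *)
have lL : fam_dlie x (K x) w w / 2 + fam_lie x (K w) w =
    4 * om ^+ 2 * (fam_e2 * (heta qk x w ^+ 2 - heta qj x w ^+ 2)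
      - fam_qq * heta qk x w * hsig qi x w).
  rewrite /fam_dlie /fam_lie /hopf_dlie /hopf_lie !sig_gen !sig_genr.
  move: (lie_eta_j om x w) (lie_eta_k om x w).
  generalize (heta qj (K x) w) (heta qk (K x) w) (heta qj x (K w)) (heta qk x (K w)).
  move=> t1 t2 t3 t4 e1 e2'; have -> : t3 = 2 * om * heta qk x w - t1 by rewrite -e1; ring.
  have -> : t4 = - (2 * om) * heta qj x w - t2 by rewrite -e2'; ring.
  by gen_eta; field.
rewrite lL.
have dS : dot (rmulq w.1 qi) (raise x w).1 = om * (dot w.1 w.1 - heta qi x w ^+ 2
    - heta qj x w ^+ 2 - heta qk x w ^+ 2)
    + (C * b3 x w - q * A * s1 x w) / 2 * (A / 2) * heta qk x w
    - ((C - 2 * A) * b2 x w / 2 - q * raise_v x w) * om * heta qj x w.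
  have wi : dot x.1 (rmulq w.1 qi) = - heta qi x w by rewrite dot_i.
  have ww : dot (rmulq w.1 qi) (rmulq w.1 qi) = dot w.1 w.1 by rewrite !dotq.
  have e1 : heta qi x (rmulq w.1 qi, 0) = 0.
    by rewrite /heta /= !dotq Tw.1.
  have e2 : heta qj x (rmulq w.1 qi, 0) = heta qk x w by rewrite /heta /= !dotq.
  have e3 : heta qk x (rmulq w.1 qi, 0) = - heta qj x w by rewrite /heta /= !dotq.
  have := raise_dot1 w (rmulq w.1 qi, 0); rewrite e1 e2 e3 /= wi ww dotC => ->.
  by move: (raise_v _ _) (b3 _ _) (b2 _ _) (s1 _ _); gen_dot; gen_eta => *; ring.
rewrite dS /fam_lie /hopf_lie (raise_eta_j Tw) (raise_eta_k Tw) raise_sig_i.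
have sj : hsig qj x (raise x w) = p * D * s3 x w / 2 * (D / 2).
  rewrite {1}/hsig /raise /= !dotDr !dotNr !dotZr !(frame_dots x2).
  by move: (raise_v _ _) (s2 _ _) (s3 _ _) => *; ring.
have sk : hsig qk x (raise x w) = - (p * D * s2 x w / 2 * (D / 2)).
  rewrite {1}/hsig /raise /= !dotDr !dotNr !dotZr !(frame_dots x2).
  by move: (raise_v _ _) (s2 _ _) (s3 _ _) => *; ring.
rewrite sj sk /raise_v /hor_sq /b2 /b3 /s1 /s2 /s3 /fam_l2 /fam_e2 /fam_pp /fam_qq.
gen_dot; gen_eta; field.
by rewrite A0 D0 om0 h0.
Qed.

End AtPoint.
End FamilyForms.

(** * Charts of the spheres *)

Section OrthogonalComplement.
Context {R : realType} {m : nat}.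
Local Notation E := ('M[R]_(m, 4) * 'rV[R]_4)%type.
Implicit Types (x v w z : E).

Definition dotE v w : R := dot v.1 w.1 + dot v.2 w.2.

Definition vecE v : 'rV[R]_(m * 4 + 1 * 4) := row_mx (mxvec v.1) (mxvec v.2).
Definition unvecE (u : 'rV[R]_(m * 4 + 1 * 4)) : E :=
  (vec_mx (lsubmx u), vec_mx (rsubmx u)).

Lemma vecEK : cancel vecE unvecE.
Proof. by move=> [v w]; rewrite /unvecE row_mxKl row_mxKr !mxvecK. Qed.

Lemma unvecEK : cancel unvecE vecE.
Proof. by move=> u; rewrite /vecE /unvecE !vec_mxK hsubmxK. Qed.

Lemma dot_mxvec k (y z : 'M[R]_(k, 4)) : dot y z = (mxvec y *m (mxvec z)^T) 0 0.
Proof.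
rewrite mxE /dot pair_big /= [RHS](reindex _ (curry_mxvec_bij k 4)) /=.
by apply: eq_bigr => -[i j] _; rewrite !mxE !mxvecE.
Qed.

Lemma dotE_vec v w : dotE v w = (vecE v *m (vecE w)^T) 0 0.
Proof. by rewrite /vecE tr_row_mx mul_row_col mxE -!dot_mxvec. Qed.

Lemma cl_vecE : cont_linear vecE.
Proof.
have c1 : cont_linear (fun y : 'M[R]_(m, 4) => row_mx (mxvec y) (0 : 'rV[R]_(1 * 4))).
  apply: cl_mx => [y z|a y]; first by rewrite linearD add_row_mx addr0.
  by rewrite linearZ scale_row_mx scaler0.
have c2 : cont_linear (fun y : 'rV[R]_4 => row_mx (0 : 'rV[R]_(m * 4)) (mxvec y)).
  apply: cl_mx => [y z|a y]; first by rewrite linearD add_row_mx addr0.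
  by rewrite linearZ scale_row_mx scaler0.
have -> : vecE = fun v => row_mx (mxvec v.1) 0 + row_mx 0 (mxvec v.2).
  by apply/funext => v; rewrite add_row_mx addr0 add0r.
exact: cl_add (cl_comp c1 (cl_fst _ _)) (cl_comp c2 (cl_snd _ _)).
Qed.

Lemma cl_unvecE : cont_linear unvecE.
Proof.
have -> : unvecE = fun u => (vec_mx (lsubmx u), 0) + (0, vec_mx (rsubmx u)).
  by apply/funext => u; congr pair; rewrite ?addr0 ?add0r.
apply: cl_add.
  by apply: (cl_comp (cl_inl _ _)); apply: cl_mx => *; rewrite !linearD || rewrite !linearZ.
by apply: (cl_comp (cl_inr _ _)); apply: cl_mx => *; rewrite !linearD || rewrite !linearZ.
Qed.

Lemma cl_mulmxr a b k (M : 'M[R]_(a, b)) : cont_linear (fun u : 'M[R]_(k, a) => u *m M).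
Proof. by apply: cl_mx => *; rewrite ?mulmxDl -?scalemxAl. Qed.

(** The complement is the kernel of the matrix of normals, whose rank is known because
    orthonormality makes its Gram matrix the identity. *)
Lemma ortho_coordinates (cs : seq E) n : (n + size cs = m * 4 + 4)%N ->
  (forall i j, (i < size cs)%N -> (j < size cs)%N ->
     dotE (nth 0 cs i) (nth 0 cs j) = (i == j)%:R) ->
  exists (L : 'rV[R]_n -> E) (P : E -> 'rV[R]_n),
    [/\ cont_linear L, cont_linear P, cancel L P,
        forall a c, c \in cs -> dotE (L a) c = 0
      & forall v, (forall c, c \in cs -> dotE v c = 0) -> L (P v) = v].
Proof.
move=> dimE ortho; set r := size cs in dimE ortho.
pose Cm : 'M[R]_(r, m * 4 + 1 * 4) := \matrix_(i < r) vecE (nth 0 cs i).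
have CC : Cm *m Cm^T = 1%:M.
  apply/matrixP => i j; transitivity (dotE (nth 0 cs i) (nth 0 cs j)).
    by rewrite dotE_vec [LHS]mxE [RHS]mxE; apply: eq_bigr => k _; rewrite !mxE.
  by rewrite ortho// mxE.
have rC : \rank Cm^T = r.
  rewrite mxrank_tr; apply/eqP; rewrite eqn_leq rank_leq_row /=.
  by rewrite -[X in (X <= _)%N](mxrank1 R) -CC mxrankM_maxl.
pose Km := kermx Cm^T.
have nE : n = \rank Km.
  by rewrite mxrank_ker rC (_ : (m * 4 + 1 * 4 = m * 4 + 4)%N)// -dimE addnK.
(* With [n] replaced by the rank itself, [row_base] has the right number of rows. *)
clear dimE; subst n.
have in_ker v : (forall c, c \in cs -> dotE v c = 0) <-> (vecE v <= Km)%MS.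
  split=> [v0|/sub_kermxP vK c ccs].
    apply/sub_kermxP/rowP => i; rewrite [RHS]mxE.
    apply: etrans (v0 (nth 0 cs i) (mem_nth _ (ltn_ord i))).
    by rewrite dotE_vec [LHS]mxE [RHS]mxE; apply: eq_bigr => k _; rewrite !mxE.
  have ic : (index c cs < r)%N by rewrite index_mem.
  have := congr1 (fun M : 'rV[R]_r => M 0 (Ordinal ic)) vK; rewrite [RHS]mxE.
  apply: etrans; rewrite dotE_vec [LHS]mxE [RHS]mxE.
  by apply: eq_bigr => k _; rewrite !mxE /= nth_index.
pose L (a : 'rV[R]_(\rank Km)) := unvecE (a *m row_base Km).
pose P v : 'rV[R]_(\rank Km) := vecE v *m pinvmx (row_base Km).
exists L, P; split.
- exact: cl_comp cl_unvecE (cl_mulmxr _ _).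
- exact: cl_comp (cl_mulmxr _ _) cl_vecE.
- by move=> a; rewrite /P /L unvecEK -mulmxA mulmxVp ?row_base_free// mulmx1.
- move=> a; apply/in_ker; rewrite /L unvecEK.
  by apply: submx_trans (submxMl _ _) _; rewrite eq_row_base.
- move=> v /in_ker vK; rewrite /L /P mulmxKpV ?vecEK//.
  by rewrite eq_row_base.
Qed.

End OrthogonalComplement.

(** Immersion criterion for radial projections: where the derivative of [f] vanishes, so does that
    of its coefficient [dot (f u) c], and only [l a] is left. The normalising square root is never
    differentiated explicitly. *)
Lemma cone_derive (R : realType) (W : normedModType R) k (f : W -> 'M[R]_(k, 4)) (c : 'M[R]_(k, 4))
    (l : W -> 'M[R]_(k, 4)) (u a : W) : cont_linear l -> derivable f u a ->
  'D_a f u = 0 -> (forall u, f u = dot (f u) c *: (c + l u)) -> dot (f u) c != 0 ->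
  l a = 0.
Proof.
move=> cl df f0 fE fc.
have [dd ed] := is_derive_bilin (cb_dot k) df (derivable_cst c u a).
have dl : is_derive u a (fun u => c + l u) (l a).
  have dlin : derivable l u a.
    by exact: CkS_derivable (Ck_linear setT 1 cl) _.
  have [d1 e1] := is_derive_add (is_derive_cst c u a) (derivableP dlin).
  have El : 'D_a l u = l a.
    have did : derivable (@id W) u a by exact: derivable_id.
    by have [_] := is_derive_lin cl did; rewrite derive_id.
  by split=> //; rewrite e1 add0r El.
have [d2 e2] := is_derive_bilin (cb_scale 'M[R]_(k, 4)) dd (@ex_derive _ _ _ _ _ _ _ dl).
have FE : f = fun u => dot (f u) c *: (c + l u) by apply/funext.
have E0 := etrans (congr1 (fun h => 'D_a h u) (esym FE)) f0.
have ed0 : 'D_a (fun u => dot (f u) (cst c u)) u = 0.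
  by rewrite ed f0 derive_cst dot0l dot0r addr0.
have [_ edl] := dl; move: (etrans (esym e2) E0); rewrite ed0 edl scale0r add0r => /eqP.
by rewrite scaler_eq0 (negPf fc) => /eqP.
Qed.

Section SphereModel.
Context {R : realType} {m : nat}.
Local Notation E := ('M[R]_(m, 4) * 'rV[R]_4)%type.
Implicit Types (x v w z : E) (b : bool).

(* [b] tells S^3 ([true]) from the circle S^1_i ([false]), cut out of S^3 by
   orthogonality to j and k. *)
Definition lcs b : seq 'rV[R]_4 := if b then [::] else [:: qj; qk].
Definition model b : set E := if b then sphere_S3 (R := R) (m := m) else sphere_S1i (R := R) (m := m).
Definition tan_space b x : set E :=
  [set v | tangent x v /\ forall c, c \in lcs b -> dot v.2 c = 0].
Definition normals b x : seq E := [:: (x.1, 0); (0, x.2)] ++ [seq (0, c) | c <- lcs b].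

Lemma dot_qj (y : 'rV[R]_4) : dot y qj = y 0 o2.
Proof.
by rewrite /dot big_ord1 sum_ord4 !qjE /=; ring.
Qed.

Lemma dot_qk (y : 'rV[R]_4) : dot y qk = y 0 o3.
Proof.
by rewrite /dot big_ord1 sum_ord4 !qkE /=; ring.
Qed.

Lemma modelP b x : model b x <-> [/\ dot x.1 x.1 = 1, dot x.2 x.2 = 1
  & forall c, c \in lcs b -> dot x.2 c = 0].
Proof.
case: b => /=; rewrite /sphere_S1i /sphere_S3 /=.
  by split=> [[x1 x2]|[x1 x2 _]].
split=> [[[x1 x2] xj xk]|[x1 x2 xc]].
  by split=> // c; rewrite !inE => /orP[] /eqP ->; rewrite ?dot_qj ?dot_qk.
by split=> //; rewrite -?dot_qj -?dot_qk; apply: xc; rewrite !inE eqxx ?orbT.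
Qed.

Lemma tan_spaceP b x v : tan_space b x v <-> forall c, c \in normals b x -> dotE v c = 0.
Proof.
rewrite /tan_space /normals /tangent /dotE; split=> [[[v1 v2] vc] c|vc].
  rewrite mem_cat !inE => /orP[/orP[/eqP ->|/eqP ->]|/mapP[d dl ->]] /=.
  - by rewrite dot0r addr0 dotC.
  - by rewrite dot0r add0r dotC.
  - by rewrite dot0r add0r vc.
split; first split.
- have := vc (x.1, 0); rewrite /= dot0r addr0 dotC; apply.
  by rewrite inE eqxx.
- have := vc (0, x.2); rewrite /= dot0r add0r dotC; apply.
  by rewrite !inE eqxx orbT.
- move=> c cl; have := vc (0, c); rewrite /= dot0r add0r; apply.
  by rewrite !inE (map_f (fun c => (0, c)) cl) !orbT.
Qed.

Lemma dot_jj : dot (qj : 'rV[R]_4) qj = 1.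
Proof. by rewrite dot_qj qjE. Qed.
Lemma dot_kk : dot (qk : 'rV[R]_4) qk = 1.
Proof. by rewrite dot_qk qkE. Qed.
Lemma dot_jk : dot (qj : 'rV[R]_4) qk = 0.
Proof. by rewrite dot_qk qjE. Qed.

Lemma normals_ortho b x : model b x ->
  forall i j, (i < size (normals b x))%N -> (j < size (normals b x))%N ->
  dotE (nth 0 (normals b x) i) (nth 0 (normals b x) j) = (i == j)%:R.
Proof.
move=> /modelP[x1 x2 xc] i j; rewrite /dotE.
case: b xc => /= xc.
  by case: i => [|[|i]]; case: j => [|[|j]] //=; rewrite ?dot0l ?dot0r ?addr0 ?add0r.
have xj : dot x.2 qj = 0 by apply: xc; rewrite inE eqxx.
have xk : dot x.2 qk = 0 by apply: xc; rewrite !inE eqxx orbT.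
case: i => [|[|[|[|i]]]]; case: j => [|[|[|[|j]]]] //=;
  rewrite ?dot0l ?dot0r ?addr0 ?add0r ?x1 ?x2 ?xj ?xk ?dot_jj ?dot_kk ?dot_jk //.
- by rewrite dotC.
- by rewrite dotC.
- by rewrite dotC dot_jk.
Qed.

Lemma hopf_normals_ortho b x : model b x -> let cs := (rmulq x.1 qi, 0) :: normals b x in
  forall i j, (i < size cs)%N -> (j < size cs)%N ->
  dotE (nth 0 cs i) (nth 0 cs j) = (i == j)%:R.
Proof.
move=> Mx cs [|i] [|j] /=; have /modelP[x1 x2 xc] := Mx.
- by rewrite /dotE /= dot0l addr0 (frame_dots x1).
- move=> _ jl; rewrite /dotE /=; case: j jl => [|[|j]] /=.
  + by rewrite dot0l addr0 dot_xi.
  + by rewrite dot0l dot0r addr0.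
  + rewrite ltnS ltnS size_map => jl; rewrite (nth_map 0)//= dot0l dot0r addr0//.
- move=> il _; rewrite /dotE /=; case: i il => [|[|i]] /=.
  + by rewrite dot0r addr0 dotC dot_xi.
  + by rewrite dot0l dot0r addr0.
  + by rewrite ltnS ltnS size_map => jl; rewrite (nth_map 0)//= dot0l dot0r addr0.
- by move=> il jl; rewrite normals_ortho// eqSS.
Qed.

Definition normalize z : E :=
  ((Num.sqrt (dot z.1 z.1))^-1 *: z.1, (Num.sqrt (dot z.2 z.2))^-1 *: z.2).

Section Gnomonic.
Variables (b : bool) (x0 : E) (n : nat) (L : 'rV[R]_n -> E).
Hypotheses (Mx0 : model b x0) (cL : cont_linear L).
Hypothesis L_tan : forall a, tan_space b x0 (L a).
Implicit Types (u a : 'rV[R]_n).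

(** Central projection of the tangent plane to each factor. Its inverse is rational, and it respects
    the circle because that is cut out by linear equations. *)
Definition gnomonic u : E := normalize (x0 + L u).
Local Notation gn := gnomonic.

Lemma gn_dot u : dot (x0 + L u).1 x0.1 = 1 /\ dot (x0 + L u).2 x0.2 = 1.
Proof.
have /modelP[x1 x2 _] := Mx0; have [[l1 l2] _] := L_tan u.
by rewrite /= !dotDl x1 x2 [dot (L u).1 _]dotC [dot (L u).2 _]dotC l1 l2 !addr0.
Qed.

Lemma gn_norm_gt0 u : 0 < dot (x0 + L u).1 (x0 + L u).1 /\
  0 < dot (x0 + L u).2 (x0 + L u).2.
Proof.
have /modelP[x1 x2 _] := Mx0; have [[l1 l2] _] := L_tan u.
have P k (y z : 'M[R]_(k, 4)) : dot y y = 1 -> dot y z = 0 -> 0 < dot (y + z) (y + z).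
  move=> y1 yz; rewrite dotDl !dotDr y1 yz dotC yz addr0 add0r.
  by rewrite ltr_pwDl ?ltr01 ?dot_ge0.
by split; exact: P.
Qed.

Lemma gn_model u : model b (gn u).
Proof.
have /modelP[x1 x2 xc] := Mx0; have [_ lc] := L_tan u.
have [n1 n2] := gn_norm_gt0 u; apply/modelP.
have N (k : nat) (y : 'M[R]_(k, 4)) : 0 < dot y y ->
    dot ((Num.sqrt (dot y y))^-1 *: y) ((Num.sqrt (dot y y))^-1 *: y) = 1.
  move=> y0; rewrite dotZl dotZr mulrA -expr2 exprVn sqr_sqrtr ?ltW// mulVf//.
  by rewrite gt_eqF.
split; [exact: N|exact: N|].
move=> c cl; rewrite [dot _ _]dotZl; move: (Num.sqrt _)^-1 => k.
by rewrite dotDl (xc _ cl) (lc _ cl) addr0 mulr0.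
Qed.

Lemma gn_Ck k : Ck k setT gn.
Proof.
have zC : Ck k setT (fun u => x0 + L u).
  by apply: (CkD openT); [exact: Ck_cst|exact: Ck_linear].
have z1C := Ck_lin openT (cl_fst _ _) zC; have z2C := Ck_lin openT (cl_snd _ _) zC.
apply: (Ck_pair openT); apply: (CkZ openT) => //; apply: (Ck_rsqrt openT).
- by move=> u _; have [] := gn_norm_gt0 u.
- exact: (Ck_bilin openT (cb_dot m)).
- by move=> u _; have [] := gn_norm_gt0 u.
- exact: (Ck_bilin openT (cb_dot 1)).
Qed.

Lemma gn_cone u : (0 < dot (gn u).1 x0.1 /\ (gn u).1 = dot (gn u).1 x0.1 *: (x0 + L u).1) /\
  (0 < dot (gn u).2 x0.2 /\ (gn u).2 = dot (gn u).2 x0.2 *: (x0 + L u).2).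
Proof.
have [n1 n2] := gn_norm_gt0 u; have [d1 d2] := gn_dot u.
have N (k : nat) (z c : 'M[R]_(k, 4)) : 0 < dot z z -> dot z c = 1 ->
    let g := (Num.sqrt (dot z z))^-1 *: z in 0 < dot g c /\ g = dot g c *: z.
  by move=> z0 zc g; rewrite /g dotZl zc mulr1; split; rewrite // invr_gt0 sqrtr_gt0.
by split; exact: N.
Qed.

Lemma gn_immersion u a : 'D_a gn u = 0 -> L a = 0.
Proof.
move=> g0; have dg : derivable gn u a by apply: CkS_derivable (gn_Ck 1) _.
have [d1 e1] := is_derive_lin (cl_fst _ _) dg.
have [d2 e2] := is_derive_lin (cl_snd _ _) dg.
have L1 : (L a).1 = 0.
  apply: (cone_derive (f := fun u => (gn u).1) (c := x0.1) (u := u)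
    (l := fun u => (L u).1)) => //.
  - exact: cl_comp (cl_fst _ _) cL.
  - by rewrite e1 g0.
  - by move=> y; have [[_ {1}->] _] := gn_cone y.
  - by have [[+ _] _] := gn_cone u; move=> /lt0r_neq0.
have L2 : (L a).2 = 0.
  apply: (cone_derive (f := fun u => (gn u).2) (c := x0.2) (u := u)
    (l := fun u => (L u).2)) => //.
  - exact: cl_comp (cl_snd _ _) cL.
  - by rewrite e2 g0.
  - by move=> y; have [_ [_ {1}->]] := gn_cone y.
  - by have [_ [+ _]] := gn_cone u; move=> /lt0r_neq0.
by rewrite [L a]surjective_pairing L1 L2.
Qed.

End Gnomonic.

End SphereModel.

Section LinearSurjectivity.
Context {R : realType} {V : normedModType R}.

(** The dimensions agree: read through [P], the derivative is a square matrix with trivial kernel.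
    This gives the tangent spaces in arbitrary charts. *)
Lemma injective_derive_surjective n (D : set 'rV[R]_n) (phi : 'rV[R]_n -> V) u
    (L : 'rV[R]_n -> V) (P : V -> 'rV[R]_n) : coord_separated V ->
  open D -> Ck 1 D phi -> D u -> cont_linear P ->
  (forall a, 'D_a phi u = 0 -> a = 0) -> (forall a, L (P ('D_a phi u)) = 'D_a phi u) ->
  cont_linear L -> cancel L P ->
  forall b, exists a, 'D_a phi u = L b.
Proof.
move=> sV oD phiC Du cP imm LP cL LK b.
pose A : 'M[R]_n := \matrix_i P ('D_(delta_mx 0 i) phi u).
have AE a : P ('D_a phi u) = a *m A.
  rewrite (derive_dirE a sV oD Du phiC) (cl_sum cP) mulmx_sum_row.
  by apply: eq_bigr => i _; rewrite (clZ cP) rowK.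
have Au : A \in unitmx.
  rewrite -row_free_unit -kermx_eq0; apply/rowV0P => a /sub_kermxP aA.
  apply: imm; rewrite -LP AE aA; exact: cl0.
exists (b *m invmx A); rewrite -LP AE -mulmxA mulVmx// mulmx1//.
Qed.

End LinearSurjectivity.

Section SphereCharts.
Context {R : realType} {m : nat}.
Local Notation E := ('M[R]_(m, 4) * 'rV[R]_4)%type.
Implicit Types (x v w z : E) (b : bool).

Lemma separated_E : coord_separated (E : normedModType R).
Proof. exact: separated_pair (separated_mx _ _) (separated_mx _ _). Qed.

Definition model_dim b : nat := if b then (4 * m + 2)%N else (4 * m)%N.

Lemma size_normals b x : (model_dim b + size (normals b x) = m * 4 + 4)%N.
Proof.
by case: b; rewrite /model_dim /= [(m * 4)%N]mulnC -?addnA.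
Qed.

Lemma tan_coordinates b x : model b x ->
  exists (L : 'rV[R]_(model_dim b) -> E) (P : E -> 'rV[R]_(model_dim b)),
    [/\ cont_linear L, cont_linear P, cancel L P,
        forall a, tan_space b x (L a) & forall v, tan_space b x v -> L (P v) = v].
Proof.
move=> Mx; have [L [P [cL cP LK Lc LP]]] :=
  ortho_coordinates (size_normals b x) (normals_ortho Mx).
exists L, P; split=> // [a|v /tan_spaceP]; last exact: LP.
by apply/tan_spaceP => c; exact: Lc.
Qed.

(** Inverse of the gnomonic chart. Scaling a factor of [y] leaves it unchanged, which later admits
    unnormalised representatives. *)
Definition cone_coord x y : E :=
  ((dot y.1 x.1)^-1 *: y.1 - x.1, (dot y.2 x.2)^-1 *: y.2 - x.2).
Definition cone_dom x : set E := [set y | 0 < dot y.1 x.1 /\ 0 < dot y.2 x.2].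

Lemma cone_dom_open x : open (cone_dom x).
Proof.
have cO (f : E -> R) : continuous f -> open [set y | 0 < f y].
  by move=> cf; apply: (@open_comp _ _ f [set t | 0 < t]) => [y _|]; [exact: cf|exact: open_gt].
apply: openI; apply: cO.
  exact: cl_cont (cl_comp (cb_linl x.1 (cb_dot m)) (cl_fst _ _)).
exact: cl_cont (cl_comp (cb_linl x.2 (cb_dot 1)) (cl_snd _ _)).
Qed.

Lemma cone_coord_Ck k x : Ck k (cone_dom x) (cone_coord x).
Proof.
have oD : open (cone_dom x) by exact: cone_dom_open.
have c1 := Ck_linear (cone_dom x) k (cl_fst 'M[R]_(m, 4) 'rV[R]_4).
have c2 := Ck_linear (cone_dom x) k (cl_snd 'M[R]_(m, 4) 'rV[R]_4).
apply: (Ck_pair oD); apply: (CkB oD); try exact: Ck_cst; apply: (CkZ oD) => //;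
  apply: (CkV oD).
- by move=> y [y1 _]; rewrite gt_eqF.
- exact: (Ck_lin oD (cb_linl x.1 (cb_dot m))).
- by move=> y [_ y2]; rewrite gt_eqF.
- exact: (Ck_lin oD (cb_linl x.2 (cb_dot 1))).
Qed.

Lemma cone_preimage_open x (Z : normedModType R) (P : E -> Z) (O' : set Z) :
  cont_linear P -> open O' -> open (cone_dom x `&` (fun y => P (cone_coord x y)) @^-1` O').
Proof.
move=> cP oO; rewrite openE => y [Dy Oy]; apply: filterI.
  exact: (open_nbhs_nbhs (conj (@cone_dom_open x) Dy)).
have c1 := Ck_cont (Ck_lin (@cone_dom_open x) cP (@cone_coord_Ck 0 x)) Dy.
by apply: c1; exact: (open_nbhs_nbhs (conj oO Oy)).
Qed.

Lemma cone_coord_gn b x n (L : 'rV[R]_n -> E) : model b x -> cont_linear L ->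
  (forall a, tan_space b x (L a)) -> forall u,
  cone_dom x (gnomonic x L u) /\ cone_coord x (gnomonic x L u) = L u.
Proof.
move=> Mx cL Lt u; have [[p1 e1] [p2 e2]] := gn_cone Mx Lt u.
split; first by [].
rewrite /cone_coord {2}e1 {2}e2 !scalerA !mulVf ?gt_eqF// !scale1r.
rewrite [(x + _).1]/= [(x + _).2]/= ![_ + _ - _]addrAC !subrr !add0r.
by rewrite -surjective_pairing.
Qed.

Lemma gn_cone_coord b x y n (L : 'rV[R]_n -> E) (u : 'rV[R]_n) : model b y ->
  cone_dom x y -> L u = cone_coord x y -> gnomonic x L u = y.
Proof.
move=> /modelP[y1 y2 _] [p1 p2] Lu; rewrite /gnomonic /normalize Lu.
have Q k (a c : 'M[R]_(k, 4)) : dot a a = 1 -> 0 < dot a c ->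
    let z := c + ((dot a c)^-1 *: a - c) in (Num.sqrt (dot z z))^-1 *: z = a.
  move=> a1 ac z; have -> : z = (dot a c)^-1 *: a by rewrite /z addrC subrK.
  rewrite dotZl dotZr a1 mulr1 -expr2 sqrtr_sqr ger0_norm ?invr_ge0 ?ltW//.
  by rewrite scalerA invrK divff ?scale1r ?gt_eqF.
by rewrite [RHS]surjective_pairing; congr pair; exact: Q.
Qed.

Lemma cone_coord_tan b x y : model b x -> model b y -> cone_dom x y ->
  tan_space b x (cone_coord x y).
Proof.
move=> /modelP[x1 x2 xc] /modelP[y1 y2 yc] [p1 p2].
have Q k (a c : 'M[R]_(k, 4)) : dot c c = 1 -> 0 < dot a c ->
    dot c ((dot a c)^-1 *: a - c) = 0.
  by move=> c1 ac; rewrite dotDr dotNr dotZr [dot c a]dotC mulVf ?gt_eqF// c1 subrr.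
split; first by split; exact: Q.
by move=> c cl; rewrite dotDl dotNl dotZl (yc _ cl) (xc _ cl) mulr0 subrr.
Qed.

Lemma gn_param b x (L : 'rV[R]_(model_dim b) -> E) (P : E -> 'rV[R]_(model_dim b)) :
  model b x -> cont_linear L -> cont_linear P -> cancel L P ->
  (forall a, tan_space b x (L a)) -> (forall v, tan_space b x v -> L (P v) = v) ->
  parametrization (model b) setT (gnomonic x L).
Proof.
move=> Mx cL cP LK Lt LP; have ccg := cone_coord_gn Mx cL Lt.
split.
- exact: openT.
- by move=> k; exact: (gn_Ck Mx cL Lt).
- move=> u a _ /(gn_immersion Mx cL Lt) La; apply: (can_inj LK); rewrite La.
  by rewrite (cl0 cL).
- move=> u v _ _ uv; apply: (can_inj LK).
  by have [_ <-] := ccg u; have [_ <-] := ccg v; rewrite uv.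
- move=> U oU _; exists (cone_dom x `&` (fun y => P (cone_coord x y)) @^-1` U).
    exact: cone_preimage_open.
  apply/seteqP; split=> [_ [u Uu <-]|y [My [Dy Uy]]].
    have [Du cu] := ccg u; split; first exact: (gn_model Mx Lt).
    by split=> //=; rewrite cu LK.
  exists (P (cone_coord x y)); first by [].
  apply: (gn_cone_coord My Dy).
  by rewrite LP//; exact: cone_coord_tan.
Qed.

Lemma gn0 b x n (L : 'rV[R]_n -> E) : model b x -> cont_linear L -> gnomonic x L 0 = x.
Proof.
move=> /modelP[x1 x2 _] cL; rewrite /gnomonic /normalize (cl0 cL) addr0 x1 x2 sqrtr1 invr1.
by rewrite !scale1r -surjective_pairing.
Qed.

Lemma model_submanifold b : submanifold (model_dim b) (model b : set E).
Proof.
move=> x Mx; have [L [P [cL cP LK Lt LP]]] := tan_coordinates Mx.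
exists setT, (gnomonic x L); split; first exact: (gn_param Mx cL cP LK Lt LP).
by exists 0 => //; exact: (gn0 Mx cL).
Qed.

Lemma param_tan b (D : set 'rV[R]_(model_dim b)) (phi : 'rV[R]_(model_dim b) -> E) :
  parametrization (model b) D phi ->
  forall u, D u -> forall a, tan_space b (phi u) ('D_a phi u).
Proof.
move=> pD u Du a; have [oD phiC _ _ _] := pD.
have M1 y : D y -> model b (phi y) by exact: chart_in.
have dphi : derivable phi u a := CkS_derivable (phiC 1) Du.
have [dd1 ed1] := is_derive_lin (cl_fst _ _) dphi.
have [dd2 ed2] := is_derive_lin (cl_snd _ _) dphi.
have Z (f : 'rV[R]_(model_dim b) -> R) (c : R) : (forall y, D y -> f y = c) -> 'D_a f u = 0.
  move=> fc; have := eq_derive a oD (g := (fun _ => c : R)) fc Du.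
  by rewrite derive_cst.
have Q k (f : 'rV[R]_(model_dim b) -> 'M[R]_(k, 4)) : derivable f u a ->
    (forall y, D y -> dot (f y) (f y) = 1) -> dot (f u) ('D_a f u) = 0.
  move=> df f1; have [_] := is_derive_bilin (cb_dot k) df df.
  rewrite (Z _ _ f1) [dot ('D_a f u) _]dotC.
  by generalize (dot (f u) ('D_a f u)) => t; lra.
split; first split.
- have := Q m (fun y => (phi y).1) dd1; rewrite ed1; apply.
  by move=> y /M1 /modelP[].
- have := Q 1%N (fun y => (phi y).2) dd2; rewrite ed2; apply.
  by move=> y /M1 /modelP[].
- move=> c cl; have [_] := is_derive_lin (cb_linl c (cb_dot 1)) dd2.
  rewrite ed2 => <-; apply: (Z _ 0) => y /M1 /modelP[_ _]; exact.
Qed.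

Lemma tan_chart b (D : set 'rV[R]_(model_dim b)) (phi : 'rV[R]_(model_dim b) -> E) :
  parametrization (model b) D phi ->
  forall u, D u -> forall v, tan_space b (phi u) v <-> exists a, 'D_a phi u = v.
Proof.
move=> pD u Du v; split=> [Tv|[a <-]]; last exact: (param_tan pD Du a).
have [oD phiC imm _ _] := pD.
have [L [P [cL cP LK Lt LP]]] := tan_coordinates (chart_in pD Du).
rewrite -(LP _ Tv).
apply: (injective_derive_surjective separated_E oD (phiC 1%N) Du cP) => //.
  by move=> a; exact: imm.
by move=> a; rewrite LP//; exact: (param_tan pD Du a).
Qed.

Lemma model_compact b : compact (model b : set E).
Proof.
pose A := [set u | model b (unvecE u)] : set 'rV[R]_(m * 4 + 1 * 4).
have -> : model b = unvecE @` A.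
  apply/seteqP; split=> [y My|_ [u Au <-]]; last exact: Au.
  by exists (vecE y); rewrite ?vecEK// /A /= vecEK.
apply: continuous_compact; first exact/continuous_subspaceT/(cl_cont cl_unvecE).
(* The two squared norms add up to 2, so every coordinate lies well within these bounds. *)
pose B := [set u | forall i, `[(-2 : R), 2]%classic ((u : 'rV[R]_(m * 4 + 1 * 4)) 0 i)].
apply: (@subclosed_compact _ A B).
- have c1 := cl_comp (cl_fst 'M[R]_(m, 4) 'rV[R]_4) cl_unvecE.
  have c2 := cl_comp (cl_snd 'M[R]_(m, 4) 'rV[R]_4) cl_unvecE.
  have cl1 k (f : 'rV[R]_(m * 4 + 1 * 4) -> 'M[R]_(k, 4)) :
      cont_linear f -> closed [set u | dot (f u) (f u) = 1].
    move=> cf; apply: (@preimage_closed _ _ (fun u => dot (f u) (f u)) [set t | t = 1]) => [u _|].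
      have fC := Ck_linear setT 0 cf.
      exact: (Ck_cont (Ck_bilin openT (cb_dot k) fC fC) (I : setT u)).
    exact: closed_eq.
  have -> : A = [set u | dot (unvecE u).1 (unvecE u).1 = 1] `&`
      ([set u | dot (unvecE u).2 (unvecE u).2 = 1] `&`
       \bigcap_(c in [set c | c \in lcs b]) [set u | dot (unvecE u).2 c = 0]).
    by apply/seteqP; split=> u /=; [move=> /modelP[? ? ?]|move=> [? [? ?]]; apply/modelP].
  apply: closedI; first exact: cl1.
  apply: closedI; first exact: cl1.
  apply: closed_bigI => c _.
  apply: (@preimage_closed _ _ (fun u => dot (unvecE u).2 c) [set t | t = 0]) => [u _|].
    exact: (cl_cont (cl_comp (cb_linl c (cb_dot 1)) (cl_comp (cl_snd _ _) cl_unvecE))).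
  exact: closed_eq.
- apply: (@rV_compact R _ (fun=> `[(-2 : R), 2]%classic)) => i; exact: segment_compact.
- move=> u Au i; have /modelP[y1 y2 _] := Au.
  have := dotE_vec (unvecE u) (unvecE u); rewrite unvecEK /dotE y1 y2 mxE => sE.
  have : u 0 i ^+ 2 <= 1 + 1.
    rewrite sE (bigD1 i)//= mxE expr2 lerDl sumr_ge0// => j _.
    by rewrite mxE -expr2 sqr_ge0.
  by rewrite /= in_itv /=; move: (u 0 i) => t; nra.
Qed.

End SphereCharts.

(** * The geodesic flow on both manifolds *)

Section FamilyFlow.
Context {R : realType} {m : nat}.
Local Notation E := ('M[R]_(m, 4) * 'rV[R]_4)%type.
Implicit Types (x v w z : E) (b : bool).
Variables (A D p q om : R).
Hypotheses (A0 : A != 0) (D0 : D != 0) (om0 : om != 0).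
Hypothesis h_gt0 : 0 < 1 - p ^+ 2 - q ^+ 2.
Local Notation K := (hopf_gen om).
Local Notation fam_form := (@fam_form R m A D p q om).

Lemma lcs_rmulq_i b x c : model b x -> c \in lcs b -> dot (rmulq x.2 qi) c = 0.
Proof.
move=> /modelP[_ _]; case: b => // xc; rewrite !inE => /orP[] /eqP ->.
  by rewrite dot_qj rmulqE -dot_qk xc// !inE eqxx orbT.
by rewrite dot_qk rmulqE -dot_qj xc ?oppr0// !inE eqxx.
Qed.

(** Over the circle [sigma_2] and [sigma_3] vanish, and the second component of [raise] reduces to
    the direction [x i]. Hence the formula found on the product with S^3 also solves the equation on
    the submanifold. *)
Lemma tan_raise b x w : model b x -> tan_space b x w -> tan_space b x (raise A D p q om x w).
Proof.
move=> Mx [Tw wc]; have /modelP[x1 x2 xc] := Mx.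
split; first exact: raise_tangent.
move=> c; case: b Mx wc xc => // Mx wc xc cl.
have x_j : x.2 0 o2 = 0 by rewrite -dot_qj xc// !inE eqxx.
have x_k : x.2 0 o3 = 0 by rewrite -dot_qk xc// !inE eqxx orbT.
have w_j : w.2 0 o2 = 0 by rewrite -dot_qj wc// !inE eqxx.
have w_k : w.2 0 o3 = 0 by rewrite -dot_qk wc// !inE eqxx orbT.
have s2E : hsig qj x w = 0.
  by rewrite /hsig /dot big_ord1 sum_ord4 !rmulqE x_j x_k w_j w_k; ring.
have s3E : hsig qk x w = 0.
  by rewrite /hsig /dot big_ord1 sum_ord4 !rmulqE x_j x_k w_j w_k; ring.
have r2 : (raise A D p q om x w).2 = (raise_v A p q om x w * (D / 2)) *: rmulq x.2 qi.
  by rewrite /raise /= /s2 /s3 s2E s3E !(mulr0, mul0r, scale0r) subr0 addr0.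
by rewrite r2 dotZl (lcs_rmulq_i Mx cl) mulr0.
Qed.

Definition hor_part x v : 'M[R]_(m, 4) :=
  v.1 - heta qi x v *: rmulq x.1 qi - heta qj x v *: rmulq x.1 qj - heta qk x v *: rmulq x.1 qk.

Lemma hor_sqE x v : dot x.1 x.1 = 1 -> hor_sq om x v = dot (hor_part x v) (hor_part x v) / om ^+ 2.
Proof.
move=> x1; rewrite /hor_sq; congr (_ / _).
rewrite /hor_part !dotDl !dotNl !dotZl !dotDr !dotNr !dotZr !(frame_dots x1).
rewrite -/(heta qi x v) -/(heta qj x v) -/(heta qk x v).
rewrite [dot v.1 (rmulq _ qi)]dotC [dot v.1 (rmulq _ qj)]dotC [dot v.1 (rmulq _ qk)]dotC.
rewrite -/(heta qi x v) -/(heta qj x v) -/(heta qk x v).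
by gen_dot; gen_eta; ring.
Qed.

Lemma hor_sq_ge0 x v : dot x.1 x.1 = 1 -> 0 <= hor_sq om x v.
Proof. by move=> x1; rewrite hor_sqE// divr_ge0 ?dot_ge0 ?sqr_ge0. Qed.

Lemma fam_pos x v : dot x.1 x.1 = 1 -> dot x.2 x.2 = 1 -> tangent x v -> v != 0 ->
  0 < fam_form x v v.
Proof.
move=> x1 x2 Tv; apply: contraNT; rewrite -leNgt (fam_normE p q A0 D0 om0 x2 Tv).
have H0 := hor_sq_ge0 v x1.
move=> F0.
have B1 : b1 om x v = 0 /\ b3 om x v = 0 /\ s1 D x v = 0 /\ b2 A x v = 0
    /\ s2 D x v = 0 /\ s3 D x v = 0 /\ hor_sq om x v = 0.
  move: F0 H0; move: (b1 _ _ _) (b2 _ _ _) (b3 _ _ _) (s1 _ _ _) (s2 _ _ _) (s3 _ _ _)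
    (hor_sq _ _ _) => x_1 x_2 x_3 y_1 y_2 y_3 h F0 H0.
  (* Completing squares in [b1 + p s1] and [b3 + q s1] leaves [s1 ^ 2] with a coefficient that
     [h_gt0] makes positive. *)
  have e : h + x_2 ^+ 2 + y_2 ^+ 2 + y_3 ^+ 2 + (x_1 + p * y_1) ^+ 2 + (x_3 + q * y_1) ^+ 2
    + (1 - p ^+ 2 - q ^+ 2) * y_1 ^+ 2 <= 0 by move: F0; congr (_ <= _); ring.
  have ? := sqr_ge0 x_2; have ? := sqr_ge0 y_2; have ? := sqr_ge0 y_3.
  have ? := sqr_ge0 (x_1 + p * y_1); have ? := sqr_ge0 (x_3 + q * y_1).
  have ? : 0 <= (1 - p ^+ 2 - q ^+ 2) * y_1 ^+ 2 by rewrite mulr_ge0 ?sqr_ge0 ?ltW.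
  have y1 : y_1 = 0.
    have /eqP : (1 - p ^+ 2 - q ^+ 2) * y_1 ^+ 2 = 0 by lra.
    by rewrite mulf_eq0 (gt_eqF h_gt0) orFb sqrf_eq0 => /eqP.
  have S (t : R) : t ^+ 2 = 0 -> t = 0 by move=> /eqP; rewrite sqrf_eq0 => /eqP.
  have X1 : x_1 + p * y_1 = 0 by apply: S; lra.
  have X3 : x_3 + q * y_1 = 0 by apply: S; lra.
  have X2 : x_2 = 0 by apply: S; lra.
  have Y2 : y_2 = 0 by apply: S; lra.
  have Y3 : y_3 = 0 by apply: S; lra.
  have h0 : h = 0 by lra.
  have X1' : x_1 = 0 by move: X1; rewrite y1 mulr0 addr0.
  have X3' : x_3 = 0 by move: X3; rewrite y1 mulr0 addr0.
  by [].
have [e1 [e3 [t1 [e2 [t2 [t3 h0]]]]]] := B1.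
have ei : heta qi x v = 0 by move/eqP: e1; rewrite mulf_eq0 invr_eq0 (negPf om0) orbF => /eqP.
have ek : heta qk x v = 0 by move/eqP: e3; rewrite mulf_eq0 invr_eq0 (negPf om0) orbF => /eqP.
have nz (k : R) : k != 0 -> 2 / k != 0.
  by move=> k0; rewrite mulf_neq0 ?invr_eq0 ?pnatr_eq0.
have ej : heta qj x v = 0 by move/eqP: e2; rewrite mulf_eq0 (negPf (nz _ A0)) => /eqP.
have ti : hsig qi x v = 0 by move/eqP: t1; rewrite mulf_eq0 (negPf (nz _ D0)) => /eqP.
have tj : hsig qj x v = 0 by move/eqP: t2; rewrite mulf_eq0 (negPf (nz _ D0)) => /eqP.
have tk : hsig qk x v = 0 by move/eqP: t3; rewrite mulf_eq0 (negPf (nz _ D0)) => /eqP.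
have v20 : v.2 = 0 by rewrite (sig_decomp x2 Tv) ti tj tk !scale0r !addr0.
have v10 : v.1 = 0.
  move: h0; rewrite hor_sqE// /hor_part ei ej ek !scale0r !subr0 => /eqP.
  by rewrite mulf_eq0 invr_eq0 sqrf_eq0 (negPf om0) orbF => /eqP /dot_eq0.
by rewrite [v]surjective_pairing v10 v20.
Qed.

Lemma fam_flow b : geodesic_flow (model_dim b (m := m)) (model b) (tan_space b) fam_form
  (@fam_lie R m A D q om) (@fam_dform R m A D p q om) (@fam_dlie R m A D q om) K.
Proof.
split.
- exact: separated_E.
- exact: hopf_smooth.
- exact: hopf_lie_smooth.
- exact: hopf_sym.
- exact: hopf_lie_sym.
- exact: hopf_gen_linear.
- by move=> x v w; exact: hopf_lieE.
- by move=> U phi; exact: tan_chart.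
- exact: model_submanifold.
- by move=> x v /modelP[x1 x2 _] [Tv _]; exact: fam_pos.
- move=> x /modelP[x1 x2 _]; split; first exact: gen_tangent.
  by move=> c _; rewrite /= dot0l.
- move=> x /modelP[x1 _ _]; apply: hopf_unit => //.
  by rewrite /fam_l2 mulVf// sqrf_eq0.
- by move=> x w /modelP[x1 _ _] [Tw _]; exact: hopf_closed.
Qed.

Lemma fam_raise b x w : model b x -> tan_space b x w -> tan_space b x (raise A D p q om x w) /\
  forall z, tan_space b x z -> 2 * fam_form x (raise A D p q om x w) z =
    fam_lie A D q om x w z
    + ext_form (g := fam_form) (dg := fam_dform (m := m) A D p q om) K x w z.
Proof.
move=> Mx Tw; split; first exact: tan_raise.
have /modelP[x1 x2 _] := Mx; move=> z [Tz _]; apply: raiseE => //.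
- by rewrite gt_eqF.
- exact: Tw.1.
Qed.

End FamilyFlow.

(** * Leaves and the Hopf fibration *)

Section Angles.
Context {R : realType}.
Implicit Types (t u a b : R).

Lemma cos_period (k : int) u : cos (u + k%:~R * (2 * pi)) = cos u.
Proof.
have P (n : nat) (v : R) : cos (v + n%:R * (2 * pi)) = cos v.
  by rewrite !mulr_natl; exact: (periodicn (@cosD2pi R) n v).
case: k => n; first exact: P.
by rewrite NegzE mulrNz mulNr -[LHS](P n.+1) subrK.
Qed.

Lemma sin_period (k : int) u : sin (u + k%:~R * (2 * pi)) = sin u.
Proof.
have P (n : nat) (v : R) : sin (v + n%:R * (2 * pi)) = sin v.
  by rewrite !mulr_natl; exact: (periodicn (@sinD2pi R) n v).
case: k => n; first exact: P.
by rewrite NegzE mulrNz mulNr -[LHS](P n.+1) subrK.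
Qed.

Lemma cos_eq1 u : cos u = 1 -> exists k : int, u = k%:~R * (2 * pi).
Proof.
move=> u1; have pi0 := pi_gt0 R; have pp : 0 < 2 * pi :> R by lra.
(* Reduce modulo the period to [v] in [[0, 2 pi)]; cosine is injective on [[0, pi]], and the other
   half is reflected by [2 pi - v]. *)
pose k := Num.floor (u / (2 * pi)); exists k.
have : u = u - k%:~R * (2 * pi) + k%:~R * (2 * pi) by rewrite subrK.
have := floor_le (u / (2 * pi)); have := floorD1_gt (u / (2 * pi)).
rewrite -/k ltr_pdivrMr// ler_pdivlMr// intrD1 mulrDl mul1r.
set v := u - _ => hi lo uE; have v1 : cos v = 1 by rewrite -u1 [in RHS]uE cos_period.
suff v0 : v = 0 by rewrite {1}uE v0 add0r.
have [v0 v2] : 0 <= v /\ v < 2 * pi by rewrite /v; split; lra.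
have [vpi|vpi] := leP v pi.
  apply: cos_inj; rewrite ?in_itv /= ?v0 ?vpi ?lexx ?pi_ge0// cos0//.
have : 2 * pi - v = 0.
  apply: cos_inj; rewrite ?in_itv /= ?lexx ?pi_ge0//; first by apply/andP; split; lra.
  by rewrite cos0 addrC -[2 * pi]mul1r (cos_period 1) cosN.
by lra.
Qed.

Lemma unit_angle a b : a ^+ 2 + b ^+ 2 = 1 -> exists t, cos t = a /\ sin t = b.
Proof.
move=> ab; have a1 : -1 <= a <= 1 by apply/andP; split; nra.
have ca : cos (acos a) = a by rewrite acosK// in_itv.
have sa : sin (acos a) = `|b|.
  by rewrite sin_acos// -sqrtr_sqr; congr Num.sqrt; rewrite -ab addrAC subrr add0r.
have [b0|b0] := leP 0 b; first by exists (acos a); rewrite sa ger0_norm.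
by exists (- acos a); rewrite cosN sinN sa ltr0_norm// opprK.
Qed.

End Angles.

Section HopfCircles.
Context {R : realType} {m : nat}.
Local Notation E := ('M[R]_(m, 4) * 'rV[R]_4)%type.
Local Notation W := ('M[R]_(m * 4) * 'rV[R]_4)%type.
Implicit Types (x v w z : E) (b : bool) (t : R).

Definition circ x t : E := (cos t *: x.1 + sin t *: rmulq x.1 qi, x.2).

Lemma circ_model b x t : model b x -> model b (circ x t).
Proof.
move=> /modelP[x1 x2 xc]; apply/modelP; split=> //=.
rewrite !dotDl !dotZl !dotDr !dotZr dot_xi [dot x.1 (rmulq x.1 qi)]dotC dot_xi.
by rewrite (frame_dots x1) x1 !(mulr0, mulr1, addr0, add0r) -!expr2 cos2Dsin2.
Qed.

Lemma circ_i x t : rmulq (circ x t).1 qi = cos t *: rmulq x.1 qi - sin t *: x.1.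
Proof. by rewrite /= row_qmulD !rmulqZ rmulq_ii scalerN. Qed.

Lemma circ_inj b x s t : model b x ->
  circ x s = circ x t <-> exists k : int, s - t = k%:~R * (2 * pi).
Proof.
move=> /modelP[x1 _ _]; split=> [|[k /eqP]]; last first.
  by rewrite subr_eq addrC => /eqP ->; rewrite /circ cos_period sin_period.
move=> /(congr1 fst) /= e; apply: cos_eq1; rewrite cosB.
have := congr1 (dot x.1) e; have := congr1 (dot (rmulq x.1 qi)) e.
rewrite !dotDr !dotZr !(frame_dots x1) [dot x.1 (rmulq _ _)]dotC !dot_xi x1.
rewrite !mulr0 !mulr1 !addr0 !add0r => -> ->.
by rewrite -!expr2 cos2Dsin2.
Qed.

Lemma circ_Ck (U : normedModType R) k (D : set U) (y : U -> E) (f : U -> R) : open D ->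
  Ck k D y -> Ck k D f -> Ck k D (fun u => circ (y u) (f u)).
Proof.
move=> oD yC fC; have [cC sC] := Ck_cos_sin oD fC.
have y1 := Ck_lin oD (cl_fst _ _) yC; have y2 := Ck_lin oD (cl_snd _ _) yC.
apply: (Ck_pair oD) => //; apply: (CkD oD); apply: (CkZ oD) => //.
exact: (Ck_lin oD (cl_rmulq m qi)).
Qed.

Lemma circ_derive x (k t : R) :
  is_derive t (1 : R) (fun s => circ x (k * s)) (k *: hopf_gen 1 (circ x (k * t))).
Proof.
have dk : is_derive t (1 : R) (fun s => k * s) k.
  have [dd e] := is_derive_lin (cl_scale (R : normedModType R) k) (@derivable_id _ R t 1).
  by split; [exact: dd|rewrite e derive_id scaler_R mulr1].
have [dkd dke] := dk.
have [dc ec] := is_derive_comp_scalar dkd (is_derive_cos (k * t)).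
have [ds es] := is_derive_comp_scalar dkd (is_derive_sin (k * t)).
have d1 := is_derive_lin (cb_linl x.1 (cb_scale _)) dc.
have d2 := is_derive_lin (cb_linl (rmulq x.1 qi) (cb_scale _)) ds.
have [d3 e3] := is_derive_add d1 d2.
have [d4 e4] := is_derive_lin (cl_inl 'M[R]_(m, 4) 'rV[R]_4) d3.
have [d5 e5] := is_derive_add (DeriveDef d4 e4) (is_derive_cst ((0, x.2) : E) t (1 : R)).
have E5 : (fun s => circ x (k * s)) = fun s => ((cos (k * s) *: x.1 + sin (k * s) *: rmulq x.1 qi, 0) : E) + (0, x.2).
  by apply/funext => s; rewrite /circ; congr pair; rewrite /= ?addr0 ?add0r.
rewrite E5; split; first exact: d5.
rewrite e5 addr0 e3 ec es dke /hopf_gen scale1r circ_i.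
congr pair; rewrite /= ?scaler0// scalerBr !scalerA addrC.
by congr (_ + _); rewrite ?scaleNr mulrC ?mulrN ?scaleNr.
Qed.

End HopfCircles.

(** * The Hopf map and its fibres *)

Section HopfMap.
Context {R : realType} {m : nat}.
Local Notation E := ('M[R]_(m, 4) * 'rV[R]_4)%type.
Local Notation W := ('M[R]_(m * 4) * 'rV[R]_4)%type.
Implicit Types (x v w z : E) (y : 'M[R]_(m, 4)) (b : bool) (t : R).

Definition outer y y' : 'M[R]_(m * 4) := (mxvec y)^T *m mxvec y'.

Lemma cb_outer : cont_bilinear outer.
Proof.
apply: (cb_comp (cb_mulmx _ _ _)).
  by apply: cl_mx => *; rewrite ?linearD ?linearZ /= ?linearD ?linearZ.
by apply: cl_mx => *; rewrite ?linearD ?linearZ.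
Qed.

(* Twice the orthogonal projection onto the complex line of [y]; it separates
   the circles [y exp(i t)] of the unit sphere. *)
Definition line_proj y := outer y y + outer (rmulq y qi) (rmulq y qi).
Definition pr x : W := (line_proj x.1, x.2).

Lemma separated_W : coord_separated (W : normedModType R).
Proof. exact: separated_pair (separated_mx _ _) (separated_mx _ _). Qed.

Lemma pr_circ x t : pr (circ x t) = pr x.
Proof.
congr pair; rewrite /line_proj circ_i /=; set y := x.1.
rewrite !(cbDl cb_outer, cbDr cb_outer) -!(scaleNr _ y).
rewrite !(cbZl cb_outer, cbZr cb_outer) !scalerA.
move: (outer y y) (outer y (rmulq y qi)) (outer (rmulq y qi) y)
  (outer (rmulq y qi) (rmulq y qi)) => a c d e.
apply/matrixP => i j; rewrite !mxE; have := cos2Dsin2 t.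
move: (cos t) (sin t) (a i j) (c i j) (d i j) (e i j) => u v a' c' d' e' uv.
by rewrite -[RHS]mul1r -uv; ring.
Qed.

(** Contracting [line_proj y] with [z] returns, for unit [y], the component of [z] in the complex
    line of [y]: a linear way to recover points of a line from its projection. *)
Definition mx_contract y (Q : 'M[R]_(m * 4)) : 'M[R]_(m, 4) := vec_mx (mxvec y *m Q).

Lemma cl_mx_contract y : cont_linear (mx_contract y).
Proof.
apply: cl_mx => *; rewrite /mx_contract ?mulmxDr -?scalemxAr ?linearD ?linearZ//.
Qed.

Lemma mx_contract_proj y (z : 'M[R]_(m, 4)) : mx_contract z (line_proj y) = dot z y *: y + dot z (rmulq y qi) *: rmulq y qi.
Proof.
have O1 (u v : 'M[R]_(m, 4)) : mx_contract z (outer u v) = dot z u *: v.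
  rewrite /mx_contract /outer mulmxA [mxvec z *m _]mx11_scalar -dot_mxvec mul_scalar_mx.
  by rewrite linearZ /= mxvecK.
by rewrite (clD (cl_mx_contract z)) !O1.
Qed.

Lemma pr_Ck (U : normedModType R) k (D : set U) (f : U -> E) : open D ->
  Ck k D f -> Ck k D (fun u => pr (f u)).
Proof.
move=> oD fC; have f1 := Ck_lin oD (cl_fst _ _) fC; have f2 := Ck_lin oD (cl_snd _ _) fC.
apply: (Ck_pair oD) => //; have f1i := Ck_lin oD (cl_rmulq m qi) f1.
by apply: (CkD oD); apply: (Ck_bilin oD cb_outer).
Qed.

Lemma pr_derive (U : normedModType R) (f : U -> E) u a : derivable f u a ->
  is_derive u a (fun u => pr (f u))
    (outer ('D_a f u).1 (f u).1 + outer (f u).1 ('D_a f u).1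
     + (outer (rmulq ('D_a f u).1 qi) (rmulq (f u).1 qi)
        + outer (rmulq (f u).1 qi) (rmulq ('D_a f u).1 qi)), ('D_a f u).2).
Proof.
move=> df; have [d1 e1] := is_derive_lin (cl_fst _ _) df.
have [di ei] := is_derive_lin (cl_rmulq m qi) d1.
have d2 := is_derive_lin (cl_comp (cl_inr 'M[R]_(m * 4) 'rV[R]_4) (cl_snd 'M[R]_(m, 4) 'rV[R]_4)) df.
have P1 := is_derive_bilin cb_outer d1 d1; have P2 := is_derive_bilin cb_outer di di.
have [P3 e3] := is_derive_add P1 P2.
have P4 := is_derive_lin (cl_inl 'M[R]_(m * 4) 'rV[R]_4) P3.
have [P5 e5] := is_derive_add P4 d2.
have E5 : (fun u => pr (f u)) = fun u => ((line_proj (f u).1, 0) : W) + (0, (f u).2).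
  by apply/funext => v; congr pair; rewrite /= ?addr0 ?add0r.
rewrite E5; split; first exact: P5.
rewrite e5 e3 ei e1; congr pair; rewrite /= ?addr0 ?add0r//.
Qed.

Lemma pr_eq b x z : model b x -> model b z -> pr z = pr x -> exists t, z = circ x t.
Proof.
move=> /modelP[x1 x2 _] /modelP[z1 z2 _] e.
(* A unit vector is fixed by the projection to its own line, so equality of the projections writes
   [z] in terms of [x] and [x i]. *)
have := congr1 (fun Q : W => mx_contract z.1 Q.1) e; rewrite /= !mx_contract_proj.
rewrite z1 scale1r [dot z.1 (rmulq z.1 qi)]dotC dot_xi scale0r addr0 => zE.
have [t [ct st]] : exists t, cos t = dot z.1 x.1 /\ sin t = dot z.1 (rmulq x.1 qi).
  apply: unit_angle; rewrite -[RHS]z1 {4}zE dotDr !dotZr !expr2//.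
exists t; rewrite /circ ct st -zE; have /= <- := congr1 snd e.
by rewrite -surjective_pairing.
Qed.

Variable om : R.
Hypothesis om0 : 0 < om.
Local Notation K := (hopf_gen om).
Local Notation F := (flow_lines K).

Lemma circ_tangent b x (k : R) : model b x ->
  tangent_curve (model b) F setT (fun s => circ x (k * s)).
Proof.
move=> Mx; split=> [j|t _].
  apply: (circ_Ck openT); first exact: Ck_cst.
  exact: Ck_linear (cl_scale (R : normedModType R) k).
split; first exact: circ_model.
rewrite derive1E; have [_ ->] := circ_derive x k t.
exists (k / om); rewrite /hopf_gen; congr pair; rewrite ?scaler0//.
by rewrite /= scale1r scalerA divfK ?gt_eqF.
Qed.

(** The derivative of the Hopf map vanishes on [K], so a tangent curve of any speed stays in one
    fibre. *)
Lemma pr_tangent_curve b (c : R -> E) : tangent_curve (model b) F setT c ->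
  forall s t, pr (c s) = pr (c t).
Proof.
move=> [cC cT] s t.
have d0 r : is_derive r (1 : R) (fun r => pr (c r)) 0.
  have dc : derivable c r (1 : R) := CkS_derivable (cC 1%N) I.
  have [dp ep] := pr_derive dc; split=> //; rewrite ep.
  have [_ [k]] := cT r I; rewrite derive1E => ->.
  rewrite /hopf_gen /= scalerA; congr pair; last by rewrite scaler0.
  rewrite rmulqZ rmulq_ii scalerN -(scaleNr _ (c r).1).
  rewrite !(cbZl cb_outer, cbZr cb_outer) !scaleNr -opprD.
  by apply/eqP; rewrite subr_eq0 addrC.
have [I0 [l [lc l0]]] := separated_W.
apply/eqP; rewrite -subr_eq0; apply/eqP; apply: l0 => i; rewrite (clB (lc i)).
apply/eqP; rewrite subr_eq0; apply/eqP.
apply: (is_derive_0_is_cst (f := fun r => l i (pr (c r)))) => r.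
have [dp ep] := d0 r; have [dl el] := is_derive_lin (lc i) dp.
by split=> //; rewrite el ep (cl0 (lc i)).
Qed.

Lemma leafE b x : model b x -> leaf (model b) F x = [set y | exists t, y = circ x t].
Proof.
move=> Mx; apply/seteqP; split=> [_ [c [cT c0 <-]]|_ [t ->]] /=.
  have Mc r : model b (c r) by have [_ /(_ r I) []] := cT.
  by apply: (pr_eq Mx (Mc 1)); rewrite (pr_tangent_curve cT 1 0) c0.
exists (fun s => circ x (t * s)); split; first exact: circ_tangent.
  by rewrite mulr0 /circ cos0 sin0 scale1r scale0r addr0 -surjective_pairing.
by rewrite mulr1.
Qed.

Lemma leaf_pr b x : model b x -> leaf (model b) F x = [set y | model b y /\ pr y = pr x].
Proof.
move=> Mx; rewrite leafE//; apply/seteqP; split=> [_ [t ->]|y [My e]] /=.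
  by split; [exact: circ_model|exact: pr_circ].
exact: (pr_eq Mx My e).
Qed.

(** [K] has length 1 for [g], hence [sqrt r] after rescaling, and its orbits close up after flow
    time [2 pi / om]. *)
Lemma circle_leaf_circ b x (g : E -> E -> E -> R) (r : R) : model b x -> 0 < r ->
  (forall (y : E) k l v w, g y (k *: v) (l *: w) = k * (l * g y v w)) ->
  (forall (y : E), model b y -> g y (K y) (K y) = 1) ->
  circle_leaf (model b) (rescale r g) F x (fun s => circ x (om / Num.sqrt r * s))
    (2 * pi * Num.sqrt r / om).
Proof.
move=> Mx r0 gZ g1; have sr0 : 0 < Num.sqrt r by rewrite sqrtr_gt0.
have k0 : 0 < om / Num.sqrt r by rewrite divr_gt0.
have kl : om / Num.sqrt r * (2 * pi * Num.sqrt r / om) = 2 * pi.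
  by field; rewrite !gt_eqF.
split; first exact: circ_tangent.
- move=> t _; rewrite derive1E; have [_ ->] := circ_derive x (om / Num.sqrt r) t.
  set y := circ x _; have -> : om / Num.sqrt r *: (hopf_gen 1 y : E) = (Num.sqrt r)^-1 *: K y.
    rewrite /hopf_gen; congr pair; rewrite /= ?scaler0// !scalerA mulr1.
    by rewrite [om / _]mulrC.
  rewrite /rescale gZ g1 ?mulr1; last exact: circ_model.
  by rewrite -invfM -expr2 sqr_sqrtr ?ltW// divff// gt_eqF.
- split.
  + by rewrite !(divr_gt0, mulr_gt0)// pi_gt0.
  + by move=> t; rewrite mulrDr kl /circ -[2 * pi]mul1r (cos_period 1) (sin_period 1).
  + move=> s t /andP[s0 sl] /andP[t0 tl] /(circ_inj _ _ Mx)[k].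
    rewrite -mulrBr => e.
    (* Two parameters within one period differ by less than the period, which leaves only
       [k = 0]. *)
    have bnd : - (2 * pi) < om / Num.sqrt r * (s - t) < 2 * pi.
      by rewrite -kl -mulrN !ltr_pM2l//; apply/andP; split; lra.
    have k0' : k = 0.
      move: bnd; rewrite e -[- (2 * pi)]mulN1r -[X in _ < _ < X]mul1r !ltr_pM2r ?mulr_gt0 ?pi_gt0//.
      by rewrite (_ : -1 = (-1)%:~R :> R)// (_ : 1 = 1%:~R :> R)// !ltr_int => /andP[]; case: (k) => [[|n]|n].
    move/eqP: e; rewrite k0' mul0r mulf_eq0 gt_eqF//= subr_eq0 => /eqP //.
- rewrite leafE//; apply/seteqP; split=> [_ [t _ <-]|_ [t ->]] /=; first by eexists.
  exists ((om / Num.sqrt r)^-1 * t) => //.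
  by rewrite mulrA divff ?gt_eqF// mul1r.
Qed.

End HopfMap.

Section LinearReparametrization.
Context {R : realType} {U V W : normedModType R}.

Lemma derive_lin_comp (l : U -> V) (f : V -> W) x v : cont_linear l ->
  derivable f (l x) (l v) ->
  is_derive x v (fun u => f (l u)) ('D_(l v) f (l x)).
Proof.
move=> cl /derivable_cvg df; apply: cvg_is_derive.
have -> : (fun h : R => h^-1 *: (f (l (h *: v + x)) - f (l x))) =
  fun h => h^-1 *: (f (h *: l v + l x) - f (l x)).
  by apply/funext => h; rewrite (clD cl) (clZ cl).
exact: df.
Qed.

Lemma Ck_lin_comp k (l : U -> V) (f : V -> W) : cont_linear l ->
  Ck k setT f -> Ck k setT (fun u => f (l u)).
Proof.
move=> cl; elim: k f => [|k IH] f fC.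
  split=> // x _; apply: (cvg_comp _ _ (@cl_cont _ _ _ _ cl x)).
  exact: (Ck_cont fC (I : setT (l x))).
have dE x v := derive_lin_comp (x := x) (v := v) cl (CkS_derivable fC (I : setT (l x))).
split=> [x _|v].
  apply: (cvg_comp _ _ (@cl_cont _ _ _ _ cl x)).
  exact: (Ck_cont fC (I : setT (l x))).
split=> [x _|]; first by have [] := dE x v.
apply: (eq_Ck openT _ (IH _ (CkS_D (l v) fC))) => x _.
by have [_ ->] := dE x v.
Qed.

End LinearReparametrization.

(** * Local trivialisations of the Hopf fibration *)

Section HopfFibration.
Context {R : realType} {m : nat} (m_gt0 : (0 < m)%N).
Local Notation E := ('M[R]_(m, 4) * 'rV[R]_4)%type.
Local Notation W := ('M[R]_(m * 4) * 'rV[R]_4)%type.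
Implicit Types (x v w z : E) (t : R).
Variable b : bool.
Local Notation n := (model_dim b (m := m)).
Local Notation M := (model b : set E).
Local Notation B := (pr @` M : set W).

Definition slice x v := tan_space b x v /\ dot (rmulq x.1 qi) v.1 = 0.

Lemma slice_coordinates x : M x ->
  exists (L : 'rV[R]_n.-1 -> E) (P : E -> 'rV[R]_n.-1),
    [/\ cont_linear L, cont_linear P, cancel L P,
        forall a, slice x (L a) & forall v, slice x v -> L (P v) = v].
Proof.
move=> Mx; pose cs : seq E := (rmulq x.1 qi, 0) :: normals b x.
have sE : (n.-1 + size cs = m * 4 + 4)%N.
  rewrite /= addnS -addSn prednK; last by rewrite /model_dim; case: (b); case: (m) m_gt0.
  exact: size_normals.
have [L [P [cL cP LK Lc LP]]] := ortho_coordinates sE (hopf_normals_ortho Mx).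
have iE v : dotE v (rmulq x.1 qi, 0) = dot (rmulq x.1 qi) v.1.
  by rewrite /dotE dot0r addr0 dotC.
exists L, P; split=> // [a|v [/tan_spaceP Tv vi]].
  split; first by apply/tan_spaceP => c cn; apply: Lc; rewrite /cs inE cn orbT.
  by rewrite -iE; apply: Lc; rewrite inE eqxx.
apply: LP => c; rewrite inE => /orP[/eqP ->|]; last exact: Tv.
by rewrite iE.
Qed.

Section Slice.
Variables (x : E) (L : 'rV[R]_n.-1 -> E) (P : E -> 'rV[R]_n.-1).
Hypotheses (Mx : M x) (cL : cont_linear L) (cP : cont_linear P) (LK : cancel L P).
Hypotheses (Ls : forall a, slice x (L a)) (LP : forall v, slice x v -> L (P v) = v).
Local Notation gn := (gnomonic x L).
Implicit Types (u a : 'rV[R]_n.-1).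

Let Lt a : tan_space b x (L a). Proof. by have [] := Ls a. Qed.

Definition slice_chart u : W := pr (gn u).

(** A linear inverse of the Hopf map on the slice, up to a positive factor: a slice representative
    [y] satisfies [<x, y i> = 0], so contraction with [x] gives [<x, y> y]. *)
Definition unproj (Q : W) : E := (mx_contract x.1 Q.1, Q.2).

Lemma cl_unproj : cont_linear unproj.
Proof.
have -> : unproj = fun Q => ((mx_contract x.1 Q.1, 0) : E) + (0, Q.2).
  by apply/funext => Q; congr pair; rewrite ?addr0 ?add0r.
exact: cl_add (cl_comp (cl_inl _ _) (cl_comp (cl_mx_contract x.1) (cl_fst _ _)))
  (cl_comp (cl_inr _ _) (cl_snd _ _)).
Qed.

Lemma unproj_slice_chart u : unproj (slice_chart u) = (dot (gn u).1 x.1 *: (gn u).1, (gn u).2).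
Proof.
have /modelP[x1 _ _] := Mx; have [_ si] := Ls u.
rewrite /unproj /slice_chart /=; congr pair; rewrite mx_contract_proj [dot x.1 _]dotC.
have [[_ e] _] := gn_cone Mx Lt u.
suff -> : dot x.1 (rmulq (gn u).1 qi) = 0 by rewrite scale0r addr0.
rewrite dot_i; have -> : dot (rmulq x.1 qi) (gn u).1 =
    dot (gn u).1 x.1 * dot (rmulq x.1 qi) (x + L u).1 by rewrite {1}e dotZr.
by rewrite dotDr dot_xi si addr0 mulr0 oppr0.
Qed.

Lemma unproj_slice_chart_cone u : cone_dom x (unproj (slice_chart u)) /\ cone_coord x (unproj (slice_chart u)) = L u.
Proof.
have [[p1 _] [p2 _]] := gn_cone Mx Lt u; rewrite unproj_slice_chart.
have [_ <-] := cone_coord_gn Mx cL Lt u.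
split; first by split=> //=; rewrite dotZl mulr_gt0.
congr pair; rewrite /= dotZl scalerA; congr (_ *: _ - _).
by rewrite invfM -mulrA mulVf ?mulr1// gt_eqF.
Qed.

Lemma slice_chart_Ck k : Ck k setT slice_chart.
Proof. by apply: (pr_Ck openT); exact: (gn_Ck Mx cL Lt). Qed.

(** As [unproj] is linear, it carries the criterion [cone_derive] from the sphere to the base. *)
Lemma slice_chart_immersion u a : 'D_a slice_chart u = 0 -> a = 0.
Proof.
move=> slice_chart0; apply: (can_inj LK); rewrite (cl0 cL).
have dpsi : derivable slice_chart u a := CkS_derivable (slice_chart_Ck 1) I.
have [d1 e1] := is_derive_lin (cl_comp (cl_fst _ _) cl_unproj) dpsi.
have [d2 e2] := is_derive_lin (cl_comp (cl_snd _ _) cl_unproj) dpsi.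
have [C1 C2] : (forall y, 0 < dot (unproj (slice_chart y)).1 x.1 /\
      (unproj (slice_chart y)).1 = dot (unproj (slice_chart y)).1 x.1 *: (x.1 + (L y).1)) /\
    (forall y, 0 < dot (unproj (slice_chart y)).2 x.2 /\
      (unproj (slice_chart y)).2 = dot (unproj (slice_chart y)).2 x.2 *: (x.2 + (L y).2)).
  have S k (c z : 'M[R]_(k, 4)) : 0 < dot z c -> z = dot z c *: (c + ((dot z c)^-1 *: z - c)).
    by move=> zc; rewrite addrC subrK scalerA divff ?scale1r// gt_eqF.
  split=> y; have [[p1 p2] Ly] := unproj_slice_chart_cone y; split; rewrite // -Ly; exact: S.
have L1 : (L a).1 = 0.
  apply: (cone_derive (f := fun u => (unproj (slice_chart u)).1) (c := x.1) (u := u)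
    (l := fun u => (L u).1)) => //.
  - exact: cl_comp (cl_fst _ _) cL.
  - by rewrite e1 slice_chart0 (cl0 cl_unproj).
  - by move=> y; have [_ {1}->] := C1 y.
  - by have [+ _] := C1 u; move=> /lt0r_neq0.
have L2 : (L a).2 = 0.
  apply: (cone_derive (f := fun u => (unproj (slice_chart u)).2) (c := x.2) (u := u)
    (l := fun u => (L u).2)) => //.
  - exact: cl_comp (cl_snd _ _) cL.
  - by rewrite e2 slice_chart0 (cl0 cl_unproj).
  - by move=> y; have [_ {1}->] := C2 y.
  - by have [+ _] := C2 u; move=> /lt0r_neq0.
by rewrite [L a]surjective_pairing L1 L2.
Qed.

(* The circle of [y] meets the slice in the unit vector along the projection
   of [x] to the complex line of [y]. *)
Lemma slice_chart_surj y : M y -> cone_dom x (unproj (pr y)) ->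
  slice_chart (P (cone_coord x (unproj (pr y)))) = pr y.
Proof.
move=> My [p1 p2]; have /modelP[x1 x2 xc] := Mx; have /modelP[y1 y2 yc] := My.
pose c := dot x.1 y.1; pose s := dot x.1 (rmulq y.1 qi).
have uE : (unproj (pr y)).1 = c *: y.1 + s *: rmulq y.1 qi by rewrite /= mx_contract_proj.
have cs : 0 < c ^+ 2 + s ^+ 2.
  by move: p1; rewrite uE dotDl !dotZl [dot y.1 _]dotC [dot _ x.1]dotC -!expr2.
pose r := Num.sqrt (c ^+ 2 + s ^+ 2); have r0 : 0 < r by rewrite sqrtr_gt0.
have rr : r ^+ 2 = c ^+ 2 + s ^+ 2 by rewrite sqr_sqrtr// ltW.
have [t [ct st]] : exists t, cos t = c / r /\ sin t = s / r.
  by apply: unit_angle; rewrite !exprMn -mulrDl -rr exprVn divff// sqrf_eq0 gt_eqF.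
pose z := circ y t; have Mz : M z by exact: circ_model.
have zu : (unproj (pr y)).1 = r *: z.1.
  by rewrite uE /= ct st scalerDr !scalerA ![r * _]mulrC !divfK ?gt_eqF.
have zx : dot z.1 x.1 = r.
  apply: (mulfI (lt0r_neq0 r0)); rewrite -dotZl -zu uE dotDl !dotZl.
  by rewrite [dot y.1 _]dotC [dot _ x.1]dotC -!expr2 rr.
have Dz : cone_dom x z by split; rewrite /= ?zx.
have cE : cone_coord x (unproj (pr y)) = cone_coord x z.
  rewrite /cone_coord zu dotZl scalerA; congr pair.
  by rewrite invfM mulrAC mulVf ?mul1r// gt_eqF.
have zi : dot x.1 (rmulq z.1 qi) = 0.
  rewrite circ_i dotDr dotNr !dotZr ct st -/c -/s.
  by rewrite mulrAC [s / r * c]mulrAC [s * c]mulrC subrr.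
have S : slice x (cone_coord x z).
  split; first exact: cone_coord_tan.
  by rewrite /= dotDr dotNr dotZr dot_xi subr0 [dot _ z.1](_ : _ = 0) ?mulr0//
    -[LHS]opprK -dot_i zi oppr0.
rewrite cE -(pr_circ y t) -/z /slice_chart; congr pr.
by apply: (gn_cone_coord Mz Dz); rewrite LP.
Qed.

Lemma slice_chart_param : parametrization B setT slice_chart.
Proof.
split.
- exact: openT.
- by move=> k; exact: slice_chart_Ck.
- by move=> u a _; exact: slice_chart_immersion.
- move=> u v _ _ uv; apply: (can_inj LK).
  by have [_ <-] := unproj_slice_chart_cone u; have [_ <-] := unproj_slice_chart_cone v; rewrite uv.
- move=> U oU _; exists (unproj @^-1` (cone_dom x `&` (fun y => P (cone_coord x y)) @^-1` U)).
    apply: open_comp => [y _|]; first exact: (cl_cont cl_unproj).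
    exact: cone_preimage_open.
  apply/seteqP; split=> [_ [u Uu <-]|_ [[y My <-] [Dy Uy]]].
    have [Du cu] := unproj_slice_chart_cone u; split.
      by exists (gn u) => //; exact: (gn_model Mx Lt).
    by split=> //=; rewrite cu LK.
  by exists (P (cone_coord x (unproj (pr y)))) => //; exact: slice_chart_surj.
Qed.

Lemma slice_chart0 : slice_chart 0 = pr x.
Proof. by rewrite /slice_chart (gn0 Mx cL). Qed.

Definition local_triv (z : 'rV[R]_n.-1 * R) : E := circ (gn z.1) z.2.

Lemma local_triv_Ck k : Ck k setT local_triv.
Proof.
apply: (circ_Ck openT); first exact: (Ck_lin_comp (cl_fst _ _) (gn_Ck Mx cL Lt k)).
exact: (Ck_linear setT k (cl_snd 'rV[R]_n.-1 (R : normedModType R))).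
Qed.

(** Composition with [pr] forgets the angle and forces [a.1 = 0]; what remains is [a.2] times the
    unit tangent of the circle. *)
Lemma local_triv_immersion u t (a : 'rV[R]_n.-1 * R) : 'D_a local_triv (u, t) = 0 -> a = 0.
Proof.
move=> D0; have dtriv : derivable local_triv (u, t) a := CkS_derivable (local_triv_Ck 1) I.
have [dp ep] := pr_derive dtriv.
have prE : (fun z : 'rV[R]_n.-1 * R => pr (local_triv z)) = fun z : 'rV[R]_n.-1 * R => slice_chart z.1.
  by apply/funext => z; rewrite /local_triv pr_circ.
have dpsi : derivable slice_chart u a.1 := CkS_derivable (slice_chart_Ck 1) I.
have [_ e] := derive_lin_comp (x := (u, t) : 'rV[R]_n.-1 * R) (v := a)
  (cl_fst 'rV[R]_n.-1 (R : normedModType R)) dpsi.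
have a1 : a.1 = 0.
  apply: (@slice_chart_immersion u); apply: etrans (esym e) _.
  rewrite -prE ep D0 /= -(scale0r (0 : 'M[R]_(m, 4))) rmulqZ.
  by rewrite !(cbZl cb_outer, cbZr cb_outer) !scale0r !addr0.
have dgn : derivable gn u a.1 := CkS_derivable (gn_Ck Mx cL Lt 1) I.
have [dg eg] := derive_lin_comp (x := (u, t) : 'rV[R]_n.-1 * R) (v := a)
  (cl_fst 'rV[R]_n.-1 (R : normedModType R)) dgn.
have g0 : 'D_a (fun z : 'rV[R]_n.-1 * R => gn z.1) (u, t) = 0.
  by rewrite eg a1 derive0.
have ds : derivable (fun z : 'rV[R]_n.-1 * R => z.2) (u, t) a.
  exact: CkS_derivable (Ck_linear setT 1 (cl_snd 'rV[R]_n.-1 (R : normedModType R))) I.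
have es : 'D_a (fun z : 'rV[R]_n.-1 * R => z.2) (u, t) = a.2.
  have did : derivable (@id ('rV[R]_n.-1 * R)) (u, t) a by exact: derivable_id.
  have [_] := is_derive_lin (cl_snd 'rV[R]_n.-1 (R : normedModType R)) did.
  by rewrite derive_id.
have [dc ec] := is_derive_comp_scalar ds (is_derive_cos t).
have [dsn esn] := is_derive_comp_scalar ds (is_derive_sin t).
have [dy ey] := is_derive_lin (cl_fst _ _) dg.
have [dyi eyi] := is_derive_lin (cl_rmulq m qi) dy.
have p1 := is_derive_bilin (cb_scale 'M[R]_(m, 4)) dc dy.
have p2 := is_derive_bilin (cb_scale 'M[R]_(m, 4)) dsn dyi.
have [_ e3] := is_derive_add p1 p2.
have [_ e4] := is_derive_lin (cl_fst _ _) dtriv.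
have := etrans (esym e3) e4; rewrite D0 eyi ey g0 ec esn es.
have /modelP[y1 _ _] := gn_model Mx Lt u.
rewrite -[(gnomonic x L (u, t).1).1]/((gn u).1).
move: (gn u).1 y1 => y y1.
rewrite -[(0 : E).1]/(0 : 'M[R]_(m, 4)).
have -> : rmulq (0 : 'M[R]_(m, 4)) qi = 0 by rewrite -(scale0r 0) rmulqZ !scale0r.
rewrite !scaler0 !addr0 => /(congr1 (fun z : 'M[R]_(m, 4) => dot z (- sin t *: y + cos t *: rmulq y qi))).
rewrite dot0l !dotDl !dotZl !dotDr !dotZr (frame_dots y1) y1 dot_xi.
rewrite [dot _ (rmulq _ qi)]dotC dot_xi => e5.
have a2 : a.2 = 0.
  have cs := cos2Dsin2 t; rewrite -[LHS]mul1r -cs; move: e5.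
  by move: (cos t) (sin t) (a.2) => c' s' k <-; ring.
by rewrite [a]surjective_pairing a1 a2.
Qed.

End Slice.

Lemma base_submanifold : submanifold n.-1 B.
Proof.
move=> _ [x Mx <-]; have [L [P [cL cP LK Ls LP]]] := slice_coordinates Mx.
exists setT, (slice_chart x L); split; first exact: (slice_chart_param Mx cL cP LK Ls LP).
by exists 0 => //; exact: (slice_chart0 Mx cL).
Qed.

Lemma hopf_fibration (om : R) : 0 < om ->
  smooth_circle_fibration n M (flow_lines (hopf_gen om)).
Proof.
move=> om0; exists W, B, pr; split.
- exact: base_submanifold.
- by move=> D phi [oD phiC _ _ _] k; exact: (pr_Ck oD (phiC k)).
- by [].
- by move=> x Mx; exact: leaf_pr.
move=> _ [x Mx <-]; have [L [P [cL cP LK Ls LP]]] := slice_coordinates Mx.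
have Lt a : tan_space b x (L a) by have [] := Ls a.
exists setT, (slice_chart x L), (local_triv x L); split; split.
- exact: (slice_chart_param Mx cL cP LK Ls LP).
- by exists 0 => //; exact: (slice_chart0 Mx cL).
- by move=> k; rewrite setXTT; exact: (local_triv_Ck Mx cL Ls).
- by move=> y t _ a; exact: (local_triv_immersion Mx cL LK Ls).
- move=> y t _; split; last exact: pr_circ.
  by apply: circ_model; exact: (gn_model Mx Lt).
- move=> z Mz [u _ e]; have [t zt] := pr_eq (gn_model Mx Lt u) Mz (esym e).
  by exists u, t.
- by move=> y s t _; exact: (circ_inj _ _ (gn_model Mx Lt y)).
Qed.

End HopfFibration.

(** * Pinching *)

Section Pinching.
Context {R : realType}.
Implicit Types (eps z w : R).

Definition tau_eps eps := eps * (1 + eps) / (4 + eps).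
Definition gap_eps eps := Num.sqrt (eps ^+ 2 + 4 * tau_eps eps).
Definition min_eps eps := (2 + 5 * eps - 3 * gap_eps eps) / 8.
Definition max_eps eps := (2 + 5 * eps + 3 * gap_eps eps) / 8.

Section Eigenvalues.
Variable eps : R.
Hypothesis eps0 : 0 < eps.
Local Notation r := (r_eps eps).
Local Notation S := (gap_eps eps).
Local Notation tau := (tau_eps eps).

Lemma tauE : tau * (4 + eps) = eps * (1 + eps).
Proof. have e0 := eps0; by rewrite /tau_eps divfK// gt_eqF//; lra. Qed.

Lemma tau_gt0 : 0 < tau.
Proof. have e0 := eps0; by rewrite /tau_eps divr_gt0 ?mulr_gt0//; lra. Qed.

Lemma r_sq : r ^+ 2 * (eps * (4 + eps)) = 1 + eps.
Proof.
have e0 := eps0.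
have d0 : 0 < eps * (4 + eps) by rewrite mulr_gt0//; lra.
by rewrite sqr_sqrtr ?divfK ?gt_eqF// divr_ge0 ?ltW//; lra.
Qed.

Lemma tau_r : tau = eps ^+ 2 * r ^+ 2.
Proof.
have e0 := eps0.
apply: (@mulIf _ (4 + eps)); first by rewrite gt_eqF//; lra.
by rewrite tauE -r_sq; ring.
Qed.

Lemma gap_sq : S ^+ 2 = eps ^+ 2 + 4 * tau.
Proof. by rewrite sqr_sqrtr// addr_ge0 ?sqr_ge0// mulr_ge0// ltW ?tau_gt0. Qed.

Lemma gap_gt : eps < S.
Proof.
have e0 := eps0.
have S0 : 0 <= S by exact: sqrtr_ge0.
have := gap_sq; have := tau_gt0; move: S S0 tau => s s0 t t0 e; nra.
Qed.

(** The block has positive trace and determinant [(1 + eps) ^ 3 / (4 * (4 + eps))]; the cube below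
    is this determinant with denominators cleared. *)
Lemma min_eps_gt0 : 0 < min_eps eps.
Proof.
have e0 := eps0.
have S0 : 0 <= S by exact: sqrtr_ge0.
suff : 3 * S < 2 + 5 * eps by rewrite /min_eps => ?; lra.
have H : (3 * S) ^+ 2 < (2 + 5 * eps) ^+ 2.
  rewrite exprMn gap_sq -subr_gt0.
  have e4 : 0 < 4 + eps by lra.
  rewrite -(pmulr_rgt0 _ e4).
  have -> : (4 + eps) * ((2 + 5 * eps) ^+ 2 - 3 ^+ 2 * (eps ^+ 2 + 4 * tau)) =
     16 * (1 + eps) ^+ 3 + 36 * (eps * (1 + eps) - tau * (4 + eps)) by ring.
  by rewrite tauE subrr mulr0 addr0 mulr_gt0// exprn_gt0//; lra.
have [//|le] := ltP (3 * S) (2 + 5 * eps).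
have : (2 + 5 * eps) ^+ 2 <= (3 * S) ^+ 2 by apply: lerXn2r => //; rewrite ?nnegrE; lra.
by rewrite leNgt H.
Qed.

(** The lower bound amounts to [5 * eps - 2 * tau <= 3 * S]; once squared and cleared of
    denominators, its two sides differ by exactly [144 * eps]. *)
Lemma middle_eigenvalue : min_eps eps <= 1 / 4 + tau / 4 <= max_eps eps.
Proof.
have e0 := eps0.
have S0 := gap_gt; have t0 := tau_gt0; have tE := tauE.
have te : tau <= eps by move: tau tE t0 => t; nra.
apply/andP; split; rewrite /min_eps /max_eps; last by lra.
suff : 5 * eps - 2 * tau <= 3 * S by move=> ?; lra.
have H : (5 * eps - 2 * tau) ^+ 2 <= (3 * S) ^+ 2.
  rewrite [X in _ <= X]exprMn gap_sq -subr_ge0.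
  have e4 : 0 < (4 + eps) ^+ 2 by rewrite exprn_gt0//; lra.
  rewrite -(pmulr_rge0 _ e4).
  have -> : (4 + eps) ^+ 2 * (3 ^+ 2 * (eps ^+ 2 + 4 * tau) - (5 * eps - 2 * tau) ^+ 2) =
    4 * ((9 + 5 * eps) * (4 + eps) * (tau * (4 + eps)) - 4 * eps ^+ 2 * (4 + eps) ^+ 2
      - (tau * (4 + eps)) ^+ 2) by ring.
  rewrite tauE; have -> : 4 * ((9 + 5 * eps) * (4 + eps) * (eps * (1 + eps))
      - 4 * eps ^+ 2 * (4 + eps) ^+ 2 - (eps * (1 + eps)) ^+ 2) = 144 * eps by ring.
  by lra.
have [//|lt] := leP (5 * eps - 2 * tau) (3 * S).
have : (3 * S) ^+ 2 < (5 * eps - 2 * tau) ^+ 2 by apply: ltrXn2r => //; lra.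
by rewrite ltNge H.
Qed.

(** The Jacobi form on the plane orthogonal to [u_1] in the span of [u_1], [u_3], [v_1], in
    orthonormal coordinates; [min_eps] and [max_eps] are its eigenvalues. *)
Definition block eps z w := (1 / 4 + eps) * z ^+ 2 - 3 / 2 * eps * r_eps eps * z * w
  + (1 + eps) / 4 * w ^+ 2.

Lemma gap_prod : (S + eps) * (S - eps) = 4 * eps ^+ 2 * r ^+ 2.
Proof. by rewrite -mulrA -tau_r mulrC -subr_sqr gap_sq; ring. Qed.

(** The form minus its least eigenvalue is singular, hence a perfect square after multiplication by
    its [z ^ 2] coefficient, [3 / 8 * (S + eps)]. *)
Lemma block_min z w :
  3 / 8 * (S + eps) * (block eps z w - min_eps eps * (z ^+ 2 + w ^+ 2)) =
  (3 / 8 * (S + eps) * z - 3 / 4 * eps * r * w) ^+ 2.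
Proof.
have e0 := eps0.
rewrite /block /min_eps; have := gap_prod; move: S r => s t st.
apply/eqP; rewrite -subr_eq0; apply/eqP.
transitivity (9 / 64 * w ^+ 2 * ((s + eps) * (s - eps) - 4 * eps ^+ 2 * t ^+ 2)); first by field.
by rewrite st subrr mulr0.
Qed.

(** Here the multiplier is the [w ^ 2] coefficient, which has the same value. *)
Lemma block_max z w :
  3 / 8 * (S + eps) * (max_eps eps * (z ^+ 2 + w ^+ 2) - block eps z w) =
  (3 / 8 * (S + eps) * w + 3 / 4 * eps * r * z) ^+ 2.
Proof.
have e0 := eps0.
rewrite /block /max_eps; have := gap_prod; move: S r => s t st.
apply/eqP; rewrite -subr_eq0; apply/eqP.
transitivity (9 / 64 * z ^+ 2 * ((s + eps) * (s - eps) - 4 * eps ^+ 2 * t ^+ 2)); first by field.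
by rewrite st subrr mulr0.
Qed.

Lemma block_bounds z w :
  min_eps eps * (z ^+ 2 + w ^+ 2) <= block eps z w <= max_eps eps * (z ^+ 2 + w ^+ 2).
Proof.
have e0 := eps0.
have k0 : 0 < 3 / 8 * (S + eps) by have := gap_gt; lra.
by rewrite -[_ <= block _ _ _]subr_ge0 -[block _ _ _ <= _]subr_ge0 -(pmulr_rge0 _ k0)
  -[0 <= max_eps _ * _ - _](pmulr_rge0 _ k0) block_min block_max !sqr_ge0.
Qed.

Lemma quarter_eigenvalue : min_eps eps <= (1 + eps) / 4 <= max_eps eps.
Proof. have e0 := eps0; have := gap_gt; rewrite /min_eps /max_eps => ?; apply/andP; split; lra. Qed.

End Eigenvalues.

End Pinching.

Lemma rescale1 (R : realType) (V : normedModType R) (g : V -> V -> V -> R) : rescale 1 g = g.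
Proof. by apply/funext => y; apply/funext => v; apply/funext => w; rewrite /rescale mul1r. Qed.

(** * Extremal curvatures for the explicit parameters *)

Section Examples.
Context {R : realType} {m : nat}.
Local Notation E := ('M[R]_(m, 4) * 'rV[R]_4)%type.
Implicit Types (x v w : E).

Lemma g_familyE (A C D p q : R) : 0 < A -> 0 < C -> D != 0 ->
  g_family A C D p q = fam_form (m := m) A D p q (Num.sqrt (A * C) / 2).
Proof.
move=> A0 C0 D0; have s0 : 0 < Num.sqrt (A * C) by rewrite sqrtr_gt0 mulr_gt0.
apply/funext => x; apply/funext => v; apply/funext => w.
have ji : dot (rmulq x.1 qj) (rmulq x.1 qi) = 0.
  by rewrite dot_i rmulq_ji dotNl opprK dot_xk.
have jk : dot (rmulq x.1 qj) (rmulq x.1 qk) = 0.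
  by rewrite dot_k rmulq_jk dot_xi oppr0.
rewrite /g_family /beta1 /beta3 /sigma1 /gAC /gS3 /u1 /u3 /v1 /xi1 /xi2 /xi3 qmul_rmulq.
rewrite !dotZl !dotZr ji jk -/(heta qi x v) -/(heta qj x v) -/(heta qk x v).
rewrite -/(heta qi x w) -/(heta qj x w) -/(heta qk x w) -/(hsig qi x v) -/(hsig qi x w).
rewrite /fam_form /hopf_form /fam_l2 /fam_d2 /fam_e2 /fam_pp /fam_qq.
move: (Num.sqrt _) s0 => s s0; gen_dot; gen_eta.
by field; rewrite D0 !gt_eqF.
Qed.

Lemma weighted_bounds (l u a k P X Q N : R) : 0 <= P -> 0 <= X ->
  l <= a <= u -> l <= k <= u -> l * N <= Q <= u * N ->
  l * (P + X + N) <= a * P + k * X + Q <= u * (P + X + N).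
Proof.
move=> P0 X0 /andP[la au] /andP[lk ku] /andP[lQ Qu]; rewrite !mulrDr.
by rewrite !lerD// ler_wpM2r.
Qed.

Lemma model_nonempty b : (0 < m)%N -> exists x : E, model b x.
Proof.
move=> m0; pose a : 'M[R]_(m, 4) := delta_mx (Ordinal m0) o0.
exists (a, delta_mx 0 o0); apply/modelP.
have d1 k (i : 'I_k) : dot (delta_mx i o0 : 'M[R]_(k, 4)) (delta_mx i o0) = 1.
  rewrite /dot (bigD1 i)//= sum_ord4 !mxE !eqxx /= !mulr0 mulr1 !addr0 big1 ?addr0//.
  by move=> j /negPf ji; rewrite sum_ord4 !mxE ji /= !mulr0 !addr0.
split; rewrite ?d1//; case: b => //= c; rewrite !inE => /orP[] /eqP ->.
  by rewrite dot_qj mxE.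
by rewrite dot_qk mxE.
Qed.

Variables (b : bool) (eps p0 : R).
Hypotheses (m_gt0 : (0 < m)%N) (eps_gt0 : 0 < eps) (p0_gt0 : 0 < p0) (p0_lt1 : p0 < 1).
Local Notation A := (1 + eps).
Local Notation r := (r_eps eps).
Local Notation h := (h_eps p0 eps).
Local Notation q := (r_eps eps * h_eps p0 eps).
Local Notation om := (Num.sqrt ((1 + eps) * 1) / 2).
Local Notation D := (Num.sqrt (1 + eps) / p0).
Local Notation n := (model_dim b (m := m)).
Local Notation M := (model b : set E).
Local Notation K := (hopf_gen om).
Local Notation g := (g_eps p0 eps).
Local Notation F := (F_eps eps).
Local Notation fam := (fam_form (m := m) A D p0 q om).
Local Notation S := (gap_eps eps).
Local Notation jac := (jacobi_form (g := fam) (g2 := fam_lie (m := m) A D q om)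
  (dg2 := fam_dlie (m := m) A D q om) (K := K) (raise A D p0 q om)).

Lemma A_gt0 : 0 < A. Proof. have e0 := eps_gt0; lra. Qed.
Lemma om_gt0 : 0 < om.
Proof. by rewrite divr_gt0// sqrtr_gt0 mulr1 A_gt0. Qed.
Lemma D_gt0 : 0 < D.
Proof. by rewrite divr_gt0// sqrtr_gt0 A_gt0. Qed.

Lemma om_sq : 4 * om ^+ 2 = A.
Proof. by rewrite mulr1 exprMn sqr_sqrtr ?ltW ?A_gt0//; field. Qed.

Lemma pD_sq : (p0 * D) ^+ 2 = A.
Proof.
by rewrite mulrC divfK ?sqr_sqrtr ?ltW ?A_gt0// gt_eqF.
Qed.

Lemma h_sq : h ^+ 2 * (1 + r ^+ 2) = 1 - p0 ^+ 2.
Proof.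
have p1 := p0_lt1; have p2 := p0_gt0.
have r0 : 0 < 1 + r ^+ 2 by rewrite ltr_pwDl// sqr_ge0.
rewrite sqr_sqrtr ?divfK ?gt_eqF// divr_ge0 ?ltW// subr_gt0.
by rewrite expr_lt1// ltW.
Qed.

(** Thus [h ^ 2] is the Gram determinant of [u_1], [u_3], [v_1]. *)
Lemma hE : 1 - p0 ^+ 2 - q ^+ 2 = h ^+ 2.
Proof. by rewrite -h_sq; ring. Qed.

Lemma h_gt0 : 0 < h.
Proof.
have p1 := p0_lt1; have p2 := p0_gt0.
rewrite sqrtr_gt0; apply: divr_gt0; last by rewrite ltr_pwDl// sqr_ge0.
by rewrite subr_gt0 expr_lt1// ltW.
Qed.

Lemma h_sq_gt0 : 0 < 1 - p0 ^+ 2 - q ^+ 2.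
Proof. by rewrite hE exprn_gt0// h_gt0. Qed.

Let A0 : A != 0. Proof. by rewrite gt_eqF ?A_gt0. Qed.
Let D0 : D != 0. Proof. by rewrite gt_eqF ?D_gt0. Qed.
Let om0 : om != 0. Proof. by rewrite gt_eqF ?om_gt0. Qed.

Lemma g_epsE : g = fam.
Proof. exact: (g_familyE _ _ A_gt0 ltr01 D0). Qed.

Lemma eps_flow : geodesic_flow n M (tan_space b) fam (fam_lie (m := m) A D q om)
  (fam_dform (m := m) A D p0 q om) (fam_dlie (m := m) A D q om) K.
Proof. exact: (fam_flow A0 D0 om0 h_sq_gt0). Qed.

Lemma eps_jacobiE x w : dot x.1 x.1 = 1 -> dot x.2 x.2 = 1 -> tangent x w ->
  jac x w =
  A / 4 * (hor_sq om x w + s2 D x w ^+ 2 + s3 D x w ^+ 2)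
  + (1 / 4 + tau_eps eps / 4) * b2 A x w ^+ 2
  + block eps (b3 om x w + q * s1 D x w) (h * s1 D x w).
Proof.
move=> x1 x2 Tw.
have hn0 : 1 - p0 ^+ 2 - q ^+ 2 != 0 by rewrite gt_eqF ?h_sq_gt0.
rewrite (fam_jacobiE A0 D0 om0 hn0 x1 x2 Tw).
have C1 : 4 * om ^+ 2 / A = 1 by rewrite om_sq divff.
rewrite C1 pD_sq hE -h_sq /block (tau_r eps_gt0).
have rE := r_sq eps_gt0; have h0 : h != 0 by rewrite gt_eqF ?h_gt0.
move: (hor_sq _ _ _) (b2 _ _ _) (b3 _ _ _) (s1 _ _ _) (s2 _ _ _) (s3 _ _ _).
move: (r) (h) h0 rE => r' h' h0 rE H B2 B3 S1 S2 S3.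
apply/eqP; rewrite -subr_eq0; apply/eqP.
(* The two sides differ by a multiple of the defining equation of [r_eps]. *)
transitivity ((r' ^+ 2 * (eps * (4 + eps)) - (1 + eps)) * h' ^+ 2 * S1 ^+ 2 / 4).
  by field.
by rewrite rE subrr !mul0r.
Qed.

Lemma eps_normE x w : dot x.1 x.1 = 1 -> dot x.2 x.2 = 1 -> tangent x w ->
  fam x (K x) w = 0 ->
  fam x w w = hor_sq om x w + s2 D x w ^+ 2 + s3 D x w ^+ 2 + b2 A x w ^+ 2
    + ((b3 om x w + q * s1 D x w) ^+ 2 + (h * s1 D x w) ^+ 2).
Proof.
move=> x1 x2 Tw; rewrite (fam_perpE _ _ A0 D0 om0 x1) => perp.
rewrite (fam_normE p0 q A0 D0 om0 x2 Tw).
have b1E : b1 om x w = - p0 * s1 D x w by apply/eqP; rewrite -subr_eq0 -perp; apply/eqP; ring.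
rewrite b1E; have hE' := hE.
move: (hor_sq _ _ _) (b2 _ _ _) (b3 _ _ _) (s1 _ _ _) (s2 _ _ _) (s3 _ _ _).
move: q h hE' => q' h' hE' H B2 B3 S1 S2 S3.
rewrite [(h' * _) ^+ 2]exprMn -hE'; ring.
Qed.

Lemma eps_bounds x w : M x -> tan_space b x w -> fam x (K x) w = 0 ->
  min_eps eps * fam x w w <= jac x w
    <= max_eps eps * fam x w w.
Proof.
move=> /modelP[x1 x2 _] [Tw _] perp.
rewrite (eps_jacobiE x1 x2 Tw) (eps_normE x1 x2 Tw perp).
apply: weighted_bounds.
- by rewrite !addr_ge0 ?sqr_ge0// hor_sq_ge0.
- exact: sqr_ge0.
- exact: quarter_eigenvalue.
- exact: middle_eigenvalue.
- exact: block_bounds.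
Qed.

(* Eigenvectors lie in the span of [u_1, u_3, v_1]; [z] and [w] are the
   coordinates [beta_3 + q sigma_1] and [h sigma_1]. *)
Definition block_vector x (z w : R) : E :=
  ((om * (- p0 * (w / h))) *: rmulq x.1 qi + (om * (z - r * w)) *: rmulq x.1 qk,
   (w / h * (D / 2)) *: rmulq x.2 qi).

Lemma block_vectorP x (z w : R) : M x -> let v := block_vector x z w in
  [/\ tan_space b x v, fam x (K x) v = 0, fam x v v = z ^+ 2 + w ^+ 2
    & jac x v
      = block eps z w].
Proof.
move=> Mx v; have /modelP[x1 x2 xc] := Mx.
have h0 : h != 0 by rewrite gt_eqF ?h_gt0.
have ei : heta qi x v = om * (- p0 * (w / h)).
  by rewrite /heta /v /= dotDr !dotZr !(frame_dots x1) !(mulr1, mulr0, addr0, add0r).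
have ej : heta qj x v = 0.
  by rewrite /heta /v /= dotDr !dotZr !(frame_dots x1) !(mulr1, mulr0, addr0, add0r).
have ek : heta qk x v = om * (z - r * w).
  by rewrite /heta /v /= dotDr !dotZr !(frame_dots x1) !(mulr1, mulr0, addr0, add0r).
have si : hsig qi x v = w / h * (D / 2).
  by rewrite /hsig /v /= dotZr (frame_dots x2) !mulr1.
have sj : hsig qj x v = 0 by rewrite /hsig /v /= dotZr (frame_dots x2) !mulr0.
have sk : hsig qk x v = 0 by rewrite /hsig /v /= dotZr (frame_dots x2) !mulr0.
have Tv : tangent x v.
  split; rewrite /v /= ?dotDr !dotZr [dot _ (rmulq _ qi)]dotC dot_xi ?mulr0//.
  by rewrite [dot _ (rmulq _ qk)]dotC dot_xk mulr0 addr0.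
have B2 : b2 A x v = 0 by rewrite /b2 ej mulr0.
have B3 : b3 om x v = z - r * w by rewrite /b3 ek mulrC mulKf.
have S1 : s1 D x v = w / h.
  rewrite /s1 si; move: D0 h0; move: (D) (h) => d h' d0 h0; field.
  by rewrite d0 h0.
have S2 : s2 D x v = 0 by rewrite /s2 sj mulr0.
have S3 : s3 D x v = 0 by rewrite /s3 sk mulr0.
have H0 : hor_sq om x v = 0.
  have -> : hor_sq om x v = (dot v.1 v.1 - heta qi x v ^+ 2 - heta qj x v ^+ 2
    - heta qk x v ^+ 2) / om ^+ 2 by [].
  rewrite ei ej ek /v /= !dotDl !dotDr !dotZl !dotZr !(frame_dots x1).
  by apply/eqP; rewrite mulf_eq0; apply/orP; left; apply/eqP; ring.
have perp : fam x (K x) v = 0.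
  rewrite (fam_perpE _ _ A0 D0 om0 x1) S1 /b1 ei.
  by move: om0 h0; move: (om) (h) => o' h' o0 h0; field; rewrite o0 h0.
have qs : q * (w / h) = r * w by rewrite mulrACA divff ?mulr1.
have hs : h * (w / h) = w by rewrite mulrC divfK.
split=> //.
- by split=> // c cl; rewrite /v dotZl (lcs_rmulq_i Mx cl) mulr0.
- rewrite (eps_normE x1 x2 Tv perp) H0 S1 S2 S3 B2 B3 qs hs subrK.
  by rewrite expr0n /= !add0r.
- rewrite (eps_jacobiE x1 x2 Tv) H0 S1 S2 S3 B2 B3 qs hs subrK.
  by rewrite expr0n /= !addr0 !mulr0 !add0r.
Qed.

Lemma eps_mixedP k : mixed_curvatures n M g F k <-> exists x w,
  [/\ M x, tan_space b x w, w != 0, fam x (K x) w = 0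
    & k = jac x w / fam x w w].
Proof.
rewrite g_epsE; apply: (mixed_curvaturesP eps_flow).
by move=> x w; exact: (fam_raise A0 D0 om0 h_sq_gt0).
Qed.

Lemma eps_mixed_bounds k : mixed_curvatures n M g F k -> min_eps eps <= k <= max_eps eps.
Proof.
move=> /eps_mixedP[x [w [Mx Tw w0 perp ->]]].
have N0 : 0 < fam x w w by exact: (gf_pos eps_flow).
by rewrite ler_pdivlMr// ler_pdivrMr// eps_bounds.
Qed.

Lemma block_curvature (z w : R) : 0 < z ^+ 2 + w ^+ 2 ->
  mixed_curvatures n M g F (block eps z w / (z ^+ 2 + w ^+ 2)).
Proof.
move=> zw; have [x Mx] := model_nonempty b m_gt0; apply/eps_mixedP.
have [Tv perp nE jE] := block_vectorP z w Mx.
exists x, (block_vector x z w); split=> //; last by rewrite nE jE.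
apply: contraTneq zw => v0; rewrite -nE v0 (sf0l (gf_form eps_flow)) ltxx//.
Qed.

Lemma eps_is_min : is_min (mixed_curvatures n M g F) (min_eps eps).
Proof.
split=> [|k /eps_mixed_bounds /andP[]//].
have S0 := gap_gt eps_gt0; have e0 := eps_gt0.
(* The vector at which the square in [block_min] vanishes. *)
pose z := 3 / 4 * eps * r; pose w := 3 / 8 * (S + eps).
have w0 : 0 < w by rewrite /w; lra.
have zw : 0 < z ^+ 2 + w ^+ 2 by rewrite ltr_wpDl ?sqr_ge0// exprn_gt0.
have bE : block eps z w = min_eps eps * (z ^+ 2 + w ^+ 2).
  apply/eqP; rewrite -subr_eq0 -(mulrI_eq0 _ (lregP (lt0r_neq0 w0))) block_min// -/w -/z.
  by rewrite mulrC subrr expr0n.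
by have := block_curvature zw; rewrite bE mulfK// gt_eqF.
Qed.

Lemma eps_is_max : is_max (mixed_curvatures n M g F) (max_eps eps).
Proof.
split=> [|k /eps_mixed_bounds /andP[]//].
have S0 := gap_gt eps_gt0; have e0 := eps_gt0.
(* The zero of the square in [block_max], orthogonal to the eigenvector of the minimum. *)
pose z := 3 / 8 * (S + eps); pose w := - (3 / 4 * eps * r).
have z0 : 0 < z by rewrite /z; lra.
have zw : 0 < z ^+ 2 + w ^+ 2 by rewrite ltr_pwDl ?sqr_ge0// exprn_gt0.
have bE : block eps z w = max_eps eps * (z ^+ 2 + w ^+ 2).
  apply/esym/eqP; rewrite -subr_eq0 -(mulrI_eq0 _ (lregP (lt0r_neq0 z0))) block_max// -/z.
  by rewrite /w mulrN mulrC addrC subrr expr0n.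
by have := block_curvature zw; rewrite bE mulfK// gt_eqF.
Qed.

Lemma eps_leaf x (s : R) : M x -> 0 < s ->
  circle_leaf M (rescale s g) F x (fun t => circ x (om / Num.sqrt s * t))
    (2 * pi * Num.sqrt s / om).
Proof.
move=> Mx s0; rewrite g_epsE.
apply: (circle_leaf_circ om_gt0 Mx s0) => [y k l v w|y My].
  by rewrite (sfZl (gf_form eps_flow)) (sfZr (gf_form eps_flow)).
exact: (gf_unit eps_flow).
Qed.

Lemma eps_example : mixed_positive_example n M g F.
Proof.
have gE := g_epsE; split.
- by split; [exact: model_compact|exact: model_submanifold].
- by rewrite gE; exact: (flow_riemannian eps_flow).
- exact: (flow_foliation eps_flow).
- by rewrite gE => J c; exact: (flow_geodesic eps_flow).
- move=> k /eps_mixed_bounds /andP[+ _]; exact: lt_le_trans (min_eps_gt0 eps_gt0).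
- move=> x Mx; have leafx := eps_leaf Mx ltr01.
  rewrite rescale1 in leafx; do 2!eexists; split; first exact: leafx.
  have [ct cu _ _] := leafx; rewrite gE in cu *.
  exact: (flow_geodesic eps_flow openT ct cu).
- exact: (hopf_fibration m_gt0 b om_gt0).
- have [x Mx] := model_nonempty b m_gt0; have /modelP[x1 x2 _] := Mx.
  rewrite gE; apply: (flow_not_bundle_like eps_flow (x := x)
    (v := (rmulq x.1 qj, 0)) (w := (rmulq x.1 qk, 0))) => //.
  + by split=> [|c _]; rewrite ?dot0l//; split; rewrite ?dot0r// dotC dot_xj.
  + by split=> [|c _]; rewrite ?dot0l//; split; rewrite ?dot0r// dotC dot_xk.
  + rewrite (fam_perpE _ _ A0 D0 om0 x1) /b1 /s1 /heta /hsig (frame_dots x1).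
    by rewrite dot0r mul0r !mulr0 addr0.
  + rewrite (fam_perpE _ _ A0 D0 om0 x1) /b1 /s1 /heta /hsig (frame_dots x1).
    by rewrite dot0r mul0r !mulr0 addr0.
  + rewrite /fam_lie /hopf_lie /heta /hsig !dot0r !(frame_dots x1).
    (* This is [M ^ 2 - L ^ 2] for [C = 1], nonzero because [A] differs from [C]. *)
    have -> : fam_e2 A om = - (4 * eps / A ^+ 2).
      have := om_sq; rewrite /fam_e2; have := A0; have := om0.
      move: (om) => o o0 a0 oA; have -> : (o ^+ 2)^-1 = 4 / A by rewrite -oA; field.
      by field.
    have e2 : - (4 * eps / A ^+ 2) != 0.
      by rewrite oppr_eq0 !mulf_neq0 ?invr_eq0 ?expf_neq0 ?pnatr_eq0 ?(gt_eqF eps_gt0).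
    move: (om) om0 (- _) e2 => o o0 k k0; rewrite !(mulr0, mul0r, addr0, mulr1).
    by rewrite !mulf_neq0// pnatr_eq0.
Qed.

End Examples.

(** * Limits as eps tends to 0 from the right *)

Section Limits.
Context {R : realType}.

Lemma eps_cvg : (eps : R) @[eps --> 0^'+] --> (0 : R).
Proof. by apply: cvg_at_right_filter; exact: cvg_id. Qed.

Lemma shift_cvg (a : R) : a + eps @[eps --> (0 : R)^'+] --> a.
Proof.
have {2}-> : a = a + 0 by rewrite addr0.
by apply: cvgD; [exact: cvg_cst|exact: eps_cvg].
Qed.

Lemma gap_cvg : gap_eps eps @[eps --> (0 : R)^'+] --> (0 : R).
Proof.
have tauC : tau_eps eps @[eps --> (0 : R)^'+] --> (0 : R).
  have {2}-> : (0 : R) = 0 * 1 / 4 by rewrite !mul0r.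
  apply: cvgM; last by apply: cvgV; [rewrite pnatr_eq0|exact: shift_cvg].
  by apply: cvgM; [exact: eps_cvg|exact: shift_cvg].
have sqC : eps ^+ 2 + 4 * tau_eps eps @[eps --> (0 : R)^'+] --> (0 : R).
  have {2}-> : (0 : R) = 0 * 0 + 4 * 0 by rewrite !mulr0 addr0.
  apply: cvgD; first by apply: cvgM; exact: eps_cvg.
  by apply: cvgM => //; exact: cvg_cst.
have {2}-> : (0 : R) = Num.sqrt 0 by rewrite sqrtr0.
exact: (cvg_comp _ _ sqC (@sqrt_continuous R 0)).
Qed.

Lemma eigenvalue_cvg (k : R) :
  (2 + 5 * eps + k * gap_eps eps) / 8 @[eps --> (0 : R)^'+] --> (1 / 4 : R).
Proof.
have -> : (1 / 4 : R) = (2 + 5 * 0 + k * 0) / 8 by field.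
apply: cvgM; last exact: cvg_cst.
apply: cvgD; last by apply: cvgM; [exact: cvg_cst|exact: gap_cvg].
apply: cvgD; first exact: cvg_cst.
by apply: cvgM; [exact: cvg_cst|exact: eps_cvg].
Qed.

Lemma min_cvg : min_eps eps @[eps --> (0 : R)^'+] --> (1 / 4 : R).
Proof.
have -> : @min_eps R = fun eps => (2 + 5 * eps + (- 3) * gap_eps eps) / 8.
  by apply/funext => eps; rewrite /min_eps mulNr.
exact: eigenvalue_cvg.
Qed.

Lemma max_cvg : max_eps eps @[eps --> (0 : R)^'+] --> (1 / 4 : R).
Proof. exact: eigenvalue_cvg. Qed.

Lemma length_cvg :
  2 * pi * Num.sqrt (max_eps eps) / (Num.sqrt ((1 + eps) * 1) / 2) @[eps --> (0 : R)^'+]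
    --> (2 * pi : R).
Proof.
have s4 : Num.sqrt (1 / 4 : R) = 1 / 2.
  have -> : (1 / 4 : R) = (1 / 2) ^+ 2 by field.
  by rewrite sqrtr_sqr ger0_norm// divr_ge0.
have {2}-> : (2 * pi : R) = 2 * pi * Num.sqrt (1 / 4) / (Num.sqrt (1 * 1) / 2).
  by rewrite s4 mulr1 sqrtr1; field.
apply: cvgM.
  apply: cvgM; first exact: cvg_cst.
  exact: (cvg_comp _ _ max_cvg (@sqrt_continuous R _)).
apply: cvgV; first by rewrite mulr1 sqrtr1 mul1r invr_eq0 pnatr_eq0.
apply: cvgM; last exact: cvg_cst.
have c1 : (1 + eps) * 1 @[eps --> (0 : R)^'+] --> (1 * 1 : R).
  by apply: cvgM; [exact: shift_cvg|exact: cvg_cst].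
exact: (cvg_comp _ _ c1 (@sqrt_continuous R _)).
Qed.

End Limits.

Lemma model_pinched (R : realType) (m : nat) (b : bool) (p0 : R) : (0 < m)%N ->
  0 < p0 -> p0 < 1 -> almost_1_pinched (model_dim b (m := m)) (model b (R := R) (m := m)) p0.
Proof.
move=> m0 p0_gt0 p0_lt1.
have max0 (eps : R) : 0 < eps -> 0 < max_eps eps.
  by move=> e0; have := quarter_eigenvalue e0; have := min_eps_gt0 e0 => ? /andP[? ?]; lra.
split.
- by move=> eps e0; exact: eps_example.
- exists (fun eps => min_eps eps / max_eps eps); split=> [eps e0|].
    by exists (min_eps eps), (max_eps eps); split; [exact: eps_is_min|exact: eps_is_max|].
  have -> : (1 : R) = (1 / 4) / (1 / 4) by field.
  by apply: cvgM; [exact: min_cvg|apply: cvgV; [lra|exact: max_cvg]].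
pose len (eps : R) := 2 * pi * Num.sqrt (max_eps eps) / (Num.sqrt ((1 + eps) * 1) / 2).
(* Rescaling the metric by [max_eps] divides all curvatures by it; the resulting length is the same
   for every leaf, so uniformity is automatic. *)
exists (@max_eps R), (fun eps _ => len eps); split=> [eps e0|e e0].
  have gR := mpe_riemannian (eps_example b m0 e0 p0_gt0 p0_lt1).
  have [mx ub] := eps_is_max b m0 e0 p0_gt0 p0_lt1; have x0 := max0 _ e0.
  split=> [//||x Mx]; last by eexists; exact: (eps_leaf e0 p0_gt0 p0_lt1 Mx x0).
  split; first by apply/(mixed_curvatures_rescale _ _ x0 gR); rewrite mulr1.
  move=> k /(mixed_curvatures_rescale _ _ x0 gR) /ub.
  by rewrite -ler_pdivlMl// mulVf// gt_eqF.
suff /cvgrPdist_lt /(_ e e0) : len eps @[eps --> (0 : R)^'+] --> (2 * pi : R).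
  by apply: filterS => eps + x _; rewrite distrC.
exact: length_cvg.
Qed.

Theorem theorem1p3 (R : realType) :
  (forall (N : nat) (delta : R), ~~ odd N -> (4 <= N)%N -> 0 < delta < 1 ->
     exists (V : normedModType R) (M : set V) (g : V -> V -> V -> R)
            (F : V -> set V) (r : R),
       [/\ mixed_positive_example N M g F, is_delta_mix N M g F r & delta < r])
  /\
  (forall (m : nat) (p0 : R), (1 <= m)%N -> 0 < p0 < 1 ->
     almost_1_pinched (4 * m + 2)%N (@sphere_S3 R m) p0
     /\ almost_1_pinched (4 * m)%N (@sphere_S1i R m) p0).
Proof.
split=> [N delta evN N4 /andP[_ d1]|m p0 m0 /andP[p0_gt0 p0_lt1]]; last first.
  by split; [exact: (@model_pinched R m true)|exact: (@model_pinched R m false)].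
(* The parity of [N / 2] selects the model: odd for the product with S^3, even for the product with
   the circle. *)
have [m [b [m0 NE]]] : exists m b, (0 < m)%N /\ N = model_dim b (m := m).
  exists (N./2)./2, (odd N./2); split.
    by rewrite half_gt0 -[2%N]/(4./2) half_leq.
  have NE : N = (odd N./2 + (N./2)./2.*2).*2 by rewrite odd_double_half even_halfK.
  rewrite {1}NE /model_dim; case: odd => /=; rewrite -!muln2; ring.
(* A sample value of [p0]; the pinching holds for each [p0] between 0 and 1. *)
have p2 : 0 < (2^-1 : R) by rewrite invr_gt0.
have p21 : (2^-1 : R) < 1 by rewrite invf_lt1// ltr1n.
have [ex [dm [dmE dmC]] _] := model_pinched b m0 p2 p21.
have [eps [e0 de]] : exists eps : R, 0 < eps /\ delta < dm eps.
  near (0 : R)^'+ => eps; exists eps; split; first by near: eps; exact: nbhs_right_gt.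
  by near: eps; exact: (cvgr_gt _ dmC _ d1).
rewrite NE; do 5!eexists; split; [exact: (ex _ e0)|exact: (dmE _ e0)|exact: de].
Unshelve. all: by end_near.
Qed.
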